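(* Let $k\in\mathbb N$ and suppose $\lim_{n\to\infty}nr_n^d=0$ and $\lim_{n\to\infty}n(nr_n^d)^{k-1}=\infty$. Then, as $n\to\infty$ (with $r=r_n$), $$I_{n,k}\sim\frac1{k!}\,n(nr^d)^{k-1}\int_{\mathbb R^d}f(x)^k\,dx\int_{(\mathbb R^d)^{k-1}}h_1((o,\mathbf x))\,d\mathbf x,$$ $$\mathrm{Var}[S'_{n,k}]=I_{n,k}\big(1+O((nr^d)^k)\big),\qquad d_{\mathrm{TV}}(S'_{n,k},Z_{I_{n,k}})=O\big((nr^d)^k\big),$$ $$d_{\mathrm K}\big((\mathrm{Var}\,S'_{n,k})^{-1/2}(S'_{n,k}-\mathbb E S'_{n,k}),\mathcal N\big)=O\Big(\max\big((nr^d)^k,\ (n(nr^d)^{k-1})^{-1/2}\big)\Big).$$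
   Context: Setting. Let $d\in\mathbb N$, and let $X_1,X_2,\ldots$ be i.i.d. random vectors in $\mathbb R^d$ with a common probability density $f$ that is bounded ($f_{\max}:=\sup f<\infty$); no other assumption is made on $f$ or its support. For $t>0$, $Z_t$ denotes a Poisson random variable with mean $t$. For $n>0$ take $Z_n$ independent of $(X_i)$ and let $\mathcal P_n=\{X_1,\ldots,X_{Z_n}\}$ (a Poisson process with intensity $nf$). For finite $\mathcal X\subset\mathbb R^d$ and $r>0$, $G(\mathcal X,r)$ is the graph on $\mathcal X$ with an edge between each pair of distinct points at Euclidean distance at most $r$, and $S'_{n,k}$ is the number of connected components of $G(\mathcal P_n,r_n)$ with exactly $k$ vertices; $I_{n,k}=\mathbb E[S'_{n,k}]$. Here $r_n>0$ is a given sequence. $o$ is the origin. For $\mathbf x=(x_1,\ldots,x_{k-1})\in(\mathbb R^d)^{k-1}$, $h_1((o,\mathbf x))$ is the indicator that $G(\{o,x_1,\ldots,x_{k-1}\},1)$ is connected; when $k=1$ the integral over $(\mathbb R^d)^{0}$ is interpreted as $1$. $a_n\sim b_n$ means $a_n/b_n\to1$. $\mathcal N$ is a standard normal variable. $d_{\mathrm K}(X,Y)=\sup_{z}|\Pr[X\le z]-\Pr[Y\le z]|$ and $d_{\mathrm{TV}}(X,Y)=\sup_E|\Pr[X\in E]-\Pr[Y\in E]|$ over Borel $E\subset\mathbb R$. *)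

(* Defs.v *)
From HB Require Import structures.
From mathcomp Require Import all_boot all_order all_algebra finmap.
From mathcomp Require Import all_classical all_reals all_analysis.
From mathcomp Require Import measurable_realfun.

Set Implicit Arguments.
Unset Strict Implicit.
Unset Printing Implicit Defensive.
Import Order.TTheory GRing.Theory Num.Theory.
Import numFieldNormedType.Exports.

Local Open Scope classical_set_scope.
Local Open Scope ring_scope.

Section power_measure.
Context d (T : measurableType d) (R : realType).

Definition tcons n (x : T * n.-tuple T) : n.+1.-tuple T :=
  [tuple of x.1 :: x.2].

Lemma measurable_tcons n : measurable_fun [set: T * n.-tuple T] (@tcons n).
Proof. exact: measurable_cons. Qed.

(* `mu \x nu` carried over to n.+1-tuples *)
Section step.
Variables (mu : {sigma_finite_measure set T -> \bar R}) (n : nat).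
Variable nu : {sigma_finite_measure set (n.-tuple T) -> \bar R}.

Definition cons_measure : set (n.+1.-tuple T) -> \bar R :=
  pushforward (mu \x nu)%E (@tcons n).

Let m := measure_function_pushforward__canonical__measure_function_Measure 
  (mu \x nu)%E (@measurable_tcons n).
HB.instance Definition _ := Measure.copy cons_measure m.

Let cons_measure_sigma_finite : sigma_finite setT cons_measure.
Proof.
have /sigma_finiteP[F [TF ndF Foo]] := sigma_finiteT mu.
have /sigma_finiteP[G [TG ndG Goo]] := sigma_finiteT nu.
pose g (t : n.+1.-tuple T) := (thead t, [tuple of behead t]).
have mg : measurable_fun setT g.
  by apply/measurable_fun_pair; [exact: measurable_tnth|exact: measurable_behead].
have gK : cancel (@tcons n) g.
  by move=> [x t]; rewrite /g /tcons theadE; congr pair; exact/val_inj.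
exists (fun i => g @^-1` (F i `*` G i)) => [|i].
  rewrite -preimage_bigcup (_ : \bigcup_i _ = setT) ?preimage_setT//.
  rewrite -setXTT TF TG predeqE => -[x y]; split=> [|[/= [q _ Fm] [p _ Gp]]].
    by move=> [q _ []/= ? ?]; split; exists q.
  exists (maxn q p) => //; split.
  - by move: x Fm; exact/subsetPset/ndF/leq_maxl.
  - by move: y Gp; exact/subsetPset/ndG/leq_maxr.
have [mF Fi] := Foo i; have [mG Gi] := Goo i; split.
  by rewrite -[X in measurable X]setTI; apply: mg => //; exact: measurableX.
rewrite /cons_measure /pushforward -comp_preimage (_ : g \o _ = id); last first.
  by apply/funext => x /=; rewrite gK.
by rewrite preimage_id product_measure1E// lte_mul_pinfty// ge0_fin_numE.
Qed.

HB.instance Definition _ := Measure_isSigmaFinite.Build _ _ _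
  cons_measure cons_measure_sigma_finite.

End step.

(* The library has product measures on pairs only.  The n-fold power is built
   here on n-tuples; for n = 0 it is the unit mass on the empty tuple, so that
   an integral over T^0 is the value of the integrand at the empty tuple. *)
Fixpoint power_measure (mu : {sigma_finite_measure set T -> \bar R}) n :
    {sigma_finite_measure set (n.-tuple T) -> \bar R} :=
  match n with
  | 0 => \d_[tuple]
  | n'.+1 => cons_measure mu (power_measure mu n')
  end.

End power_measure.

Lemma power_measureX d (T : measurableType d) (R : realType)
    (mu : {sigma_finite_measure set T -> \bar R}) n (A : 'I_n -> set T) :
    (forall i, measurable (A i)) ->
  power_measure mu n [set t | forall i, A i (tnth t i)] =
    (\prod_(i < n) mu (A i))%E.
Proof.
elim: n A => [|n IH] A mA.
  rewrite big_ord0 /= diracE mem_set// => -[].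
  by [].
pose B := [set t : n.-tuple T | forall i, A (lift ord0 i) (tnth t i)].
have mB : measurable B.
  rewrite (_ : B = \bigcap_(i in [set: 'I_n])
      ((@tnth n T)^~ i @^-1` A (lift ord0 i))).
    apply: fin_bigcap_measurable => // i _; rewrite -[X in measurable X]setTI.
    exact: measurable_tnth.
  by apply/seteqP; split=> [t Bt i _|t Bt i]; exact: Bt.
rewrite big_ord_recl -IH//= -product_measure1E// /cons_measure /pushforward.
congr (_ _).
apply/seteqP; split=> [[x t] /= H|[x t] /= [Ax Bt] i].
  split; first exact: (H ord0).
  by move=> i; have := H (lift ord0 i); rewrite tnthS.
by case: (unliftP ord0 i) => [j|] ->//; rewrite tnthS; exact: Bt.
Qed.

Section lebesgue.
Variable R : realType.

(* `lebesgue_measure` lives on `measurableTypeR R`; this is the same set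
   function on the measurable type `R` itself. *)
Definition lebesgueR : set R -> \bar R := @lebesgue_measure R.

HB.instance Definition _ := isMeasure.Build _ R R lebesgueR
  (measure0 (@lebesgue_measure R)) (measure_ge0 (@lebesgue_measure R))
  (@measure_semi_sigma_additive _ _ _ (@lebesgue_measure R)).
HB.instance Definition _ := Measure_isSigmaFinite.Build _ R R lebesgueR
  (@sigma_finiteT _ _ _ (@lebesgue_measure R)).

Definition lebesgue d : {sigma_finite_measure set (d.-tuple R) -> \bar R} :=
  power_measure lebesgueR d.

End lebesgue.
Arguments lebesgue {R} d.

Section geometric_graph.
Variables (R : realType) (d : nat).

Definition edist (x y : d.-tuple R) : R :=
  Num.sqrt (\sum_(i < d) (tnth x i - tnth y i) ^+ 2).

Variables (A : {fset d.-tuple R}) (r : R).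

Definition adjacent : rel A :=
  [rel x y | (x != y) && (edist (val x) (val y) <= r)].

(* the vertex sets of the connected components *)
Definition components : {set {set A}} :=
  equivalence_partition (connect adjacent) [set: A]%SET.

Definition graph_connected : bool := #|components| == 1%N.

Definition ncomponents k : nat := #|[set C in components | #|C| == k]%SET|.

End geometric_graph.

Definition origin {R : realType} d : d.-tuple R := [tuple 0 | i < d].

Definition h1 {R : realType} {d k} (x : k.-tuple (d.-tuple R)) : R :=
  (graph_connected [fset y in origin d :: x]%fset 1)%:R.

Lemma connect_homo (T1 T2 : finType) (e1 : rel T1) (e2 : rel T2)
    (f : T1 -> T2) :
  (forall x y, e1 x y -> e2 (f x) (f y)) ->
  forall x y, connect e1 x y -> connect e2 (f x) (f y).
Proof.
move=> ef x _ /connectP[p ep ->]; apply/connectP; exists (map f p).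
  by elim: p x ep => //= z p IH x /andP[/ef -> /IH].
by rewrite last_map.
Qed.

Lemma leq_components (T1 T2 : finType) (e1 : rel T1) (e2 : rel T2)
    (f : T1 -> T2) (g : T2 -> T1) k : cancel f g -> cancel g f ->
  (forall x y, e1 x y -> e2 (f x) (f y)) ->
  (forall x y, e2 x y -> e1 (g x) (g y)) ->
  (#|[set C in equivalence_partition (connect e1) [set: T1] | #|C| == k]%SET| <=
   #|[set C in equivalence_partition (connect e2) [set: T2] | #|C| == k]%SET|)%N.
Proof.
move=> fK gK ef eg; have fI := can_inj fK.
rewrite -(card_imset _ (imset_inj fI)); apply/subset_leq_card/fintype.subsetP => D.
move=> /imsetP[C + ->]; rewrite !inE => /andP[/imsetP[x _ ->] Ck].
rewrite card_imset// Ck andbT; apply/imsetP; exists (f x); first by rewrite inE.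
apply/finset.setP => y; rewrite !inE; apply/imsetP/idP => [[z]|xy].
  by rewrite !inE => xz ->; exact: connect_homo xz.
exists (g y); last by rewrite gK.
by rewrite !inE -[x]fK; exact: connect_homo xy.
Qed.

(* The component count depends on the points only through finitely many
   comparisons of distances, hence it is measurable. *)
Section measurability.
Variables (R : realType) (d : nat) (r : R).

Definition pattern m (x : 'I_m -> d.-tuple R) :=
  [ffun p => (x p.1 == x p.2, edist (x p.1) (x p.2) <= r)]
    : {ffun 'I_m * 'I_m -> bool * bool}.

Lemma leq_ncomponents_pattern k m (x y : 'I_m -> d.-tuple R) :
  pattern x = pattern y ->
  (ncomponents [fset x i | i : 'I_m]%fset r k <=
   ncomponents [fset y i | i : 'I_m]%fset r k)%N.
Proof.
move=> xy.
have xyP i j : (x i == x j) = (y i == y j) /\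
    (edist (x i) (x j) <= r) = (edist (y i) (y j) <= r).
  by move/ffunP: xy => /(_ (i, j)); rewrite !ffunE => -[].
have xyE i j := (xyP i j).1; have xyd i j := (xyP i j).2.
have idx (z : 'I_m -> d.-tuple R) : {h : [fset z i | i : 'I_m]%fset -> 'I_m |
    forall a, z (h a) = val a}.
  have zP (a : [fset z i | i : 'I_m]%fset) : {i | z i == val a}.
    by apply/sigW; have /imfsetP[/= i _ ->] := valP a; exists i.
  by exists (fun a => sval (zP a)) => a; exact/eqP/(svalP (zP a)).
have [hx hxE] := idx x; have [hy hyE] := idx y.
have inz (z : 'I_m -> d.-tuple R) i : z i \in [fset z i | i : 'I_m]%fset.
  exact: in_imfset.
pose f a := [` inz y (hx a)]%fset.
pose g b := [` inz x (hy b)]%fset.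
have fK : cancel f g.
  by move=> a; apply/val_inj => /=; apply/eqP; rewrite -hxE xyE hyE.
have gK : cancel g f.
  by move=> a; apply/val_inj => /=; apply/eqP; rewrite -hyE -xyE hxE.
apply: (leq_components _ fK gK) => a b /=.
- by rewrite /adjacent /= -[f a == f b]val_eqE -val_eqE /= -xyE -xyd !hxE.
- by rewrite /adjacent /= -[g a == g b]val_eqE -val_eqE /= xyE xyd !hyE.
Qed.

Lemma measurable_edist d0 (Omega : measurableType d0) (x y : Omega -> d.-tuple R) :
  measurable_fun setT x -> measurable_fun setT y ->
  measurable_fun setT (fun w => edist (x w) (y w)).
Proof.
move=> mx my; apply: (measurableT_comp (f := @Num.sqrt R)).
  by apply: continuous_measurable_fun; exact: sqrt_continuous.
apply: measurable_sum => i; apply: measurable_funX; apply: measurable_funB.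
- exact: (measurableT_comp (measurable_tnth i)).
- exact: (measurableT_comp (measurable_tnth i)).
Qed.

Lemma edist_eq0 (x y : d.-tuple R) : (edist x y <= 0) = (x == y).
Proof.
apply/idP/eqP => [|->]; last first.
  by rewrite /edist big1 ?sqrtr0// => i _; rewrite subrr expr0n.
rewrite -sqrtr0 ler_sqrt//.
move=> s0; apply/eq_from_tnth => i; apply/eqP.
rewrite -subr_eq0 -sqrf_eq0 eq_le sqr_ge0 andbT; apply: le_trans s0.
by rewrite (bigD1 i)//= lerDl sumr_ge0// => j _; exact: sqr_ge0.
Qed.

Lemma measurable_pattern d0 (Omega : measurableType d0) m
    (x : 'I_m -> Omega -> d.-tuple R) p :
  (forall i, measurable_fun setT (x i)) ->
  measurable [set w | pattern (x ^~ w) = p].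
Proof.
move=> mx.
have mb i j c b : measurable [set w | (edist (x i w) (x j w) <= c) = b].
  have mE := measurable_edist (mx i) (mx j).
  have := @measurable_fun_ler _ _ _ _ _ _ mE (measurable_cst c).
  by move=> /(_ measurableT [set b] I); rewrite setTI; exact.
rewrite (_ : [set _ | _] = \bigcap_(ij in [set: 'I_m * 'I_m])
  ([set w | (edist (x ij.1 w) (x ij.2 w) <= 0) = (p ij).1] `&`
   [set w | (edist (x ij.1 w) (x ij.2 w) <= r) = (p ij).2])).
  by apply: fin_bigcap_measurable => // ij _; exact: measurableI.
apply/seteqP; split=> [w /= <- [i j] _|w /= H].
  by rewrite ffunE/= edist_eq0.
apply/ffunP => ij; have [/= H1 H2] := H ij I.
by rewrite ffunE -edist_eq0 H1 H2 -surjective_pairing.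
Qed.

End measurability.

Section random_graph.
Context d0 (Omega : measurableType d0) (R : realType) (P : probability Omega R).
Variables (d : nat) (X : nat -> {RV P >-> d.-tuple R}) (N : {RV P >-> nat}).

(* The random set of points X_1, ..., X_N; the sequence is indexed from 0. *)
Definition sample (w : Omega) : {fset d.-tuple R} :=
  [fset X (val i) w | i : 'I_(N w)]%fset.

Variables (r : R) (k : nat).

Definition nb_components (w : Omega) : R := (ncomponents (sample w) r k)%:R.

Lemma measurable_nb_components : measurable_fun setT nb_components.
Proof.
move=> _ Y mY; rewrite setTI.
pose x m w (i : 'I_m) := X i w.
rewrite (_ : _ @^-1` _ = \bigcup_(m in setT) (N @^-1` [set m] `&`
  \bigcup_(p in [set p | exists2 w, pattern r (@x m w) = p &
      Y (ncomponents [fset x m w i | i : 'I_m]%fset r k)%:R])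
    [set w | pattern r (@x m w) = p])).
  apply: bigcupT_measurable => m; apply: measurableI.
    by rewrite -[X in measurable X]setTI; exact: measurable_funP.
  apply: fin_bigcup_measurable => [|p _]; first exact: finite_finset.
  by apply: measurable_pattern => i; exact: measurable_funP.
apply/seteqP; split=> [w Yw|w [m _ [/= Nm [p [w' w'p Yw'] wp]]]].
  exists (N w) => //; split => //.
  by exists (pattern r (@x (N w) w)) => //; exists w.
rewrite /= /nb_components /sample Nm.
suff <- : ncomponents [fset x m w' i | i : 'I_m]%fset r k =
  ncomponents [fset x m w i | i : 'I_m]%fset r k by [].
apply/eqP; rewrite eqn_leq.
by rewrite !leq_ncomponents_pattern// wp w'p.
Qed.

HB.instance Definition _ :=
  isMeasurableFun.Build _ _ _ _ nb_components measurable_nb_components.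

End random_graph.

Section independence.
Context d0 (Omega : measurableType d0) (R : realType) (P : probability Omega R).

Definition mutually_independent d1 (T : measurableType d1)
    (X : nat -> {RV P >-> T}) : Prop :=
  forall (J : {fset nat}) (A : nat -> set T), (forall i, measurable (A i)) ->
    P (\bigcap_(i in [set` J]) X i @^-1` A i) =
      (\prod_(i <- J) P (X i @^-1` A i))%E.

(* independence of Z from the sigma-algebra generated by all the X i *)
Definition independent_of_sequence d1 d2 (T1 : measurableType d1)
    (T2 : measurableType d2) (Z : {RV P >-> T1}) (X : nat -> {RV P >-> T2}) :
    Prop :=
  forall B E, measurable B ->
    <<s \bigcup_i preimage_set_system setT (X i) measurable >> E ->
    P (Z @^-1` B `&` E) = (P (Z @^-1` B) * P E)%E.

(* Integrating f over the whole space gives 1, so f is normalized. *)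
Definition has_density d (X : {RV P >-> d.-tuple R}) (f : d.-tuple R -> R) :
    Prop :=
  forall A, measurable A ->
    distribution P X A = (\int[lebesgue d]_(x in A) (f x)%:E)%E.

End independence.

Section standardization.
Context d0 (Omega : measurableType d0) (R : realType) (P : probability Omega R).
Variable Y : {RV P >-> R}.

Definition standardize (w : Omega) : R :=
  (Num.sqrt (fine 'V_P[Y]))^-1 * (Y w - fine 'E_P[Y]).

Let measurable_standardize : measurable_fun setT standardize.
Proof. by apply: measurable_funM => //; exact: measurable_funB. Qed.

HB.instance Definition _ :=
  isMeasurableFun.Build _ _ _ _ standardize measurable_standardize.

End standardization.

Section distances.
Variable R : realType.

(* Distances between random variables depend on their laws only, so they are
   defined on laws. *)
Definition dTV (mu nu : set R -> \bar R) : R :=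
  sup [set `|fine (mu E) - fine (nu E)| | E in measurable].

Definition dK (mu nu : set R -> \bar R) : R :=
  sup (range (fun z : R => `|fine (mu `]-oo, z]%classic) - fine (nu `]-oo, z]%classic)|)).

(* The law of a Poisson variable of mean t, as a law on R; the second argument
   of `poisson_prob` is not used by its definition. *)
Definition poisson_law (t : R) : set R -> \bar R :=
  pushforward (poisson_prob t 0) (fun m : nat => m%:R : R).

End distances.

(* Main.v *)
Require Import Defs.
From HB Require Import structures.
From mathcomp Require Import all_boot all_order all_algebra finmap.
From mathcomp Require Import all_classical all_reals all_analysis.
From mathcomp Require Import measurable_realfun.
From mathcomp Require Import ring lra.

Set Implicit Arguments.
Unset Strict Implicit.
Unset Printing Implicit Defensive.
Import Order.TTheory GRing.Theory Num.Theory.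
Import numFieldNormedType.Exports.

Local Open Scope classical_set_scope.
Local Open Scope ring_scope.

(** Write W for the number of components with k vertices, lam for its mean, rho
    for n r^d and Q for C rho^k.  By the Mecke formula, E[W g(W)] is an integral
    over k-point sets a of E[1(a is an isolated component of a + P_n) g(W + 1)].
    A connected a constrains P_n only near a: conditionally on the points near a
    being absent, the remaining points are again a Poisson process, and replacing
    it by P_n changes W by at most the number of k-subsets of P_n inside a box
    of side O(r), whose mean is at most Q.  Hence
    |E[W g(W)] - lam E[g(W + 1)]| <= lam L Q for every L-Lipschitz g >= 0.
    Taking g = id gives the variance; taking for g the solution of the Poisson
    Stein equation, which is 1/lam-Lipschitz, gives the bound Q on the total
    variation distance.  The Kolmogorov bound then follows from a Berry-Esseen
    bound O(lam^(-1/2)) for the Poisson law, proved by a discretized version of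
    the Gaussian Stein equation.  For the mean, the substitution
    x_i = x + r y_i turns the integral over connected k-point sets into
    r^(d (k - 1)) times the integral of h1(y) int f(x) prod f(x + r y_i) dx,
    and the inner integral converges to int f^k by L1-continuity of
    translations and boundedness of f. *)

(** * Functions of finite lists of points *)

(** A Poisson process enters only through [pint], an explicit series of integrals over tuples:
    conditioning, thinning and the Mecke formula become identities between series, and no random
    measure is built. The price is that a list may repeat a point whereas the graph lives on a set;
    a law with a density on R^d, d > 0, has no atoms, so repetitions are discarded almost surely.
    Integrals take extended real values, which would make every subtraction conditional on
    finiteness. Hence the Stein identity is stated for g >= 0 as two one-sided inequalities, and
    solutions of Stein equations are shifted to become nonnegative. After conditioning, the
    comparison is made on one and the same configuration, with and without its points near a, so no
    coupling has to be constructed. The resulting error Q depends on a only through one box, and its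
    factor lam is cancelled exactly by the Lipschitz constant 1/lam; this is why the total variation
    rate is rho^k itself, without a power of the mean. *)

Section splits.
Context {T : Type}.

(* All ways of choosing k entries of s: the pairs (chosen entries, remaining entries). *)
Fixpoint splits k (s : seq T) : seq (seq T * seq T) :=
  match s with
  | [::] => if k is 0%N then [:: ([::], [::])] else [::]
  | x :: s' =>
    (if k is k'.+1 then [seq (x :: p.1, p.2) | p <- splits k' s'] else [::])
      ++ [seq (p.1, x :: p.2) | p <- splits k s']
  end.

Lemma splits0 s : splits 0 s = [:: ([::], s)].
Proof. by elim: s => //= x s ->. Qed.

End splits.

Section splits_eqType.
Context {T : eqType}.
Implicit Type s : seq T.

Lemma splits_size k s p : p \in splits k s -> size p.1 = k.
Proof.
elim: s k p => /= [|x s IH] [|k] p //=.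
- by rewrite inE => /eqP ->.
- by move=> /mapP[q /IH qs ->].
- by rewrite mem_cat => /orP[] /mapP[q /IH qs ->] //=; rewrite qs.
Qed.

Lemma splits_perm k s p : p \in splits k s -> perm_eq (p.1 ++ p.2) s.
Proof.
elim: s k p => /= [|x s IH] [|k] p //=.
- by rewrite inE => /eqP ->.
- move=> /mapP[q /IH qs ->] /=.
  by rewrite -[x :: q.2]cat1s perm_catCA /= perm_cons.
- rewrite mem_cat => /orP[] /mapP[q /IH qs ->] //=; first by rewrite perm_cons.
  by rewrite -[x :: q.2]cat1s perm_catCA /= perm_cons.
Qed.

End splits_eqType.

Section measurable_lists.
Context d (T : measurableType d) (R : realType).

(** List-valued maps of constant length, built one measurable entry at a time: closure under [take],
    [drop] and [++] is then an induction, without tuple casts. *)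
Inductive mlist d' (W : measurableType d') : (W -> seq T) -> Prop :=
| mlist_nil : mlist (fun=> [::])
| mlist_cons x g : measurable_fun setT x -> mlist g ->
    mlist (fun w => x w :: g w).

(* Functions of a finite point configuration are represented by functions on
   lists, measurable on the tuples of each length. *)
Definition mseq (F : seq T -> \bar R) :=
  forall m, measurable_fun setT (fun t : m.-tuple T => F t).

Definition mseq2 (F : seq T -> seq T -> \bar R) :=
  forall i j, measurable_fun setT (fun p : i.-tuple T * j.-tuple T => F p.1 p.2).

Lemma mlist_tuple d' (W : measurableType d') (g : W -> seq T) : mlist g ->
  exists n (t : W -> n.-tuple T), measurable_fun setT t /\ g = fun w => t w.
Proof.
elim=> [|x {}g mx _ [n [t [mt ->]]]].
  by exists 0%N, (fun=> [tuple]).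
exists n.+1, (fun w => [tuple of x w :: t w]); split => //.
exact: measurable_cons.
Qed.

Lemma mlist_tval d' (W : measurableType d') n (t : W -> n.-tuple T) :
  measurable_fun setT t -> mlist (fun w => t w : seq T).
Proof.
elim: n t => [|n IH] t mt.
  rewrite (_ : (fun w => _) = fun=> [::]); first exact: mlist_nil.
  by apply/funext => w; rewrite tuple0.
rewrite (_ : (fun w => _) = fun w => thead (t w) :: [tuple of behead (t w)]).
  apply: mlist_cons; first exact: (measurableT_comp (measurable_tnth ord0)).
  have mb : measurable_fun setT (fun w => [tuple of behead (t w)] : n.-tuple T).
    apply/measurable_fun_tnthP => i.
    rewrite (_ : _ \o _ = fun w => tnth (t w) (lift ord0 i)); last first.
      by apply/funext => w /=; rewrite [in RHS](tuple_eta (t w)) tnthS.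
    exact: (measurableT_comp (measurable_tnth (lift ord0 i))).
  exact: IH mb.
by apply/funext => w; rewrite [in LHS](tuple_eta (t w)).
Qed.

Lemma mlist_cat d' (W : measurableType d') (g h : W -> seq T) :
  mlist g -> mlist h -> mlist (fun w => g w ++ h w).
Proof. by move=> mg mh; elim: mg => //= x f mx mf; exact: mlist_cons. Qed.

Lemma mlist_take d' (W : measurableType d') (g : W -> seq T) k :
  mlist g -> mlist (fun w => take k (g w)).
Proof.
move=> mg; elim: mg k => /= [|x f mx mf IH] k; first exact: mlist_nil.
by case: k => [|k]; [exact: mlist_nil|exact: mlist_cons].
Qed.

Lemma mlist_drop d' (W : measurableType d') (g : W -> seq T) k :
  mlist g -> mlist (fun w => drop k (g w)).
Proof.
move=> mg; elim: mg k => /= [|x f mx mf IH] k; first exact: mlist_nil.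
by case: k => [|k]; [exact: mlist_cons|exact: IH].
Qed.

Lemma mlist_cst d' (W : measurableType d') (s : seq T) : mlist (fun _ : W => s).
Proof. by elim: s => [|x s IH]; [exact: mlist_nil|exact: mlist_cons]. Qed.

Lemma mseq_mlist F d' (W : measurableType d') (g : W -> seq T) :
  mseq F -> mlist g -> measurable_fun setT (fun w => F (g w)).
Proof.
move=> mF /mlist_tuple[n [t [mt ->]]].
exact: (measurableT_comp (mF n) mt).
Qed.

Lemma mseq2_mlist F d' (W : measurableType d') (g h : W -> seq T) :
  mseq2 F -> mlist g -> mlist h -> measurable_fun setT (fun w => F (g w) (h w)).
Proof.
move=> mF /mlist_tuple[n [t [mt ->]]] /mlist_tuple[m [u [mu ->]]].
apply: (measurableT_comp (f := fun p => F (tval p.1) (tval p.2))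
  (g := fun w => (t w, u w))); first exact: mF.
exact: measurable_fun_pair.
Qed.

Lemma mseq2r F a : mseq2 F -> mseq (F a).
Proof.
move=> mF m; apply: mseq2_mlist => //; last exact: mlist_tval.
by elim: a => [|x b IH]; [exact: mlist_nil|exact: mlist_cons].
Qed.

Lemma mseq_cons F x : mseq F -> mseq (fun s => F (x :: s)).
Proof.
move=> mF m; apply: mseq_mlist => //.
by apply: mlist_cons => //; exact: mlist_tval.
Qed.

(** [F] depends on [w] so that the induction can absorb the first point of the list into it, on the
    chosen or on the remaining side. *)
Lemma measurable_splits d' (W : measurableType d') (g : W -> seq T) k
  (F : W -> seq T -> seq T -> \bar R) :
  (forall a b, mlist a -> mlist b -> measurable_fun setT (fun w => F w (a w) (b w))) ->
  (forall w a b, (0 <= F w a b)%E) ->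
  mlist g ->
  measurable_fun setT (fun w => \sum_(p <- splits k (g w)) F w p.1 p.2)%E.
Proof.
move=> mF F0 mg; elim: mg k F mF F0 => [|x {}g mx mg IH] k F mF F0.
  case: k => [|k] /=.
    under eq_fun do rewrite big_seq1.
    by apply: mF; exact: mlist_nil.
  by under eq_fun do rewrite big_nil; exact: measurable_cst.
case: k => [|k] /=.
  under eq_fun do rewrite splits0 big_seq1.
  by apply: mF; [exact: mlist_nil|exact: mlist_cons].
under eq_fun do rewrite big_cat !big_map.
apply: emeasurable_funD.
  apply: (IH k (fun w a b => F w (x w :: a) b)) => // a b ma mb.
  by apply: mF => //; exact: mlist_cons.
apply: (IH k.+1 (fun w a b => F w a (x w :: b))) => // a b ma mb.
by apply: mF => //; exact: mlist_cons.
Qed.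

Lemma mseq_splits k F : mseq2 F -> (forall a b, (0 <= F a b)%E) ->
  mseq (fun s => \sum_(p <- splits k s) F p.1 p.2)%E.
Proof.
move=> mF F0 m.
apply: (@measurable_splits _ (m.-tuple T) (fun t => t) k (fun _ => F)) => //.
  by move=> a b ma mb; exact: mseq2_mlist.
exact: mlist_tval.
Qed.

End measurable_lists.

Section iterated_integral.
Context d (T : measurableType d) (R : realType).
Variable mu : {sigma_finite_measure set T -> \bar R}.
Local Open Scope ereal_scope.

Definition iint m (F : seq T -> \bar R) : \bar R :=
  \int[power_measure mu m]_t F (tval t).

Lemma iint0 F : mseq F -> iint 0 F = F [::].
Proof.
move=> mF; rewrite /iint /=.
rewrite integral_dirac//; last exact: mF.
have -> : \d_[tuple] [set: 0.-tuple T] = 1 :> \bar R by rewrite /dirac indicE in_setT.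
by rewrite mul1e.
Qed.

Lemma iint_ge0 m F : (forall s, 0 <= F s) -> 0 <= iint m F.
Proof. by move=> F0; exact: integral_ge0. Qed.

Lemma le_iint m F G : (forall s, 0 <= F s) ->  mseq F -> mseq G ->
  (forall s, size s = m -> F s <= G s) -> iint m F <= iint m G.
Proof.
move=> F0 mF mG FG; apply: ge0_le_integral => //; [exact: mF|exact: mG|].
by move=> t _; apply: FG; rewrite size_tuple.
Qed.

Lemma eq_iint m F G : (forall s, size s = m -> F s = G s) -> iint m F = iint m G.
Proof.
by move=> FG; apply: eq_integral => /= t _; apply: FG; rewrite size_tuple.
Qed.

Lemma iintS m F : (forall s, 0 <= F s) -> mseq F ->
  iint m.+1 F = \int[mu]_x iint m (fun s => F (x :: s)).
Proof.
move=> F0 mF; rewrite /iint /=.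
rewrite (ge0_integral_pushforward (@measurable_tcons _ T m))//=; last first.
  exact: mF.
rewrite preimage_setT.
rewrite (@fubini_tonelli1 _ _ _ _ _ _ _ ((fun t : m.+1.-tuple T => F t) \o @tcons _ T m))//=.
by apply: measurableT_comp; [exact: mF|exact: measurable_tcons].
Qed.

Lemma measurable_iint d' (W : measurableType d') m (F : W -> seq T -> \bar R) :
  (forall w s, 0 <= F w s) ->
  measurable_fun setT (fun p : W * m.-tuple T => F p.1 p.2) ->
  measurable_fun setT (fun w => iint m (F w)).
Proof.
move=> F0 mF; by apply: (measurable_fun_fubini_tonelli_F
  (m2 := power_measure mu m) (fun p : W * m.-tuple T => F p.1 p.2)) => //.
Qed.

Lemma measurable_iint_mlist d' (W : measurableType d') m (F : seq T -> \bar R)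
   (g : W * m.-tuple T -> seq T) :
  (forall s, 0 <= F s) -> mseq F -> mlist g ->
  measurable_fun setT (fun w => \int[power_measure mu m]_t F (g (w, t))).
Proof.
move=> F0 mF mg.
apply: (measurable_fun_fubini_tonelli_F (m2 := power_measure mu m) (F \o g)).
  exact: mseq_mlist.
by move=> p; exact: F0.
Qed.

(** The product measure is symmetric: in the induction, Tonelli exchanges the inserted variable with
    the head of the list. If [k] exceeds [m], the variable simply comes last. *)
Lemma iint_insert m k F : (forall s, 0 <= F s) -> mseq F ->
  \int[mu]_x iint m (fun s => F (take k s ++ x :: drop k s)) = iint m.+1 F.
Proof.
elim: m k F => [|m IH] k F F0 mF.
  rewrite iintS//; apply: eq_integral => x _.
  by apply: eq_iint => s /size0nil ->.
case: k => [|k].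
  by rewrite iintS//; apply: eq_integral => x _; apply: eq_iint => s _; rewrite take0 drop0.
rewrite [RHS]iintS//.
under [RHS]eq_integral => x _.
  rewrite -(IH k)//; last exact: mseq_cons.
  over.
under [LHS]eq_integral => x _.
  rewrite iintS//; last first.
    move=> n; apply: mseq_mlist => //.
    apply: mlist_cat; first by apply: mlist_take; exact: mlist_tval.
    by apply: mlist_cons => //; apply: mlist_drop; exact: mlist_tval.
  over.
rewrite (fubini_tonelli (fun p => iint m (fun s => F (take k.+1 (p.2 :: s) ++ p.1 :: drop k.+1 (p.2 :: s)))))//=.
  apply: (@measurable_iint_mlist _ _ m F (fun p => p.1.2 :: take k p.2 ++ p.1.1 :: drop k p.2)) => //.
  apply: mlist_cons; first exact: measurableT_comp.
  apply: mlist_cat; first by apply: mlist_take; exact: mlist_tval.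
  apply: mlist_cons; first exact: measurableT_comp.
  by apply: mlist_drop; exact: mlist_tval.
by move=> p; exact: iint_ge0.
Qed.

End iterated_integral.

Section mecke.
Context d (T : measurableType d) (R : realType).
Variable mu : {sigma_finite_measure set T -> \bar R}.
Local Open Scope ereal_scope.

Notation iint := (iint mu).

Lemma mseqD (F G : seq T -> \bar R) : mseq F -> mseq G -> mseq (fun s => F s + G s).
Proof. by move=> mF mG m; apply: emeasurable_funD; [exact: mF|exact: mG]. Qed.

Lemma mseqM (F G : seq T -> \bar R) : mseq F -> mseq G -> mseq (fun s => F s * G s).
Proof. by move=> mF mG m; apply: emeasurable_funM; [exact: mF|exact: mG]. Qed.

Lemma mseq_cst (c : \bar R) : mseq (fun _ : seq T => c).
Proof. by move=> m; exact: measurable_cst. Qed.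

Lemma iintD m F G : (forall s, 0 <= F s) -> (forall s, 0 <= G s) ->
  mseq F -> mseq G -> iint m (fun s => F s + G s) = iint m F + iint m G.
Proof.
by move=> F0 G0 mF mG; rewrite /iint ge0_integralD//; [exact: mF|exact: mG].
Qed.

Lemma iintZl m (c : \bar R) F : 0 <= c -> (forall s, 0 <= F s) -> mseq F ->
  iint m (fun s => c * F s) = c * iint m F.
Proof. by move=> c0 F0 mF; rewrite /iint ge0_integralZl//; exact: mF. Qed.

Lemma iint_nneseries m (F : nat -> seq T -> \bar R) : (forall i s, 0 <= F i s) ->
  (forall i, mseq (F i)) ->
  iint m (fun s => \sum_(i <oo) F i s) = \sum_(i <oo) iint m (F i).
Proof. by move=> F0 mF; rewrite /iint integral_nneseries//= => i; exact: mF. Qed.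

Lemma mseq2_consl (F : seq T -> seq T -> \bar R) x : mseq2 F -> mseq2 (fun a => F (x :: a)).
Proof.
move=> mF i j; apply: (mseq2_mlist mF).
  by apply: mlist_cons => //; exact: mlist_tval.
exact: mlist_tval.
Qed.

Lemma mseq2_consr (F : seq T -> seq T -> \bar R) x : mseq2 F -> mseq2 (fun a b => F a (x :: b)).
Proof.
move=> mF i j; apply: (mseq2_mlist mF); first exact: mlist_tval.
by apply: mlist_cons => //; exact: mlist_tval.
Qed.

Lemma mseq2_take (F : seq T -> seq T -> \bar R) k : mseq2 F ->
  mseq (fun s => F (take k s) (drop k s)).
Proof.
move=> mF m; apply: (mseq2_mlist mF).
  by apply: mlist_take; exact: mlist_tval.
by apply: mlist_drop; exact: mlist_tval.
Qed.

Lemma iint_cat i j F : (forall a b, 0 <= F a b) -> mseq2 F ->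
  iint (i + j) (fun s => F (take i s) (drop i s)) = iint i (fun a => iint j (F a)).
Proof.
elim: i F => [|i IH] F F0 mF.
  under [LHS]eq_iint => s _ do rewrite take0 drop0.
  rewrite add0n [RHS]iint0// => m.
  apply: measurable_iint => //; exact: mF.
rewrite addSn iintS//; last exact: mseq2_take.
rewrite [RHS]iintS//; last 2 first.
- by move=> s; exact: iint_ge0.
- by move=> m; apply: measurable_iint => //; exact: mF.
apply: eq_integral => x _ /=.
by rewrite (IH (fun a => F (x :: a)))//; exact: mseq2_consl.
Qed.

Lemma measurable_iint_cons m F : (forall s, 0 <= F s) -> mseq F ->
  measurable_fun setT (fun x => iint m (fun s => F (x :: s))).
Proof.
move=> F0 mF.
apply: (@measurable_iint_mlist _ _ _ mu _ T m F (fun p : T * m.-tuple T => p.1 :: p.2)) => //.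
by apply: mlist_cons => //; exact: mlist_tval.
Qed.

(** By exchangeability all the ['C(m, k)] choices have the same integral. The induction separates
    the choices by the fate of the first point, and Pascal's rule adds the two binomial
    coefficients. *)
Lemma iint_splits m k F : (forall a b, 0 <= F a b) -> mseq2 F ->
  iint m (fun s => \sum_(p <- splits k s) F p.1 p.2) =
  'C(m, k)%:R%:E * iint m (fun s => F (take k s) (drop k s)).
Proof.
elim: m k F => [|m IH] k F F0 mF.
  rewrite iint0; last exact: mseq_splits.
  case: k => [|k]; rewrite /= ?big_nil ?big_seq1 ?bin0 ?bin0n ?mul0e ?mul1e//.
  by rewrite iint0//; exact: mseq2_take.
case: k => [|k].
  rewrite bin0 mul1e; apply: eq_iint => s _.
  by rewrite splits0 big_seq1 take0 drop0.
have S0 (k' : nat) (F' : seq T -> seq T -> \bar R) (F0' : forall a b, 0 <= F' a b) s :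
    0 <= \sum_(p <- splits k' s) F' p.1 p.2.
  by apply: sume_ge0.
rewrite iintS//; [|by move=> s; exact: S0|exact: mseq_splits].
transitivity (\int[mu]_x ('C(m, k)%:R%:E *
    iint m (fun s => F (x :: take k s) (drop k s)) +
  'C(m, k.+1)%:R%:E * iint m (fun s => F (take k.+1 s) (x :: drop k.+1 s)))).
  apply: eq_integral => x _ /=.
  under eq_iint => s _ do rewrite big_cat !big_map /=.
  rewrite iintD//; last 4 first.
  - by move=> s; apply: (S0 _ (fun a b => F (x :: a) b)).
  - by move=> s; apply: (S0 _ (fun a b => F a (x :: b))).
  - by apply: (@mseq_splits _ _ _ k (fun a b => F (x :: a) b)) => //; exact: mseq2_consl.
  - by apply: (@mseq_splits _ _ _ k.+1 (fun a b => F a (x :: b))) => //; exact: mseq2_consr.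
  congr (_ + _).
    by rewrite (IH k (fun a b => F (x :: a) b))//; exact: mseq2_consl.
  by rewrite (IH k.+1 (fun a b => F a (x :: b)))//; exact: mseq2_consr.
(* When the head [x] is not chosen, it comes right after the chosen entries; [iint_insert] moves it
   there from the front without changing the integral, so both branches integrate the same [G]. *)
pose G s := F (take k.+1 s) (drop k.+1 s).
have G0 s : 0 <= G s by exact: F0.
have mG : mseq G by exact: mseq2_take.
have insG x s : size s = m -> 'C(m, k.+1)%:R%:E * F (take k.+1 s) (x :: drop k.+1 s) =
   'C(m, k.+1)%:R%:E * G (take k.+1 s ++ x :: drop k.+1 s).
  move=> sm; have [km|km] := leqP k.+1 m; last by rewrite bin_small// !mul0e.
  have sk : size (take k.+1 s) = k.+1 by rewrite size_takel// sm.
  by rewrite /G take_size_cat ?drop_size_cat.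
have insm x : mseq (fun s => G (take k.+1 s ++ x :: drop k.+1 s)).
  move=> n; apply: (mseq_mlist mG).
  apply: mlist_cat; first by apply: mlist_take; exact: mlist_tval.
  by apply: mlist_cons => //; apply: mlist_drop; exact: mlist_tval.
transitivity (\int[mu]_x ('C(m, k)%:R%:E * iint m (fun s => G (x :: s)) +
  'C(m, k.+1)%:R%:E * iint m (fun s => G (take k.+1 s ++ x :: drop k.+1 s)))).
  apply: eq_integral => x _; congr (_ + _).
  rewrite -!iintZl//; first by apply: eq_iint => s; exact: insG.
  move=> n; apply: (mseq2_mlist mF); first by apply: mlist_take; exact: mlist_tval.
  by apply: mlist_cons => //; apply: mlist_drop; exact: mlist_tval.
have mi : measurable_fun setT
    (fun x => iint m (fun s => G (take k.+1 s ++ x :: drop k.+1 s))).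
  apply: (@measurable_iint_mlist _ _ _ mu _ T m G (fun p : T * m.-tuple T =>
    take k.+1 p.2 ++ p.1 :: drop k.+1 p.2)) => //.
  apply: mlist_cat; first by apply: mlist_take; exact: mlist_tval.
  by apply: mlist_cons => //; apply: mlist_drop; exact: mlist_tval.
have I0 n H : (forall s, 0 <= H s) -> 0 <= iint n H by exact: iint_ge0.
rewrite ge0_integralD//; last 4 first.
- by move=> x _; apply: mule_ge0 => //; apply: I0.
- by apply: emeasurable_funM => //; exact: measurable_iint_cons.
- by move=> x _; apply: mule_ge0 => //; apply: I0.
- exact: emeasurable_funM.
rewrite !ge0_integralZl//; [|by move=> x _; exact: I0|exact: measurable_iint_cons|by move=> x _; exact: I0].
rewrite -iintS// iint_insert// -ge0_muleDl ?lee_fin//.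
by rewrite -EFinD -natrD addnC -binS.
Qed.

End mecke.

(** * Poisson processes *)

Section poisson_mecke.
Context d (T : measurableType d) (R : realType).
Variable mu : {sigma_finite_measure set T -> \bar R}.
Variable t : R.
Local Open Scope ereal_scope.

Notation iint := (iint mu).

(* Expectation of F over a Poisson process of intensity t mu, i.e. over the list
   of a Poisson(t) number of independent points of law mu. *)
Definition pint (F : seq T -> \bar R) : \bar R :=
  \sum_(m <oo) (poisson_pmf t m)%:E * iint m F.

(** The binomial coefficient cancels the factorial of the Poisson weight. In [mecke] this factors
    the weight of k + i points into t^k / k! and the weight of the i unchosen points. *)
Lemma poisson_pmf_addn i k : (0 < t)%R -> ((poisson_pmf t (k + i)) * 'C(k + i, k)%:R)%R =
  ((t ^+ k / k`!%:R) * poisson_pmf t i)%R.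
Proof.
move=> t0; rewrite /poisson_pmf t0.
have := bin_fact (leq_addr i k); rewrite addKn => /(congr1 (fun n : nat => n%:R : R)%R).
rewrite !natrM => <-.
have k0 : (k`!%:R != 0 :> R)%R by rewrite pnatr_eq0 -lt0n fact_gt0.
have i0 : (i`!%:R != 0 :> R)%R by rewrite pnatr_eq0 -lt0n fact_gt0.
have c0 : ('C(k + i, k)%:R != 0 :> R)%R by rewrite pnatr_eq0 -lt0n bin_gt0 leq_addr.
by rewrite exprD; field; rewrite k0 i0 c0.
Qed.

Lemma pint_ge0 F : (forall s, 0 <= F s) -> 0 <= pint F.
Proof.
move=> F0; apply: nneseries_ge0 => m _ _; apply: mule_ge0; last exact: iint_ge0.
by rewrite lee_fin poisson_pmf_ge0.
Qed.

Lemma le_pint F G : (forall s, 0 <= F s) -> mseq F -> mseq G ->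
  (forall s, F s <= G s) -> pint F <= pint G.
Proof.
move=> F0 mF mG FG; apply: lee_nneseries => m _.
  by move=> _; apply: mule_ge0; [rewrite lee_fin poisson_pmf_ge0|exact: iint_ge0].
by apply: lee_wpmul2l; [rewrite lee_fin poisson_pmf_ge0|exact: le_iint].
Qed.

Lemma pintD F G : (forall s, 0 <= F s) -> (forall s, 0 <= G s) ->
  mseq F -> mseq G -> pint (fun s => F s + G s) = pint F + pint G.
Proof.
move=> F0 G0 mF mG; rewrite /pint -nneseriesD; last 2 first.
- by move=> m _ _; apply: mule_ge0; [rewrite lee_fin poisson_pmf_ge0|exact: iint_ge0].
- by move=> m _ _; apply: mule_ge0; [rewrite lee_fin poisson_pmf_ge0|exact: iint_ge0].
apply: eq_eseriesr => m _; rewrite iintD// ge0_muleDr//; exact: iint_ge0.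
Qed.

Lemma pintZl (c : R) F : (0 <= c)%R -> (forall s, 0 <= F s) -> mseq F ->
  pint (fun s => c%:E * F s) = c%:E * pint F.
Proof.
move=> c0 F0 mF; rewrite /pint -nneseriesZl//; last first.
  by move=> m _; apply: mule_ge0; [rewrite lee_fin poisson_pmf_ge0|exact: iint_ge0].
by apply: eq_eseriesr => m _; rewrite iintZl// muleCA.
Qed.

Lemma measurable_pint d' (W : measurableType d') (F : W -> seq T -> \bar R) :
  (forall w s, 0 <= F w s) ->
  (forall m, measurable_fun setT (fun p : W * m.-tuple T => F p.1 p.2)) ->
  measurable_fun setT (fun w => pint (F w)).
Proof.
move=> F0 mF; apply: ge0_emeasurable_sum => [m w _ _|m _].
  by apply: mule_ge0; [rewrite lee_fin poisson_pmf_ge0|exact: iint_ge0].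
apply: emeasurable_funM; first exact: measurable_cst.
exact: measurable_iint.
Qed.

(** With m points, the choices of k of them contribute C(m, k) equal integrals; there are none if m
    < k, and for m = k + i the weight factors by [poisson_pmf_addn], which leaves a Poisson number i
    of remaining points. *)
Lemma mecke k F : (0 < t)%R -> (forall a b, 0 <= F a b) -> mseq2 F ->
  pint (fun s => \sum_(p <- splits k s) F p.1 p.2) =
  (t ^+ k / k`!%:R)%:E * iint k (fun a => pint (F a)).
Proof.
move=> t0 F0 mF.
have p0 m : 0 <= (poisson_pmf t m)%:E by rewrite lee_fin poisson_pmf_ge0.
have I0 m : 0 <= iint m (fun s => F (take k s) (drop k s)) by exact: iint_ge0.
transitivity (\sum_(m <oo) (poisson_pmf t m)%:E * ('C(m, k)%:R%:E * iint m (fun s => F (take k s) (drop k s)))).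
  by apply: eq_eseriesr => m _; rewrite iint_splits.
rewrite (nneseries_split 0 k); last first.
  by move=> m _; rewrite !mule_ge0//.
rewrite add0n big_nat big1 ?add0e; last first.
  by move=> m /andP[_ mk]; rewrite bin_small// mul0e mule0.
rewrite -(@nneseries_addn _ _ k)//; last first.
  by move=> m; rewrite !mule_ge0//.
under eq_eseriesr => m _.
  rewrite [(m + k)%N]addnC iint_cat// muleA -EFinM poisson_pmf_addn// EFinM -muleA.
  over.
rewrite nneseriesZl; last first.
  by move=> m _; apply: mule_ge0 => //; apply: iint_ge0 => s; exact: iint_ge0.
congr (_ * _); rewrite /pint.
have Ia m a : 0 <= iint m (F a) by exact: iint_ge0.
rewrite iint_nneseries; last 2 first.
- by move=> m s; exact: mule_ge0.
- move=> m; apply: mseqM; first exact: mseq_cst.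
  by move=> n; apply: measurable_iint => //; exact: mF.
apply: eq_eseriesr => m _; rewrite iintZl//.
by move=> n; apply: measurable_iint => //; exact: mF.
Qed.

End poisson_mecke.

Section measurable_predicates.
Context d (T : measurableType d) (R : realType).
Local Open Scope ereal_scope.

Lemma measurable_pred01 d' (W : measurableType d') (b : W -> bool) :
  measurable [set w | b w] -> measurable_fun setT (fun w => (b w)%:R%:E : \bar R).
Proof.
move=> mb; apply/measurable_EFinP.
have -> : (fun w => (b w)%:R : R) = \1_[set w | b w].
  by apply/funext => w; rewrite indicE mem_setE.
exact: measurable_indic.
Qed.

Lemma mlist_all d' (W : measurableType d') (q : pred T) (g : W -> seq T) :
  measurable [set x | q x] -> mlist g -> measurable [set w | all q (g w)].
Proof.
move=> mq; elim=> [|x {}g mx mg IH] /=.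
  by rewrite (_ : [set _ | _] = setT) ?measurableT//; apply/seteqP.
rewrite (_ : [set _ | _] = x @^-1` [set x | q x] `&` [set w | all q (g w)]).
  by apply: measurableI => //; rewrite -[X in measurable X]setTI; exact: mx.
by apply/seteqP; split => w /= => [/andP[]|[-> ->]].
Qed.

(** A filtered list has no constant length, so it is not an [mlist]. Each point is tested in turn,
    and [F] depends on [w] to keep the points already retained. *)
Lemma mlist_filter_aux d' (W : measurableType d') (q : pred T) (g : W -> seq T)
  (F : W -> seq T -> \bar R) :
  measurable [set x | q x] -> mlist g ->
  (forall h, mlist h -> measurable_fun setT (fun w => F w (h w))) ->
  measurable_fun setT (fun w => F w (seq.filter q (g w))).
Proof.
move=> mq mg; elim: mg F => [|x {}g mx mg IH] F mF /=.
  exact: (mF (fun=> [::]) (mlist_nil _ _)).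
rewrite (_ : (fun w => _) = fun w => if q (x w) then F w (x w :: seq.filter q (g w))
  else F w (seq.filter q (g w))); last by apply/funext => w; case: ifP.
apply: measurable_fun_ifT.
- apply: (measurable_fun_bool true); rewrite setTI.
  rewrite (_ : _ @^-1` _ = x @^-1` [set x | q x]).
    by rewrite -[X in measurable X]setTI; exact: mx.
  by apply/seteqP; split.
- apply: (IH (fun w s => F w (x w :: s))) => h mh.
  by apply: (mF (fun w => x w :: h w)); exact: mlist_cons.
- exact: IH.
Qed.

Lemma mseq_filter (q : pred T) (F : seq T -> \bar R) :
  measurable [set x | q x] -> mseq F -> mseq (fun s => F (seq.filter q s)).
Proof.
move=> mq mF m; apply: (@mlist_filter_aux _ (m.-tuple T) q (fun t => t) (fun _ => F)) => //.
- exact: mlist_tval.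
- by move=> h mh; exact: mseq_mlist.
Qed.

Lemma mseq_all (r : pred T) : measurable [set x | r x] ->
  mseq (fun s => (all r s)%:R%:E : \bar R).
Proof.
move=> mr m; apply: measurable_pred01.
by apply: mlist_all => //; exact: mlist_tval.
Qed.

End measurable_predicates.

Section iint_all_sigma_finite.
Context d (T : measurableType d) (R : realType).
Variable nu : {sigma_finite_measure set T -> \bar R}.
Variables (p : pred T) (q : R).
Hypotheses (mp : measurable [set x | p x]) (pq : nu [set x | p x] = q%:E).
Local Open Scope ereal_scope.

(** The measure is only sigma-finite because the result serves both the law of the points and
    Lebesgue measure. *)
Lemma iint_all_pow m : iint nu m (fun s => (all p s)%:R%:E) = (q ^+ m)%:E.
Proof.
have p0 (r : pred T) s : 0 <= (all r s)%:R%:E :> \bar R by rewrite lee_fin.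
have q0 : (0 <= q)%R by rewrite -lee_fin -pq.
elim: m => [|m IH]; first by rewrite iint0//; exact: mseq_all.
rewrite iintS//; last exact: mseq_all.
transitivity (\int[nu]_x ((p x)%:R%:E * (q ^+ m)%:E)).
  apply: eq_integral => x _; rewrite -IH -iintZl//; last exact: mseq_all.
  by apply: eq_iint => s _ /=; rewrite -EFinM -natrM mulnb.
rewrite ge0_integralZr//; last 2 first.
- exact: measurable_pred01.
- by rewrite lee_fin exprn_ge0.
rewrite (_ : \int[nu]_x _ = q%:E) -?EFinM ?exprS//.
rewrite -pq -(setIT [set x | p x]) -integral_indic//.
by apply: eq_integral => x _; rewrite indicE mem_setE.
Qed.
End iint_all_sigma_finite.

Section restriction.
Context d (T : measurableType d) (R : realType).
Variable mu : probability T R.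
Variable t : R.
Hypothesis t_gt0 : 0 < t.
Local Open Scope ereal_scope.

Notation iint := (iint mu).
Notation pint := (pint mu t).

(** The indicator selects a single splitting, the points outside [p] against those in [p], which
    exists only if [j] is the number of points outside. Summed over [j], this lets [mecke] compute
    an integral over the thinned process. *)
Lemma splits_filter (p : pred T) j s (G : seq T -> \bar R) :
  \sum_(q <- splits j s) (all (fun x => ~~ p x) q.1 && all p q.2)%:R%:E * G q.1 =
  (j == size (seq.filter (fun x => ~~ p x) s))%:R%:E * G (seq.filter (fun x => ~~ p x) s).
Proof.
elim: s j G => [|x s IH] [|j] G /=.
- by rewrite big_seq1.
- by rewrite big_nil mul0e.
- rewrite big_map /=; case: (boolP (p x)) => px /=.
    by rewrite -(IH 0%N G); apply: eq_bigr => q _.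
  rewrite big1 ?mul0e// => q _.
  by rewrite andbF mul0e.
rewrite big_cat !big_map /=; case: (boolP (p x)) => px /=.
  rewrite big1 ?add0e//; last by move=> q _; rewrite mul0e.
rewrite [X in _ + X]big1 ?adde0//; last by move=> q _; rewrite andbF mul0e.
by rewrite eqSS -(IH j (fun s => G (x :: s))).
Qed.

Lemma exp_nneseries (x : R) : (0 <= x)%R ->
  \sum_(m <oo) (x ^+ m / m`!%:R)%:E = (expR x)%:E.
Proof.
move=> x0; rewrite expRE -EFin_lim; last first.
  rewrite /pseries/=; under eq_fun do rewrite mulrC.
  exact: is_cvg_series_exp_coeff.
apply/congr_lim/funext => n/=; rewrite /pseries/= /series/= -sumEFin//.
by under eq_bigr do rewrite mulrC.
Qed.

Variable p : pred T.
Hypothesis mp : measurable [set x | p x].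

Let q := fine (mu [set x | p x]).
Let qE : mu [set x | p x] = q%:E.
Proof. by rewrite fineK// fin_num_measure. Qed.
Let q_ge0 : (0 <= q)%R.
Proof. by rewrite fine_ge0. Qed.

Lemma iint_all m : iint m (fun s => (all p s)%:R%:E) = (q ^+ m)%:E.
Proof. exact: iint_all_pow. Qed.

(** A void probability: the number of points outside [p] is Poisson of mean t (1 - q). *)
Lemma pint_all : pint (fun s => (all p s)%:R%:E) = (expR (- (t * (1 - q))))%:E.
Proof.
rewrite /pint.
under eq_eseriesr => m _.
  rewrite iint_all /poisson_pmf t_gt0 -EFinM.
  rewrite (_ : (_ * q ^+ m = expR (- t) * ((t * q) ^+ m / m`!%:R))%R); last first.
    by rewrite exprMn; ring.
  rewrite EFinM; over.
rewrite nneseriesZl; last first.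
  by move=> m _; rewrite lee_fin divr_ge0// exprn_ge0// mulr_ge0// ltW.
rewrite exp_nneseries; last by rewrite mulr_ge0// ltW.
rewrite -EFinM -expRD; congr (expR _)%:E; ring.
Qed.

Let mpC : measurable [set x | ~~ p x].
Proof.
rewrite (_ : [set x | _] = ~` [set x | p x]); first exact: measurableC.
by apply/seteqP; split => x /= /negP.
Qed.

(** Independence of a Poisson process on disjoint sets, in the one form needed: given that no point
    lies in [p], the process has the law of its restriction to the complement. Both sides are
    expanded by the number [j] of points outside [p]; on the right [mecke] applies, and the points
    in [p] integrate out by [pint_all]. *)
Lemma pint_restrict (g : seq T -> R) : (forall s, 0 <= g s)%R -> mseq (EFin \o g) ->
  let G s := (g s)%:E in
  pint (fun s => (all (fun x => ~~ p x) s)%:R%:E * G s) =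
  (expR (- (t * q)))%:E * pint (fun s => G (seq.filter (fun x => ~~ p x) s)).
Proof.
move=> g0 mG G.
have G0 s : 0 <= G s by rewrite lee_fin.
have p0 (r : pred T) s : 0 <= (all r s)%:R%:E :> \bar R by rewrite lee_fin.
have b0 (b : bool) : 0 <= b%:R%:E :> \bar R by rewrite lee_fin.
pose F a b := (all (fun x => ~~ p x) a && all p b)%:R%:E * G a.
have F0 a b : 0 <= F a b by exact: mule_ge0.
have mF : mseq2 F.
  move=> i j; apply: emeasurable_funM.
    apply: measurable_pred01.
    rewrite (_ : [set _ | _] = [set w | all (fun x => ~~ p x) (tval w.1)] `&` [set w | all p (tval w.2)]).
      by apply: measurableI; apply: mlist_all => //; exact: mlist_tval.
    by apply/seteqP; split => w /= => [/andP[]|[-> ->]].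
  by apply: (mseq_mlist mG); exact: mlist_tval.
transitivity ((expR (- (t * q)))%:E * pint (fun s => \sum_(j <oo) \sum_(r <- splits j s) F r.1 r.2)); last first.
  congr (_ * _); apply: eq_eseriesr => m _; congr (_ * _); apply: eq_iint => s _.
  under eq_eseriesr => j _ do rewrite splits_filter.
  rewrite (nneseriesD1 (n := size (seq.filter (fun x => ~~ p x) s)))//=; last by move=> j _; exact: mule_ge0.
  rewrite eqxx mul1e eseries0 ?adde0// => j _ /negPf ->.
  by rewrite mul0e.
have S0 j s : 0 <= \sum_(r <- splits j s) F r.1 r.2 by apply: sume_ge0.
have -> : pint (fun s => \sum_(j <oo) \sum_(r <- splits j s) F r.1 r.2) =
   \sum_(j <oo) pint (fun s => \sum_(r <- splits j s) F r.1 r.2).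
  rewrite [in LHS]/pint.
  under eq_eseriesr => m _.
    rewrite iint_nneseries//; last by move=> j; exact: mseq_splits.
    rewrite -nneseriesZl; last by move=> j _; exact: iint_ge0.
    over.
  rewrite nneseries_interchange// => m j.
  by rewrite mule_ge0// ?lee_fin ?poisson_pmf_ge0//; exact: iint_ge0.
have mA : mseq (fun a => (all (fun x => ~~ p x) a)%:R%:E * G a).
  by apply: mseqM => //; exact: mseq_all.
have AG0 a : 0 <= (all (fun x => ~~ p x) a)%:R%:E * G a by exact: mule_ge0.
rewrite -nneseriesZl; last by move=> j _; exact: pint_ge0.
apply: eq_eseriesr => j _; rewrite mecke//.
transitivity ((expR (- (t * q)))%:E * ((t ^+ j / j`!%:R)%:E *
   iint j (fun a => (expR (- (t * (1 - q))))%:E * ((all (fun x => ~~ p x) a)%:R%:E * G a)))).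
  rewrite iintZl//.
  rewrite !muleA -!EFinM; congr (_%:E * _).
  rewrite /poisson_pmf t_gt0.
  have -> : expR (- t) = (expR (- (t * q)) * expR (- (t * (1 - q))))%R.
    by rewrite -expRD; congr expR; ring.
  ring.
congr (_ * (_ * _)); apply: eq_iint => a _.
rewrite -pint_all muleC -EFinM.
have ap0 : (0 <= (all (fun x => ~~ p x) a)%:R * g a)%R by rewrite mulr_ge0.
rewrite -pintZl//; last exact: mseq_all.
congr pint; apply/funext => b; rewrite /F /G -mulnb natrM -!EFinM; congr (_%:E); ring.
Qed.

End restriction.

Section tuple_measures.
Context d (T : measurableType d) (R : realType).
Local Open Scope ereal_scope.

Definition boxes m : set (set (m.-tuple T)) :=
  [set [set t | forall i, A i (tnth t i)] | A in [set A : 'I_m -> set T | forall i, measurable (A i)]].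

Lemma boxesE m : measurable = <<s @boxes m >>.
Proof.
apply/seteqP; split.
  apply: smallest_sub; first exact: smallest_sigma_algebra.
  case: m => [|m] B; first by rewrite big_ord0.
  rewrite -bigcup_mkord_ord => -[i im [A mA <-]].
  apply: sub_sigma_algebra.
  exists (fun j : 'I_m.+1 => if j == inord i then A else setT) => [j|].
    by case: ifP.
  rewrite setTI; apply/seteqP; split => [t /= H|t /= At j].
    by have := H (inord i); rewrite eqxx.
  by case: eqP => // ->.
apply: smallest_sub; first exact: sigma_algebra_measurable.
move=> _ [A mA <-].
rewrite (_ : [set t | _] = \bigcap_(i in [set: 'I_m]) ((@tnth m T)^~ i @^-1` A i)).
  apply: fin_bigcap_measurable => // i _; rewrite -[X in measurable X]setTI.
  exact: measurable_tnth.
by apply/seteqP; split=> [t Bt i _|t Bt i]; exact: Bt.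
Qed.

Lemma tuple_measure_unique m (m1 m2 : {measure set (m.-tuple T) -> \bar R}) :
  m1 setT < +oo ->
  (forall A : 'I_m -> set T, (forall i, measurable (A i)) ->
    m1 [set t | forall i, A i (tnth t i)] = m2 [set t | forall i, A i (tnth t i)]) ->
  forall E, measurable E -> m1 E = m2 E.
Proof.
move=> m1oo m12 E mE.
apply: (measure_unique (@boxes m) (fun=> setT)) => //.
- exact: boxesE.
- move=> _ _ [A mA <-] [B mB <-]; exists (fun i => A i `&` B i) => [i|].
    exact: measurableI.
  by apply/seteqP; split => [t /= H|t /= [HA HB] i]; [split=> i; have [] := H i|split].
- by move=> _; exists (fun=> setT) => //; apply/seteqP.
- by rewrite bigcup_const.
- by move=> _ [A mA <-]; exact: m12.
Qed.

(** Restricting [P] to [D] and pushing it forward by [X] gives the measure c nu, so this is a change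
    of variables on the event [D]. *)
Lemma ge0_integral_setI_preimage d1 d2 (T1 : measurableType d1) (T2 : measurableType d2)
  (P : {measure set T1 -> \bar R}) (nu : {measure set T2 -> \bar R})
  (D : set T1) (X : T1 -> T2) (c : R) (f : T2 -> \bar R) :
  measurable D -> measurable_fun setT X -> (0 <= c)%R ->
  (forall A, measurable A -> P (D `&` X @^-1` A) = c%:E * nu A) ->
  measurable_fun setT f -> (forall x, 0 <= f x) ->
  \int[P]_(w in D) f (X w) = c%:E * \int[nu]_x f x.
Proof.
move=> mD mX c0 PD mf f0.
have mfX : measurable_fun setT (f \o X) by exact: measurableT_comp.
pose PR := mrestr P mD.
have PRE A : PR A = P (A `&` D) by [].
transitivity (\int[PR]_(w in D) f (X w)).
  by apply: eq_measure_integral => A mA AD; have : PR A = P A by rewrite PRE setIidl.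
transitivity (\int[PR]_w f (X w)).
  rewrite [RHS](@ge0_negligible_integral _ _ _ PR setT (~` D))//.
  - by rewrite setTD setCK.
  - exact: measurableC.
  - by have : PR (~` D) = 0 by rewrite PRE setICl measure0.
pose cc := NngNum c0.
transitivity (\int[mscale cc nu]_x f x); last by rewrite ge0_integral_mscale.
rewrite -(preimage_setT X) -(ge0_integral_pushforward mX)//.
apply: eq_measure_integral => A mA _.
have : PR (X @^-1` A) = c%:E * nu A by rewrite PRE setIC PD.
exact.
Qed.

End tuple_measures.

Section sample_law.
Context d (T : measurableType d) (R : realType).
Context dO (Omega : measurableType dO) (P : probability Omega R).
Variables (X : nat -> {RV P >-> T}) (N : {RV P >-> nat}) (t : R).
Hypothesis t_gt0 : 0 < t.
Hypothesis X_indep : mutually_independent X.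
Hypothesis X_ident : forall i A, measurable A ->
  distribution P (X i) A = distribution P (X 0%N) A.
Hypothesis N_poisson : forall B : set nat, distribution P N B = poisson_prob t 0 B.
Hypothesis N_indep : independent_of_sequence N X.
Local Open Scope ereal_scope.

Definition seqX (m : nat) (w : Omega) : seq T := [seq X i w | i <- iota 0 m].

Lemma size_seqX m w : size (seqX m w) == m.
Proof. by rewrite size_map size_iota. Qed.

Definition tupX m w : m.-tuple T := Tuple (size_seqX m w).

Lemma tnth_tupX m w (i : 'I_m) : tnth (tupX m w) i = X i w.
Proof.
rewrite (tnth_nth (X 0%N w)) /= (nth_map 0%N) ?size_iota//.
by rewrite nth_iota.
Qed.

Lemma measurable_tupX m : measurable_fun setT (tupX m).
Proof.
apply/measurable_fun_tnthP => i.
rewrite (_ : _ \o _ = X i); first exact: measurable_funP.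
by apply/funext => w /=; rewrite tnth_tupX.
Qed.

Lemma indep_boxes m (A : 'I_m -> set T) : (forall i, measurable (A i)) ->
  P (N @^-1` [set m] `&` tupX m @^-1` [set s | forall i, A i (tnth s i)]) =
  (poisson_pmf t m)%:E * power_measure (distribution P (X 0%N)) m [set s | forall i, A i (tnth s i)].
Proof.
move=> mA.
pose A' (i : nat) := if insub i is Some j then A j else setT.
have mA' i : measurable (A' i) by rewrite /A'; case: insubP.
have A'E (i : 'I_m) : A' i = A i by rewrite /A' valK.
pose J := [fset x in iota 0 m]%fset.
have -> : tupX m @^-1` [set s | forall i, A i (tnth s i)] =
    \bigcap_(i in [set` J]) X i @^-1` A' i.
  apply/seteqP; split => [w /= H i /=|w /= H i].
    rewrite inE /= mem_iota /= add0n => im.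
    by have := H (Ordinal im); rewrite tnth_tupX -A'E.
  rewrite tnth_tupX -A'E; apply: H => /=.
  by rewrite inE /= mem_iota add0n/=.
(* Independence of [N] is assumed from the sigma-algebra of the whole sequence, to which a finite
   intersection of preimages belongs. *)
rewrite N_indep//; last first.
  pose G := \bigcup_i preimage_set_system setT (X i) measurable.
  apply: (@fin_bigcap_measurable _ (g_sigma_algebraType G)) => // i _.
  apply: sub_sigma_algebra; exists i => //.
  by exists (A' i) => //; rewrite setTI.
rewrite X_indep// power_measureX//; congr (_ * _).
  have := N_poisson [set m]; rewrite /distribution /pushforward => ->.
  by rewrite /poisson_prob t_gt0 esum_set1// lee_fin poisson_pmf_ge0.
transitivity (\prod_(i <- iota 0 m) P (X i @^-1` A' i)).
  apply: perm_big; apply: uniq_perm; rewrite ?fset_uniq ?iota_uniq// => i.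
  by rewrite inE.
have -> : iota 0 m = index_iota 0 m by rewrite /index_iota subn0.
rewrite big_mkord.
by apply: eq_bigr => i _; rewrite A'E; have := X_ident i (mA i).
Qed.

Lemma indep_tuple m B : measurable B ->
  P (N @^-1` [set m] `&` tupX m @^-1` B) =
  (poisson_pmf t m)%:E * power_measure (distribution P (X 0%N)) m B.
Proof.
have mN : measurable (N @^-1` [set m]).
  by rewrite -[X in measurable X]setTI; exact: measurable_funP.
have mt := @measurable_tupX m.
pose c := NngNum (poisson_pmf_ge0 t m).
pose m1 := pushforward (mrestr P mN) (tupX m).
pose m1' := measure_function_pushforward__canonical__measure_function_Measure
  (mrestr P mN) mt.
have m1E B' : m1 B' = P (N @^-1` [set m] `&` tupX m @^-1` B').
  by rewrite setIC.
move=> mB.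
have := @tuple_measure_unique _ T R m m1'
  (mscale c (power_measure (distribution P (X 0%N)) m)) _ _ B mB.
rewrite -[m1' B]/(m1 B) m1E; apply.
  rewrite -[m1' _]/(m1 _) m1E.
  apply: le_lt_trans (probability_le1 P _) (ltry _).
  by apply: measurableI => //; rewrite preimage_setT.
move=> A mA; rewrite -[m1' _]/(m1 _) m1E.
exact: indep_boxes.
Qed.

(** The bridge from the probability space to [pint]. The event N = m is independent of the first m
    points, so splitting by the value of [N] gives the defining series. *)
Lemma integral_sample F : (forall s, 0 <= F s) -> mseq F ->
  \int[P]_w F (seqX (N w) w) = pint (distribution P (X 0%N)) t F.
Proof.
move=> F0 mF.
have mN m : measurable (N @^-1` [set m]).
  by rewrite -[X in measurable X]setTI; exact: measurable_funP.
have NT : \bigcup_m (N @^-1` [set m]) = setT.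
  by apply/seteqP; split => // w _; exists (N w).
have mFN : measurable_fun setT (fun w => F (seqX (N w) w)).
  rewrite -NT; apply/measurable_fun_bigcup => // m.
  apply: (eq_measurable_fun (fun w => F (tupX m w))).
    by move=> w; rewrite inE /= => <-.
  apply: measurable_funTS.
  exact: (measurableT_comp (mF m) (@measurable_tupX m)).
rewrite -NT ge0_integral_bigcup//; last 2 first.
- by rewrite NT.
- by apply/trivIsetP => i j _ _ ij; apply/seteqP; split => // w [/= wi wj]; move: ij; rewrite -wi -wj eqxx.
apply: eq_eseriesr => m _.
rewrite -(ge0_integral_setI_preimage (mN m) (@measurable_tupX m) (poisson_pmf_ge0 t m) (@indep_tuple m) (mF m))//.
by apply: eq_integral => w; rewrite inE /= => ->.
Qed.

End sample_law.

Local Notation edist := Defs.edist.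

(** * Components of geometric graphs *)

Section splits_uniq.
Variable T : choiceType.
Implicit Types (s : seq T) (q : pred T).

Lemma splits_filter_mem q s :
  (seq.filter q s, seq.filter (fun x => ~~ q x) s) \in splits (count q s) s.
Proof.
elim: s => //= x s IH; case: (boolP (q x)) => qx /=.
  rewrite add1n mem_cat; apply/orP; left.
  by apply/mapP; exists (seq.filter q s, seq.filter (fun x => ~~ q x) s).
rewrite add0n mem_cat; apply/orP; right.
by apply/mapP; exists (seq.filter q s, seq.filter (fun x => ~~ q x) s).
Qed.

Lemma mem_splits k s p x : p \in splits k s -> (x \in s) = (x \in p.1) || (x \in p.2).
Proof. by move=> /splits_perm /perm_mem <-; rewrite mem_cat. Qed.

Lemma splitsE k s p : uniq s -> p \in splits k s ->
  p.1 = seq.filter (mem p.1) s /\ p.2 = seq.filter (fun x => x \notin p.1) s.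
Proof.
elim: s k p => /= [|x s IH] k p.
  by case: k => [|k]; rewrite ?inE// => _ /eqP ->.
move=> /andP[xs us]; rewrite mem_cat => /orP[].
  case: k => [|k]// /mapP[p' p's ->] /=; have [p1 p2] := IH _ _ us p's.
  rewrite !inE eqxx /=; split; first congr (_ :: _).
    rewrite {1}p1; apply: eq_in_filter => y ys /=; rewrite !inE.
    by rewrite (negPf (memPn xs _ ys)).
  rewrite {1}p2; apply: eq_in_filter => y ys /=; rewrite !inE.
  by rewrite (negPf (memPn xs _ ys)).
move=> /mapP[p' p's ->] /=; have [p1 p2] := IH _ _ us p's.
have xp : x \in p'.1 = false.
  by apply: contraNF xs; rewrite (mem_splits x p's) => ->.
by rewrite /= !xp /=; split => //; congr (_ :: _).
Qed.

Lemma uniq_splits k s : uniq s -> uniq (splits k s).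
Proof.
elim: s k => /= [|x s IH] k; first by case: k.
move=> /andP[xs us]; rewrite cat_uniq; apply/and3P; split.
- case: k => // k; rewrite map_inj_uniq ?IH// => -[a b] [a' b'] /= [-> ->].
  by [].
- apply/hasPn => _ /mapP[p ps ->]; case: k ps => // k ps.
  apply/negP => /mapP[p' p's [E _]].
  by move/negP: xs; apply; rewrite (mem_splits x ps) E inE eqxx.
- by rewrite map_inj_uniq ?IH// => -[a b] [a' b'] /= [-> ->].
Qed.

Lemma sum_splits_filter k q s (V : nmodType) (F : seq T -> seq T -> V) :
  \sum_(p <- splits k (seq.filter q s)) F p.1 p.2 =
  \sum_(p <- splits k s | all q p.1) F p.1 (seq.filter q p.2).
Proof.
elim: s k F => /= [|x s IH] k F.
  by case: k => [|k]; rewrite ?big_nil// !big_seq1 !big_cons /= big_nil addr0.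
case: (boolP (q x)) => qx /=; last first.
  rewrite IH big_cat /= !big_map /=.
  rewrite [X in _ = X + _](_ : _ = 0) ?add0r.
    by apply: eq_bigr => p _; rewrite (negPf qx).
  by case: k => [|k]; rewrite ?big_nil// big_map /= big_pred0// => p; rewrite (negPf qx).
rewrite !big_cat /= !big_map /=; congr (_ + _).
  case: k => [|k]; rewrite ?big_nil// !big_map /= qx /=.
  exact: (IH k (fun a b => F (x :: a) b)).
rewrite (IH k (fun a b => F a (x :: b))).
by apply: eq_bigr => p _; rewrite qx.
Qed.

End splits_uniq.

Section graph.
Variables (R : realType) (d : nat) (r : R).
Notation T := (d.-tuple R).
Implicit Types (s a b : seq T).

Lemma edistC (x y : T) : edist x y = edist y x.
Proof.
rewrite /edist; congr Num.sqrt; apply: eq_bigr => i _.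
by rewrite -sqrrN opprB.
Qed.

Definition nbr (x y : T) := edist x y <= r.

Lemma nbr_sym x y : nbr x y = nbr y x.
Proof. by rewrite /nbr edistC. Qed.

Definition conn s : bool := graph_connected [fset x in s]%fset r.

Definition sep a b : bool := all (fun x => all (fun y => ~~ nbr x y) b) a.

Lemma sepP a b : reflect (forall x y, x \in a -> y \in b -> ~~ nbr x y) (sep a b).
Proof.
apply: (iffP allP) => [H x y xa yb|H x xa]; first by have /allP := H x xa; apply.
by apply/allP => y; exact: H.
Qed.

Lemma sep_sym a b : sep a b = sep b a.
Proof.
by apply/sepP/sepP => H x y xa yb; rewrite nbr_sym; exact: H.
Qed.

(* Connectedness as: every cut of m is crossed by an edge. *)
Definition crossing (m : pred T) := forall q : pred T,
  (exists2 x, m x & q x) -> (exists2 x, m x & ~~ q x) ->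
  exists x y, [/\ m x, m y, q x, ~~ q y & nbr x y].

Lemma adjacent_sym (A : {fset T}) : symmetric (@Defs.adjacent R d A r).
Proof. by move=> x y; rewrite /Defs.adjacent /= eq_sym edistC. Qed.

(** If no edge leaves [q], then [q] is closed under adjacency; conversely, [q] is taken to be the
    set of points reachable from [x]. As [crossing] speaks of predicates on points and not of the
    finite vertex type of [A], it can be carried over to lists and to other vertex sets. *)
Lemma graph_connectedP (A : {fset T}) :
  graph_connected A r <-> (exists x, x \in A) /\ crossing (mem A).
Proof.
have csym : connect_sym (@Defs.adjacent R d A r).
  exact: sym_connect_sym (@adjacent_sym A).
have compP C : (C \in components A r) <-> exists x : A, C = [set y | connect (@Defs.adjacent R d A r) x y]%SET.
  rewrite /components /equivalence_partition; split.
    move=> /imsetP[x _ ->]; exists x; apply/finset.setP => y.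
    by rewrite !inE.
  move=> [x ->]; apply/imsetP; exists x; rewrite ?inE//.
  by apply/finset.setP => y; rewrite !inE.
split.
- move=> /cards1P[C CE].
  have : C \in components A r by rewrite CE inE.
  rewrite compP => -[x xC]; split; first by exists (val x); exact: valP.
  move=> q [u uA qu] [v vA qv].
  apply: contrapT => H.
  have cl : fingraph.closed (@Defs.adjacent R d A r) [pred y | q (val y)].
    apply: (intro_closed csym) => y z /andP[yz nyz] /= qy.
    apply: contrapT => /negP qz; apply: H.
    by exists (val y), (val z); split => //; exact: valP.
  have cxy (y : A) : connect (@Defs.adjacent R d A r) x y.
    have : [set z | connect (@Defs.adjacent R d A r) y z]%SET \in components A r.
      by apply/compP; exists y.
    rewrite CE inE xC => /eqP/finset.setP/(_ y).
    by rewrite !inE connect0.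
  have /(closed_connect cl) : connect (@Defs.adjacent R d A r) [` uA]%fset [` vA]%fset.
    by rewrite (connect_trans _ (cxy _))// csym.
  by rewrite !inE /= qu (negPf qv).
- move=> [[x xA] H]; apply/cards1P.
  exists [set y | connect (@Defs.adjacent R d A r) [` xA]%fset y]%SET.
  have all_c (y : A) : connect (@Defs.adjacent R d A r) [` xA]%fset y.
    apply: contrapT => /negP nxy.
    pose q u := [exists z : A, (val z == u) && connect (@Defs.adjacent R d A r) [` xA]%fset z].
    have qP (z : A) : q (val z) = connect (@Defs.adjacent R d A r) [` xA]%fset z.
      apply/existsP/idP => [[z' /andP[/eqP/val_inj -> //]]|cz].
      by exists z; rewrite eqxx.
    have [||u [v [uA vA]]] := H q.
    + by exists x => //; rewrite (qP [` xA]%fset).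
    + by exists (val y); [exact: valP|rewrite qP].
    rewrite -[u]/(val [` uA]%fset) -[v]/(val [` vA]%fset) !qP => cu /negP cv nuv.
    apply: cv; case: (eqVneq [` uA]%fset [` vA]%fset) => [<-//|uv].
    by apply: (connect_trans cu); apply: connect1; apply/andP.
  apply/finset.setP => C; rewrite inE; apply/idP/eqP => [/compP[y ->]|->].
    apply/finset.setP => z; rewrite !inE all_c.
    by rewrite (connect_trans _ (all_c z))// csym.
  by apply/compP; exists [` xA]%fset.
Qed.

Lemma connP s : conn s <-> (exists x, x \in s) /\ crossing (mem s).
Proof.
rewrite /conn; split => [/graph_connectedP[[x xs] H]|[[x xs] H]].
  have ms : mem [fset x in s]%fset =1 mem s by move=> y /=; rewrite inE.
  split; first by exists x; rewrite inE in xs.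
  move=> q [u us qu] [v vs qv].
  have [||y [z [ys zs qy qz yz]]] := H q.
  - by exists u => //; rewrite ms.
  - by exists v => //; rewrite ms.
  - by exists y, z; split => //; rewrite -ms.
have ms : mem [fset x in s]%fset =1 mem s by move=> y /=; rewrite inE.
apply/graph_connectedP; split; first by exists x; rewrite inE.
move=> q [u us qu] [v vs qv].
have [||y [z [ys zs qy qz yz]]] := H q.
- by exists u => //; rewrite -ms.
- by exists v => //; rewrite -ms.
- by exists y, z; split => //; rewrite ms.
Qed.

Definition W k s : nat := ncomponents [fset x in s]%fset r k.

Lemma WE k s : W k s = ncomponents [fset x in s]%fset r k.
Proof. by []. Qed.

Lemma perm_W k s s' : perm_eq s s' -> W k s = W k s'.
Proof.
move=> /perm_mem ss'; congr ncomponents.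
by apply/fsetP => x; rewrite !inE ss'.
Qed.

Definition isolated (p : seq T * seq T) : bool := conn p.1 && sep p.1 p.2.

(** A set [C] of points corresponds to the splitting [Phi C] of [s] into its entries in [C] and the
    others, and [C] is a component exactly if this splitting is isolated. Distinct entries are
    required because splittings count positions while components count points. *)
Lemma W_splits k s : uniq s -> (W k s = \sum_(p <- splits k s) isolated p)%N.
Proof.
move=> us; set A := [fset x in s]%fset.
have inA x : (x \in A) = (x \in s) by rewrite inE.
pose l (C : {set A}) := [seq val y | y <- enum C].
have lP C (y : A) : (val y \in l C) = (y \in C).
  by rewrite mem_map ?mem_enum//; exact: val_inj.
have lA C x : x \in l C -> x \in s by move=> /mapP[y _ ->]; rewrite -inA; exact: valP.
pose Phi (C : {set A}) := (seq.filter (mem (l C)) s, seq.filter (fun x => x \notin l C) s).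
have ul C : uniq (l C) by rewrite map_inj_uniq ?enum_uniq//; exact: val_inj.
have Phi1 C : perm_eq (Phi C).1 (l C).
  apply: uniq_perm; [by rewrite filter_uniq|exact: ul|].
  move=> x; rewrite mem_filter /=; case: (boolP (x \in l C)) => //= /lA.
  exact.
have sPhi C : size (Phi C).1 = #|C| by rewrite (perm_size (Phi1 C)) size_map cardE.
have mPhi C : Phi C \in splits #|C| s.
  by rewrite -sPhi size_filter; exact: splits_filter_mem.
have PhiI : injective Phi.
  move=> C C' /(congr1 fst) CC'; apply/finset.setP => y.
  by rewrite -!lP -(perm_mem (Phi1 C)) CC' (perm_mem (Phi1 C')).
have csym : connect_sym (@Defs.adjacent R d A r).
  exact: sym_connect_sym (@adjacent_sym A).
have compP C : (C \in components A r) = isolated (Phi C).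
  have m1 x : (x \in (Phi C).1) = (x \in l C) by rewrite (perm_mem (Phi1 C)).
  have m2 x : (x \in (Phi C).2) = (x \in s) && (x \notin l C) by rewrite mem_filter andbC.
  have noedge : sep (Phi C).1 (Phi C).2 -> forall y z : A, y \in C ->
      connect (Defs.adjacent r) y z -> z \in C.
    move=> /sepP S y z yC yz.
    have cl : fingraph.closed (@Defs.adjacent R d A r) (mem C).
      apply: (intro_closed csym) => u v /andP[_ nuv] /= uC.
      apply: contrapT => /negP vC.
      have := S (val u) (val v).
      rewrite m1 m2 !lP uC vC -inA (valP v) => /(_ isT isT).
      by rewrite /nbr nuv.
    by rewrite -(closed_connect cl yz).
  apply/imsetP/andP => [[x _ CE]|[/connP[[x xl] H] S]].
    have CP y : (y \in C) = connect (Defs.adjacent r) x y by rewrite CE !inE.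
    have S : sep (Phi C).1 (Phi C).2.
      apply/sepP => u v; rewrite m1 m2 => /mapP[u' + ->] /andP[vs]; rewrite mem_enum => uC.
      rewrite -inA in vs; rewrite -[v]/(val [` vs]%fset) lP => vC; apply/negP => nuv.
      move/negP: vC; apply; rewrite CP; rewrite CP in uC.
      apply: (connect_trans uC); case: (eqVneq u' [` vs]%fset) => [<-//|uv].
      by apply: connect1; apply/andP.
    split => //; apply/connP; split; first by exists (val x); rewrite m1 lP CP.
    move=> q [u + qu] [v + qv]; rewrite /= !m1 => /mapP[u' + uE] /mapP[v' + vE].
    rewrite !mem_enum => uC vC; apply: contrapT => H.
    have cl : fingraph.closed (@Defs.adjacent R d A r) [pred y : A | (y \in C) && q (val y)].
      apply: (intro_closed csym) => y z /andP[_ nyz] /= /andP[yC qy].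
      have zC : z \in C.
        rewrite CP; rewrite CP in yC; apply: (connect_trans yC).
        case: (eqVneq y z) => [<-//|uv].
        by apply: connect1; apply/andP.
      apply/andP; split => //; apply: contrapT => /negP qz; apply: H.
      by exists (val y), (val z); rewrite /= !m1 !lP; split.
    have /(closed_connect cl) : connect (@Defs.adjacent R d A r) u' v'.
      by apply: (@connect_trans _ _ x); rewrite -?CP// csym -CP.
    by rewrite !inE /= uC vC -uE -vE qu (negPf qv).
  have xC : exists2 x' : A, x' \in C & val x' = x.
    by move: xl; rewrite m1 => /mapP[x' + ->]; rewrite mem_enum; exists x'.
  case: xC => x' xC _.
  exists x' => //; apply/finset.setP => y; rewrite !inE; apply/idP/idP; last exact: noedge.
  move=> yC; apply: contrapT => /negP nxy.
  pose q u := [exists z : A, (val z == u) && connect (@Defs.adjacent R d A r) x' z].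
  have qP (z : A) : q (val z) = connect (@Defs.adjacent R d A r) x' z.
    apply/existsP/idP => [[z' /andP[/eqP/val_inj -> //]]|cz].
    by exists z; rewrite eqxx.
  have [||u [v [+ +]]] := H q.
  - by exists (val x'); rewrite /= ?m1 ?lP// qP connect0.
  - by exists (val y); rewrite /= ?m1 ?lP// qP.
  rewrite /= !m1 => /mapP[u' _ ->] /mapP[v' _ ->]; rewrite !qP => cu /negP cv nuv.
  apply: cv; case: (eqVneq u' v') => [<-//|uv].
  by apply: (connect_trans cu); apply: connect1; apply/andP.
rewrite /W /ncomponents cardE.
transitivity (size (seq.filter isolated (splits k s))); last first.
  by rewrite size_filter -sum1_count big_mkcond; apply: eq_bigr => p _; case: isolated.
rewrite -(size_map Phi); apply: perm_size; apply: uniq_perm.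
- by rewrite map_inj_uniq ?enum_uniq.
- by rewrite filter_uniq// uniq_splits.
move=> p; rewrite mem_filter; apply/mapP/andP.
  move=> [C]; rewrite mem_enum inE => /andP[CC /eqP Ck] ->.
  by rewrite -compP CC -{1}Ck mPhi.
move=> [ip ps]; have [p1 p2] := splitsE us ps.
pose C := [set y : A | val y \in p.1]%SET.
have lC x : (x \in l C) = (x \in p.1).
  apply/mapP/idP => [[y + ->]|xp]; first by rewrite mem_enum inE.
  have xA : x \in A by rewrite inA (mem_splits x ps) xp.
  by exists [` xA]%fset => //; rewrite mem_enum inE.
have pE : p = Phi C.
  rewrite [LHS]surjective_pairing p1 p2; congr pair.
    by apply: eq_filter => x; rewrite /= lC.
  by apply: eq_filter => x; rewrite /= lC.
exists C => //; rewrite mem_enum inE compP -pE ip /=.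
by rewrite -sPhi -pE (splits_size ps).
Qed.

End graph.

Section graph_counts.
Variables (R : realType) (d : nat) (r : R).
Notation T := (d.-tuple R).
Implicit Types (s a b : seq T).
Notation W := (W r).
Notation conn := (conn r).
Notation nbr := (nbr r).
Notation sep := (sep r).
Notation isolated := (isolated r).

Lemma conn_sub a c : conn c -> (exists2 x, x \in a & x \in c) ->
  (forall x y, x \in a -> y \in c -> nbr x y -> y \in a) ->
  {subset c <= a}.
Proof.
move=> /connP[_ cr] [x xa xc] H z zc; apply: contrapT => /negP za.
have [||u [v [uc vc ua va uv]]] := cr (mem a).
- by exists x.
- by exists z.
by move/negP: va; apply; exact: (H u).
Qed.

(** Isolated subsets of [a ++ b] that avoid [a] are those of [b], since no edge joins [a] to [b].
    One that meets [a] is connected and separated from the rest, and so is [a]; each contains the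
    other by [conn_sub], which leaves one extra component. *)
Lemma W_cat k a b : uniq (a ++ b) -> size a = k -> isolated (a, b) ->
  W k (a ++ b) = (W k b).+1.
Proof.
move=> uab ak /andP[/= ca sab].
have := uab; rewrite cat_uniq => /and3P[ua /hasPn ba ub].
have ba' x : x \in b -> x \notin a by move/ba.
pose q := fun x => x \notin a.
have fq : seq.filter q (a ++ b) = b.
  rewrite filter_cat (_ : seq.filter q a = [::]); last first.
    by apply/eqP; rewrite -(negbK (_ == _)) -has_filter; apply/hasPn => x; rewrite /q negbK.
  by rewrite /=; apply/all_filterP/allP => x; exact: ba'.
rewrite !W_splits// -{2}fq (sum_splits_filter _ _ _ (fun a b => nat_of_bool (isolated (a, b)))).
rewrite (bigID (fun p => all q p.1)) /= addnC -add1n.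
have p0in : (a, b) \in splits k (a ++ b).
  have := splits_filter_mem (mem a) (a ++ b); rewrite -/q fq.
  rewrite filter_cat (_ : seq.filter (mem a) b = [::]); last first.
    by apply/eqP; rewrite -(negbK (_ == _)) -has_filter; apply/hasPn => x /ba'.
  rewrite cats0 (_ : seq.filter (mem a) a = a); last by apply/all_filterP/allP.
  rewrite count_cat (_ : count (mem a) b = 0%N) ?addn0; last first.
    by apply/eqP; rewrite -leqn0 leqNgt -has_count; apply/hasPn => x /ba'.
  by rewrite (_ : count (mem a) a = k)// -ak; apply/eqP; rewrite -all_count; apply/allP.
congr addn; last first.
  rewrite [LHS]big_seq_cond [RHS]big_seq_cond.
  apply: eq_bigr => p /andP[ps /allP qp]; rewrite /isolated /=; case: (conn p.1) => //=.
  congr nat_of_bool; apply/sepP/sepP => H x y xp yp.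
    by apply: H => //; move: yp; rewrite mem_filter => /andP[].
  case: (boolP (q y)) => qy; first by apply: H => //; rewrite mem_filter qy.
  rewrite nbr_sym; move/sepP: sab; apply; first by rewrite /q negbK in qy.
  have := mem_splits x ps; rewrite xp /= mem_cat (negPf (qp _ xp)) /=.
  by [].
rewrite big_mkcond (bigD1_seq (a, b)) ?uniq_splits//=.
have a0 : ~~ all q a.
  have /connP[[x xa] _] := ca.
  by apply/allPn; exists x => //; rewrite /q negbK.
rewrite a0 /isolated ca /= sab /= big_seq_cond big1 ?addn0// => p /andP[ps pab].
case: ifPn => // /allPn[x xp]; rewrite /q negbK => xa.
apply/eqP; rewrite eqb0; apply: contra pab => /andP[cp sp].
have sub1 : {subset p.1 <= a}.
  apply: conn_sub => //; first by exists x.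
  move=> u v ua' vp nuv; have := mem_splits v ps; rewrite vp /= mem_cat => /orP[//|vb].
  by move/sepP: sab => /(_ _ _ ua' vb); rewrite nuv.
have sub2 : {subset a <= p.1}.
  apply: conn_sub => //; first by exists x.
  move=> u v ua' vp nuv; have := mem_splits v ps; rewrite mem_cat vp /=.
  move=> /esym/orP[//|vb].
  by move/sepP: sp => /(_ _ _ ua' vb); rewrite nuv.
have eqm : mem p.1 =1 mem a by move=> y /=; apply/idP/idP; [exact: sub1|exact: sub2].
have [p1 p2] := splitsE uab ps.
have [/= q1 q2] := splitsE uab p0in.
apply/eqP; rewrite [LHS]surjective_pairing; congr pair.
  by rewrite p1 [RHS]q1; apply: eq_filter.
rewrite p2 [RHS]q2; apply: eq_filter => y.
by rewrite -[_ \notin _]/(~~ mem p.1 y) eqm.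
Qed.

(** A closed ball of radius c r for the supremum distance: it contains the Euclidean ball, and its
    Lebesgue measure is a product of interval lengths. *)
Definition box (c : R) (x y : T) : bool := [forall i, `|tnth x i - tnth y i| <= c * r].

Lemma nbr_box x y : nbr x y -> box 1 x y.
Proof.
move=> nxy; apply/forallP => i; rewrite mul1r; apply: le_trans nxy.
rewrite /edist -sqrtr_sqr ler_wsqrtr// (bigD1 i)//= lerDl.
by apply: sumr_ge0 => j _; exact: sqr_ge0.
Qed.

Lemma box_trans c c' y x z : box c x y -> box c' y z -> box (c + c') x z.
Proof.
move=> /forallP xy /forallP yz; apply/forallP => i.
apply: (le_trans (ler_distD (tnth y i) _ _)); rewrite mulrDl.
by apply: lerD; [exact: xy|exact: yz].
Qed.

Hypothesis r_ge0 : 0 <= r.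

Lemma box_widen c c' x y : c <= c' -> box c x y -> box c' x y.
Proof.
move=> cc /forallP H; apply/forallP => i; apply: (le_trans (H i)).
exact: ler_wpM2r.
Qed.

(** As long as the box of radius j r around [x] misses a point of [s], an edge crosses its boundary,
    and the next box contains at least one more distinct point. The number of distinct points bounds
    the number of such steps. *)
Lemma conn_box s x y : conn s -> x \in s -> y \in s -> box (size s)%:R x y.
Proof.
move=> /connP[_ cr] xs ys.
suff : exists2 j : nat, (j <= size (undup s))%N & forall z, z \in s -> box j%:R x z.
  move=> [j js H]; apply: box_widen (H _ ys).
  by rewrite ler_nat (leq_trans js)// size_undup.
pose cnt (j : nat) := count (fun z => box j%:R x z) (undup s).
have cnt1 j : ~ (forall z, z \in s -> box j%:R x z) -> (cnt j < cnt j.+1)%N.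
  move=> nH.
  have [z zs bz] : exists2 z, z \in s & ~~ box j%:R x z.
    apply: contrapT => H; apply: nH => z zs; apply: contrapT => /negP bz.
    by apply: H; exists z.
  have [||u [v [us vs bu bv nuv]]] := cr (box j%:R x).
  - exists x => //; apply/forallP => i.
    by rewrite subrr normr0 mulr_ge0.
  - by exists z.
  have bv' : box j.+1%:R x v.
    by rewrite -addn1 natrD; apply: (box_trans bu); exact: nbr_box.
  have sub : subpred (fun w => box j%:R x w) (fun w => box j.+1%:R x w).
    by move=> w; apply: box_widen; rewrite ler_nat.
  rewrite /cnt -!size_filter.
  apply: (@leq_ltn_trans (size (seq.filter (predC1 v) (seq.filter (fun w => box j.+1%:R x w) (undup s))))).
    apply: uniq_leq_size; first by rewrite filter_uniq ?undup_uniq.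
    move=> w; rewrite !mem_filter /= => /andP[bw ws].
    rewrite ws (sub _ bw) !andbT; apply/eqP => wv.
    by move: bv; rewrite -wv bw.
  rewrite size_filter -[X in (_ < X)%N](count_predC (predC1 v)) -[X in (X < _)%N]addn0 ltn_add2l.
  rewrite -has_count; apply/hasP; exists v; last by rewrite /= eqxx.
  by rewrite mem_filter bv' mem_undup.
apply: contrapT => nH.
have lt j : (j <= size (undup s))%N -> (j <= cnt j)%N.
  elim: j => // j IH js; apply: (leq_ltn_trans (IH (ltnW js))); apply: cnt1 => H.
  by apply: nH; exists j => //; exact: ltnW.
apply: nH; exists (size (undup s)) => // z zs.
have : cnt (size (undup s)) == size (undup s).
  by rewrite eqn_leq lt// andbT count_size.
by rewrite -all_count => /allP; apply; rewrite mem_undup.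
Qed.

Definition far a (y : T) : bool := all (fun x => ~~ nbr x y) a.

Lemma sep_far a b : sep a b = all (far a) b.
Proof.
apply/sepP/allP => [H y yb|H x y xa yb]; first by apply/allP => x xa; exact: H.
by have /allP := H y yb; apply.
Qed.

(** Deleting the points near [a] changes the status of [p] only if a deleted point belongs to [p.1]
    or is a neighbour of a point of [p.1]. The radius 2 (k + 1) adds up k steps inside [a], one to
    the deleted point, one to [p.1] and k inside [p.1]. *)
Lemma far_change k a s x0 p : conn a -> x0 \in a -> size a = k -> p \in splits k s ->
  isolated p != (all (far a) p.1) && isolated (p.1, seq.filter (far a) p.2) ->
  all (box (2 * k.+1)%:R x0) p.1.
Proof.
move=> ca x0a ak ps.
have fb y : ~~ far a y -> box k.+1%:R x0 y.
  move=> /allPn[x xa]; rewrite negbK => nxy.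
  rewrite -addn1 natrD; apply: box_trans (nbr_box nxy).
  by rewrite -ak; exact: conn_box.
have key y : conn p.1 -> box k.+1%:R x0 y ->
   (exists2 z, z \in p.1 & box 1 y z) -> all (box (2 * k.+1)%:R x0) p.1.
  move=> cp by' [z zp yz]; apply/allP => w wp.
  rewrite mul2n -addnn natrD; apply: (box_trans by').
  rewrite -[k.+1]addn1 natrD addrC; apply: (box_trans yz).
  by rewrite -(splits_size ps); exact: conn_box.
rewrite /isolated /=; case: (boolP (conn p.1)) => cp /=; last by rewrite andbF.
case: (boolP (all (far a) p.1)) => /= [fa|/allPn[y yp fy] _]; last first.
  apply: (key y) => //; first exact: fb.
  exists y => //; apply/forallP => i; by rewrite subrr normr0 mul1r.
case: (boolP (sep p.1 (seq.filter (far a) p.2))) => /= [/sepP sf|ns]; last first.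
  case: (boolP (sep p.1 p.2)) => // /sepP sp.
  exfalso; move/negP: ns; apply; apply/sepP => u v up.
  by rewrite mem_filter => /andP[_]; exact: sp.
case: (boolP (sep p.1 p.2)) => //= ns _.
move: ns; rewrite sep_sym => /allPn[y y2 /allPn[z z1]]; rewrite negbK => nyz.
case: (boolP (far a y)) => fy.
  have := sf z y z1; rewrite mem_filter fy y2 => /(_ isT).
  by rewrite nbr_sym nyz.
apply: (key y) => //; first exact: fb.
by exists z => //; exact: nbr_box.
Qed.

End graph_counts.

Section graph_measurability.
Variables (R : realType) (d : nat) (r : R).
Notation T := (d.-tuple R).
Implicit Types (s a b : seq T).
Notation W := (W r).
Notation conn := (conn r).
Notation nbr := (nbr r).
Notation sep := (sep r).
Notation far := (far r).

Lemma measurable_pattern_fun m (f : m.-tuple T -> R) :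
  (forall t u, pattern r (tnth t) = pattern r (tnth u) -> f t = f u) ->
  measurable_fun setT f.
Proof.
move=> fP _ Y mY; rewrite setTI.
rewrite (_ : _ @^-1` _ = \bigcup_(p in [set p | exists2 t, pattern r (tnth t) = p & Y (f t)])
    [set t | pattern r (fun i => tnth t i) = p]).
  apply: fin_bigcup_measurable => [|p _]; first exact: finite_finset.
  by apply: (@measurable_pattern _ _ _ _ _ _ (fun i t => tnth t i)) => i; exact: measurable_tnth.
apply/seteqP; split=> [t Yt|t [p [u up Yu] tp]].
  by exists (pattern r (tnth t)) => //; exists t.
by rewrite /= (fP t u)// up -tp.
Qed.

Lemma fset_tnth m (t : m.-tuple T) : [fset x in (t : seq T)]%fset = [fset tnth t i | i : 'I_m]%fset.
Proof.
apply/fsetP => x; rewrite inE /=; apply/tnthP/imfsetP => [[i ->]|[i _ ->]]; exists i => //.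
Qed.

Lemma W_pattern m k (t u : m.-tuple T) : pattern r (tnth t) = pattern r (tnth u) ->
  W k t = W k u.
Proof.
move=> tu; rewrite !WE !fset_tnth; apply/eqP.
by rewrite eqn_leq !leq_ncomponents_pattern.
Qed.

(** Counting the components of every size reduces connectedness, and with it its measurability, to
    [W]. *)
Lemma conn_W s : conn s = (\sum_(j < (size s).+1) W j s == 1)%N.
Proof.
rewrite /(conn _) /graph_connected -sum1_card; congr (_ == 1)%N.
set A := [fset x in s]%fset.
have le C : (#|C : {set A}| < (size s).+1)%N.
  rewrite ltnS (leq_trans (max_card _))// -cardfE.
  apply: uniq_leq_size; first exact: fset_uniq.
  by move=> x; rewrite inE.
rewrite (partition_big (fun C : {set A} => Ordinal (le C)) predT)//=.
apply: eq_bigr => j _; rewrite !WE /ncomponents -sum1_card.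
by apply: eq_bigl => C; rewrite !inE.
Qed.

Lemma conn_pattern m (t u : m.-tuple T) : pattern r (tnth t) = pattern r (tnth u) ->
  conn t = conn u.
Proof.
move=> tu; rewrite !conn_W !size_tuple; congr (_ == 1)%N.
by apply: eq_bigr => j _; exact: W_pattern.
Qed.

Lemma mseq_W k (g : nat -> R) : mseq (fun s => (g (W k s))%:E).
Proof.
move=> m; apply/measurable_EFinP; apply: measurable_pattern_fun => t u tu.
by rewrite (W_pattern _ tu).
Qed.

Lemma mseq_conn : mseq (fun s => (conn s)%:R%:E : \bar R).
Proof.
move=> m; apply/measurable_EFinP; apply: measurable_pattern_fun => t u tu.
by rewrite (conn_pattern tu).
Qed.

Lemma measurable_nbr d' (O : measurableType d') (x y : O -> T) (c : R) :
  measurable_fun setT x -> measurable_fun setT y ->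
  measurable [set w | edist (x w) (y w) <= c].
Proof.
move=> mx my.
have := @measurable_fun_ler _ _ _ _ _ _ (measurable_edist mx my) (measurable_cst c).
by move=> /(_ measurableT [set true] I); rewrite setTI; exact.
Qed.

Lemma measurable_mem d' (O : measurableType d') (x : O -> T) (g : O -> seq T) :
  measurable_fun setT x -> mlist g -> measurable [set w | x w \in g w].
Proof.
move=> mx; elim => [|y {}g my mg IH].
  by rewrite (_ : [set _ | _] = set0)//; apply/seteqP; split => w.
rewrite (_ : [set _ | _] = [set w | edist (x w) (y w) <= 0] `|` [set w | x w \in g w]).
  by apply: measurableU => //; exact: measurable_nbr.
apply/seteqP; split => w /=; rewrite inE edist_eq0.
  by move=> /orP[]; [left|right].
by move=> [->//|->]; rewrite orbT.
Qed.

Lemma measurable_all_far d' (O : measurableType d') (x : O -> T) (g : O -> seq T) :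
  measurable_fun setT x -> mlist g -> measurable [set w | all (fun y => ~~ nbr (x w) y) (g w)].
Proof.
move=> mx; elim => [|y {}g my mg IH].
  by rewrite (_ : [set _ | _] = setT)//; apply/seteqP; split => w.
rewrite (_ : [set _ | _] = ~` [set w | edist (x w) (y w) <= r] `&` [set w | all (fun y => ~~ nbr (x w) y) (g w)]).
  by apply: measurableI => //; apply: measurableC; exact: measurable_nbr.
by apply/seteqP; split => w /=; [move=> /andP[/negP]|move=> [/negP ? ?]; apply/andP].
Qed.

Lemma measurable_sep d' (O : measurableType d') (g h : O -> seq T) :
  mlist g -> mlist h -> measurable [set w | sep (g w) (h w)].
Proof.
move=> mg mh; elim: mg => [|x {}g mx mg IH].
  by rewrite (_ : [set _ | _] = setT)//; apply/seteqP; split => w.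
rewrite (_ : [set _ | _] = [set w | all (fun y => ~~ nbr (x w) y) (h w)] `&` [set w | sep (g w) (h w)]).
  by apply: measurableI => //; exact: measurable_all_far.
by apply/seteqP; split => w /= => [/andP[]|[? ?]]; last by apply/andP.
Qed.

Lemma measurable_far a : measurable [set y | far a y].
Proof.
rewrite (_ : [set y | _] = [set y | sep a [:: y]]); last first.
  by apply/seteqP; split => y; rewrite /= sep_far /= andbT.
by apply: measurable_sep; [exact: mlist_cst|apply: mlist_cons => //; exact: mlist_nil].
Qed.

Lemma measurable_box c x : measurable [set y : T | box r c x y].
Proof.
rewrite (_ : [set y | _] = \bigcap_(i in [set: 'I_d]) [set y | `|tnth x i - tnth y i| <= c * r]).
  apply: fin_bigcap_measurable => // i _.
  pose f (y : T) := `|tnth x i - tnth y i|.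
  have mf : measurable_fun setT f.
    by apply: measurableT_comp => //; apply: measurable_funB => //; exact: measurable_tnth.
  rewrite (_ : [set y | _] = f @^-1` `]-oo, c * r]); last first.
    by apply/seteqP; split => y; rewrite /= in_itv.
  by rewrite -[X in measurable X]setTI; exact: mf.
apply/seteqP; split => y /=; first by move=> /forallP H i _; exact: H.
by move=> H; apply/forallP => i; exact: H.
Qed.

Lemma mseq2_isolated k (g : nat -> R) :
  mseq2 (fun a b => ((isolated r (a, b))%:R * g (W k (a ++ b)))%:E).
Proof.
move=> i j; apply/measurable_EFinP; apply: measurable_funM.
  under eq_fun do rewrite /isolated /= -mulnb natrM.
  apply: measurable_funM.
    by apply/measurable_EFinP; apply: (mseq_mlist mseq_conn); exact: mlist_tval.
  apply/measurable_EFinP; apply: measurable_pred01.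
  by apply: measurable_sep; exact: mlist_tval.
apply/measurable_EFinP; apply: (mseq_mlist (mseq_W k g)).
by apply: mlist_cat; exact: mlist_tval.
Qed.

Lemma mseq2_isolated' k (g : nat -> R) :
  mseq2 (fun a b => ((isolated r (a, b))%:R * g (W k b))%:E).
Proof.
move=> i j; apply/measurable_EFinP; apply: measurable_funM.
  have := @mseq2_isolated k (fun=> 1) i j => /measurable_EFinP.
  by under eq_fun do rewrite mulr1.
by apply/measurable_EFinP; apply: (mseq_mlist (mseq_W k g)); exact: mlist_tval.
Qed.

Local Open Scope ereal_scope.
Section null_ties.
Variable mu : probability T R.
Hypothesis mu_atomless : forall x, mu [set x] = 0.
Notation iint := (iint mu).

Lemma mseq_mem x : mseq (fun s => (x \in s)%:R%:E : \bar R).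
Proof.
move=> m; apply: measurable_pred01; apply: measurable_mem => //.
exact: mlist_tval.
Qed.

Lemma iint_mem x m : iint m (fun s => (x \in s)%:R%:E) = 0.
Proof.
have b0 (b : bool) : 0 <= b%:R%:E :> \bar R by rewrite lee_fin.
elim: m => [|m IH]; first by rewrite iint0//; exact: mseq_mem.
apply/eqP; rewrite eq_le iint_ge0// andbT iintS//; last exact: mseq_mem.
have mx : measurable [set y | x == y].
  rewrite (_ : [set _ | _] = [set y | edist x y <= 0]%R); first exact: measurable_nbr.
  by apply/seteqP; split => y /=; rewrite edist_eq0.
apply: (@le_trans _ _ (\int[mu]_y (x == y)%:R%:E)).
  apply: ge0_le_integral => //.
  - by move=> y _; exact: iint_ge0.
  - by apply: (@measurable_iint_cons _ _ _ mu m (fun s => (x \in s)%:R%:E)) => //; exact: mseq_mem.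
  - exact: measurable_pred01.
  move=> y _.
  apply: (@le_trans _ _ (iint m (fun s => (x == y)%:R%:E + (x \in s)%:R%:E))).
    apply: le_iint => //.
    - exact: (@mseq_cons _ _ _ (fun s => (x \in s)%:R%:E) y (mseq_mem x)).
    - by apply: mseqD; [exact: (@mseq_cst _ T R (x == y)%:R%:E)|exact: mseq_mem].
    move=> s _; rewrite inE -EFinD lee_fin; case: (x == y); case: (x \in s); rewrite /= ?addr0 ?add0r//; lra.
  have -> : iint m (fun s => (x == y)%:R%:E + (x \in s)%:R%:E) =
      iint m (fun s => (x == y)%:R%:E * (all xpredT s)%:R%:E) + iint m (fun s => (x \in s)%:R%:E).
    rewrite -iintD//.
    - by apply: eq_iint => s _; rewrite all_predT mule1.
    - apply: mseqM; first exact: mseq_cst.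
      by apply: mseq_all; rewrite (_ : [set _ | _] = setT)//; apply/seteqP.
    - exact: mseq_mem.
  have mT : measurable [set x : T | xpredT x] by rewrite (_ : [set _ | _] = setT)//; apply/seteqP.
  rewrite IH adde0 iintZl//; last exact: mseq_all.
  rewrite iint_all// (_ : [set x | _] = setT) ?probability_setT ?expr1n ?mule1//.
  by apply/seteqP.
rewrite le_eqVlt; apply/orP; left; apply/eqP.
have mx1 : measurable [set x].
  rewrite (_ : [set x] = [set y | x == y])//.
  by apply/seteqP; split => y /= => [->//|/eqP].
transitivity (mu [set x]) => //.
rewrite -[RHS]mul1e -integral_cst//.
rewrite [RHS]integral_mkcond; apply: eq_integral => y _.
rewrite patchE; case: ifPn => [/set_mem /= ->|/negP yx]; first by rewrite eqxx.
by case: eqP => // xy; exfalso; apply: yx; apply/mem_set; rewrite xy.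
Qed.

Lemma mseq_uniq : mseq (fun s => (~~ uniq s)%:R%:E : \bar R).
Proof.
move=> m; apply: measurable_pred01.
rewrite (_ : [set t | _] = ~` [set t : m.-tuple T | uniq t]); last first.
  by apply/seteqP; split => t /= /negP.
apply: measurableC.
suff H d' (O : measurableType d') (g : O -> seq T) : mlist g ->
    measurable [set w | uniq (g w)] by apply: H; exact: mlist_tval.
elim => [|y {}g my mg IH].
  by rewrite (_ : [set _ | _] = setT)//; apply/seteqP; split => w.
rewrite (_ : [set _ | _] = ~` [set w | y w \in g w] `&` [set w | uniq (g w)]).
  by apply: measurableI => //; apply: measurableC; exact: measurable_mem.
by apply/seteqP; split => w /=; [move=> /andP[/negP]|move=> [/negP ? ?]; apply/andP].
Qed.

Lemma le_iint_or m F G H : (forall s, 0 <= F s) -> (forall s, 0 <= G s) ->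
  (forall s, 0 <= H s) -> mseq F -> mseq G -> mseq H ->
  (forall s, H s <= F s + G s) -> iint m F = 0 -> iint m G = 0 -> iint m H = 0.
Proof.
move=> F0 G0 H0 mF mG mH HFG iF iG; apply/eqP; rewrite eq_le iint_ge0// andbT.
apply: (@le_trans _ _ (iint m (fun s => F s + G s))).
  by apply: le_iint => //; exact: mseqD.
by rewrite iintD// iF iG adde0.
Qed.

(** Either the first point is hit by a later one, which is null by [iint_mem], or the repetition is
    among the later ones. *)
Lemma iint_uniq m : iint m (fun s => (~~ uniq s)%:R%:E) = 0.
Proof.
have b0 (b : bool) : 0 <= b%:R%:E :> \bar R by rewrite lee_fin.
elim: m => [|m IH]; first by rewrite iint0//; exact: mseq_uniq.
rewrite iintS//; last exact: mseq_uniq.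
rewrite integral0_eq// => x _.
apply: (@le_iint_or m (fun s => (x \in s)%:R%:E) (fun s => (~~ uniq s)%:R%:E)) => //.
- exact: mseq_mem.
- exact: mseq_uniq.
- exact: (@mseq_cons _ _ _ (fun s => (~~ uniq s)%:R%:E) x mseq_uniq).
- move=> s; rewrite /= negb_and negbK -EFinD lee_fin.
  by case: (x \in s); case: (uniq s) => /=; lra.
- exact: iint_mem.
Qed.

Lemma iint_uniq_cat m a : uniq a -> iint m (fun s => (~~ uniq (a ++ s))%:R%:E) = 0.
Proof.
have b0 (b : bool) : 0 <= b%:R%:E :> \bar R by rewrite lee_fin.
elim: a => [|x a IH] /=; first by rewrite iint_uniq.
move=> /andP[xa ua].
have mu' c : mseq (fun s => (~~ uniq (c ++ s))%:R%:E : \bar R).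
  elim: c => [|y c IHc]; first exact: mseq_uniq.
  move=> n; apply: (mseq_mlist mseq_uniq).
  by apply: mlist_cat; [exact: mlist_cst|exact: mlist_tval].
apply: (@le_iint_or m (fun s => (x \in s)%:R%:E) (fun s => (~~ uniq (a ++ s))%:R%:E)) => //.
- exact: mseq_mem.
- exact: (mu' (x :: a)).
- move=> s; rewrite mem_cat (negPf xa) /= negb_and negbK -EFinD lee_fin.
  by case: (x \in s); case: (uniq (a ++ s)) => /=; lra.
- exact: iint_mem.
- exact: IH.
Qed.

(** Repetitions are null because [mu] has no atoms. The fixed list [a] is included since, after the
    Mecke formula, the chosen points must also be distinct from the remaining process. *)
Lemma le_iint_uniq m a F G : uniq a -> mseq F -> mseq G ->
  (forall s, 0 <= F s) -> (forall s, 0 <= G s) ->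
  (forall s, size s = m -> uniq (a ++ s) -> F s <= G s) -> iint m F <= iint m G.
Proof.
move=> ua mF mG F0 G0 FG.
apply: ae_ge0_le_integral => //; [exact: mF|exact: mG|].
have mU : measurable [set t : m.-tuple T | ~~ uniq (a ++ t)].
  rewrite (_ : [set t | _] = (fun t : m.-tuple T => (~~ uniq (a ++ t))%:R%:E : \bar R) @^-1` [set 1]).
    rewrite -[X in measurable X]setTI.
    have : mseq (fun s => (~~ uniq (a ++ s))%:R%:E : \bar R).
      move=> n; apply: (mseq_mlist mseq_uniq).
      by apply: mlist_cat; [exact: mlist_cst|exact: mlist_tval].
    by move=> /(_ m); apply.
  apply/seteqP; split => t /=; first by move=> ->.
  by case: uniq => //= /eqP; rewrite eqe eq_sym oner_eq0.
exists [set t : m.-tuple T | ~~ uniq (a ++ t)]; split => //.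
  rewrite -[LHS]mul1e -integral_cst// integral_mkcond -[RHS](iint_uniq_cat m ua).
  apply: eq_integral => t _; rewrite patchE.
  case: ifPn => [/set_mem /= ->//|/negP yx].
  by case: (boolP (uniq (a ++ t))) => // H; exfalso; apply: yx; apply/mem_set.
move=> t /= H; apply/negP => ut; apply: H => _; apply: FG => //; exact: size_tuple.
Qed.

Lemma eq_iint_uniq m a F G : uniq a -> mseq F -> mseq G ->
  (forall s, 0 <= F s) -> (forall s, 0 <= G s) ->
  (forall s, size s = m -> uniq (a ++ s) -> F s = G s) -> iint m F = iint m G.
Proof.
move=> ua mF mG F0 G0 FG; apply/le_anti/andP; split.
  by apply: (le_iint_uniq ua) => // s sm us; rewrite FG.
by apply: (le_iint_uniq ua) => // s sm us; rewrite FG.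
Qed.

Lemma le_pint_uniq (t : R) a F G : uniq a -> mseq F -> mseq G ->
  (forall s, 0 <= F s) -> (forall s, 0 <= G s) ->
  (forall s, uniq (a ++ s) -> F s <= G s) -> pint mu t F <= pint mu t G.
Proof.
move=> ua mF mG F0 G0 FG; apply: lee_nneseries => m _.
  by move=> _; apply: mule_ge0; [rewrite lee_fin poisson_pmf_ge0|exact: iint_ge0].
apply: lee_wpmul2l; first by rewrite lee_fin poisson_pmf_ge0.
by apply: (le_iint_uniq ua) => // s _; exact: FG.
Qed.

Lemma eq_pint_uniq (t : R) a F G : uniq a -> mseq F -> mseq G ->
  (forall s, 0 <= F s) -> (forall s, 0 <= G s) ->
  (forall s, uniq (a ++ s) -> F s = G s) -> pint mu t F = pint mu t G.
Proof.
move=> ua mF mG F0 G0 FG; apply/le_anti/andP; split.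
  by apply: (@le_pint_uniq t a _ _ ua) => // s us; rewrite FG.
by apply: (@le_pint_uniq t a _ _ ua) => // s us; rewrite FG.
Qed.

End null_ties.
End graph_measurability.

(** * The Poisson approximation *)

Section stein_identity.
Variables (R : realType) (d : nat) (r : R).
Notation T := (d.-tuple R).
Implicit Types (s a b : seq T).
Notation W := (W r).
Notation conn := (conn r).
Notation isolated := (isolated r).
Notation far := (far r).
Variable mu : probability T R.
Hypothesis mu_atomless : forall x, mu [set x] = 0%E.
Variables (t : R) (k : nat) (beta : R).
Hypotheses (t_gt0 : 0 < t) (r_ge0 : 0 <= r) (beta_ge0 : 0 <= beta).
Hypothesis mu_box : forall x, (mu [set y | box r (2 * k.+1)%:R x y] <= beta%:E)%E.
Local Open Scope ereal_scope.

Notation iint := (iint mu).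
Notation pint := (pint mu t).

Definition EW (g : nat -> R) : \bar R := pint (fun s => (g (W k s))%:E).

Let Q : R := (t ^+ k / k`!%:R * beta ^+ k)%R.

Lemma pint1 : pint (fun=> 1) = 1.
Proof.
have mT : measurable [set x : T | xpredT x] by rewrite (_ : [set _ | _] = setT)//; apply/seteqP.
transitivity (pint (fun s => (all xpredT s)%:R%:E)).
  by apply: eq_eseriesr => m _; congr (_ * _); apply: eq_iint => s _; rewrite all_predT.
rewrite pint_all// (_ : [set x | _] = setT) ?probability_setT/=; last by apply/seteqP.
by rewrite subrr mulr0 oppr0 expR0.
Qed.

Lemma pint_boxes x0 :
  pint (fun s => \sum_(p <- splits k s) (all (box r (2 * k.+1)%:R x0) p.1)%:R%:E) <= Q%:E.
Proof.
have mb := measurable_box r (2 * k.+1)%:R x0.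
have mA : mseq2 (fun a b : seq T => (all (box r (2 * k.+1)%:R x0) a)%:R%:E : \bar R).
  by move=> i j; apply: (mseq_mlist (mseq_all _)) => //; exact: mlist_tval.
rewrite (mecke _ _ t_gt0 _ mA)//.
rewrite /Q [X in _ <= X]EFinM; apply: lee_wpmul2l.
  by rewrite lee_fin divr_ge0// exprn_ge0// ltW.
rewrite (_ : iint k _ = iint k (fun a => (all (box r (2 * k.+1)%:R x0) a)%:R%:E)); last first.
  apply: eq_iint => s _.
  rewrite -[LHS](_ : pint (fun b => (all (box r (2 * k.+1)%:R x0) s)%:R%:E * 1) = _); last first.
    by congr pint; apply/funext => b; rewrite mule1.
  by rewrite pintZl// pint1 mule1.
rewrite iint_all// lee_fin; apply: lerXn2r; rewrite ?nnegrE ?fine_ge0//.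
by rewrite -lee_fin fineK ?fin_num_measure//.
Qed.

(** The expectation of [g] at the number of components of the points other than [a], restricted to
    the event that [a] is an isolated component; for [g] constantly 1 it is the probability of that
    event. *)
Let V (g : nat -> R) a : \bar R := pint (fun b => ((isolated (a, b))%:R * g (W k b))%:E).

Lemma measurable_V g : (forall j, 0 <= g j)%R -> mseq (V g).
Proof.
move=> g0 m; apply: measurable_pint.
  by move=> w s; rewrite lee_fin mulr_ge0.
by move=> j; exact: (@mseq2_isolated' R d r k g m j).
Qed.

Lemma V_ge0 g a : (forall j, 0 <= g j)%R -> 0 <= V g a.
Proof. by move=> g0; apply: pint_ge0 => s; rewrite lee_fin mulr_ge0. Qed.

(** The factor [j] is resolved into a sum over isolated splittings, and [W_cat] takes [a] out of the
    count at the cost of the shift in [g j.+1]. *)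
Lemma EW_palm g : (forall j, 0 <= g j)%R ->
  EW (fun j => j%:R * g j)%R = (t ^+ k / k`!%:R)%:E * iint k (V (fun j => g j.+1)).
Proof.
move=> g0.
pose F a b : \bar R := ((isolated (a, b))%:R * g (W k (a ++ b)))%:E.
have F0 a b : 0 <= F a b by rewrite lee_fin mulr_ge0.
have mF : mseq2 F by exact: mseq2_isolated.
transitivity (pint (fun s => \sum_(p <- splits k s) F p.1 p.2)).
  apply: (@eq_pint_uniq _ _ mu mu_atomless t [::]) => //.
  - exact: (@mseq_W _ _ r k (fun j => j%:R * g j)%R).
  - exact: mseq_splits.
  - by move=> s; rewrite lee_fin mulr_ge0.
  - by move=> s; apply: sume_ge0.
  move=> s /= us; rewrite W_splits// natr_sum mulr_suml -sumEFin.
  rewrite [LHS]big_seq [RHS]big_seq; apply: eq_bigr => p ps.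
  by rewrite /F -surjective_pairing (perm_W _ _ (splits_perm ps)) W_splits.
rewrite (mecke mu k t_gt0 F0 mF).
apply: (congr1 (fun z => (t ^+ k / k`!%:R)%:E * z)).
apply: (@eq_iint_uniq _ _ mu mu_atomless k [::]) => //.
- move=> m; apply: measurable_pint; first by move=> w s; exact: F0.
  by move=> j; exact: (mF m j).
- by apply: measurable_V.
- by move=> s; exact: pint_ge0.
- by move=> s; apply: V_ge0.
move=> a ak /= ua.
apply: (@eq_pint_uniq _ _ mu mu_atomless t a) => //.
- exact: mseq2r mF.
- exact: mseq2r (@mseq2_isolated' R d r k (fun j => g j.+1)).
- by move=> s; rewrite lee_fin mulr_ge0.
move=> s us; rewrite /F; case: (boolP (isolated (a, s))) => iso; last by rewrite !mul0r.
by rewrite (W_cat us ak iso).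
Qed.

Lemma EW_mean : EW (fun j => j%:R) = (t ^+ k / k`!%:R)%:E * iint k (V (fun=> 1%R)).
Proof.
rewrite -(EW_palm (g := fun=> 1%R))//.
by congr EW; apply/funext => j; rewrite mulr1.
Qed.

Lemma dist_W_far a b x0 : conn a -> x0 \in a -> size a = k -> uniq b ->
  (`|(W k (seq.filter (far a) b))%:R - (W k b)%:R| <=
   \sum_(p <- splits k b) (all (box r (2 * k.+1)%:R x0) p.1)%:R :> R)%R.
Proof.
move=> ca x0a ak ub.
rewrite !W_splits ?filter_uniq// !natr_sum.
rewrite (sum_splits_filter _ _ _ (fun a b => (isolated (a, b))%:R%R : R)).
rewrite big_mkcond /= -sumrB (le_trans (ler_norm_sum _ _ _))//.
rewrite big_seq [X in (_ <= X)%R]big_seq; apply: ler_sum => p ps.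
have := far_change r_ge0 ca x0a ak ps.
case: (isolated p); case: (all (far a) p.1) => /=; case: (isolated (p.1, _)) => //=;
  rewrite ?subrr ?normr0 ?ler0n// => /(_ isT) ->; rewrite ?subr0 ?sub0r ?normrN normr1//.
Qed.

(** By [pint_restrict], [c] is the probability that no point is near [a]. What matters is that it is
    the same for every [h], so that [V h a] can be compared with [V] of the constant 1 without any
    estimate of [c]. *)
Lemma V_restrict a : conn a ->
  exists2 c : R, (0 <= c)%R & forall h, (forall j, 0 <= h j)%R ->
    V h a = c%:E * pint (fun b => (h (W k (seq.filter (far a) b)))%:E).
Proof.
move=> ca; pose p y := ~~ far a y.
have pE : (fun y => ~~ p y) = far a by apply/funext => y; rewrite /p negbK.
have mp : measurable [set y | p y].
  rewrite (_ : [set y | _] = ~` [set y | far a y]).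
    by apply: measurableC; exact: measurable_far.
  by apply/seteqP; split => y /= /negP.
exists (expR (- (t * fine (mu [set y | p y])))); last first.
  move=> h h0; rewrite /V.
  have := pint_restrict mu t_gt0 mp (g := fun b => h (W k b)) (fun b => h0 _) (mseq_W r k h).
  rewrite /= pE => <-; congr pint; apply/funext => b.
  by rewrite /isolated /= ca /= sep_far EFinM.
exact: expR_ge0.
Qed.

(** Up to the common factor [c], both quantities are integrals over the same process, one of its
    full list [b] and one of [b] without the points near [a]; [dist_W_far] compares them list by
    list. *)
Lemma V_bounds g (L : R) a : (forall j, 0 <= g j)%R -> (0 <= L)%R ->
  (forall i j, `|g i - g j| <= L * `|i%:R - j%:R|)%R -> size a = k ->
  V g a <= V (fun=> 1%R) a * (EW g + (L * Q)%:E) /\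
  V (fun=> 1%R) a * EW g <= V g a + V (fun=> 1%R) a * (L * Q)%:E.
Proof.
move=> g0 L0 Lip ak.
have [ca|nca] := boolP (conn a); last first.
  have V0 h : V h a = 0.
    rewrite /V (_ : (fun b => _) = fun=> 0%:E * 1); last first.
      by apply/funext => b; rewrite /isolated /= (negPf nca) !mul0r mul0e.
    by rewrite pintZl// mul0e.
  by rewrite !V0 !mul0e adde0.
have [c c0 VE] := V_restrict ca.
have [[x0 x0a] _] := (connP r a).1 ca.
rewrite !VE// pint1 mule1.
pose H := pint (fun b => (g (W k (seq.filter (far a) b)))%:E).
pose q b : R := (\sum_(p <- splits k b) (all (box r (2 * k.+1)%:R x0) p.1)%:R)%R.
have q0 b : (0 <= q b)%R by apply: sumr_ge0.
have mq : mseq (EFin \o q).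
  move=> m; have := @mseq_splits _ T R k (fun a b => (all (box r (2 * k.+1)%:R x0) a)%:R%:E).
  rewrite (_ : EFin \o q = fun s => \sum_(p <- splits k s) (all (box r (2 * k.+1)%:R x0) p.1)%:R%:E).
    apply=> //; move=> i j; apply: (mseq_mlist (mseq_all _)); last exact: mlist_tval.
    exact: measurable_box.
  by apply/funext => s; rewrite /= /q -sumEFin.
have pq : pint (fun b => (L * q b)%:E) <= (L * Q)%:E.
  under [X in pint X]eq_fun do rewrite EFinM.
  rewrite pintZl//.
  rewrite [X in _ <= X]EFinM; apply: lee_wpmul2l; first by rewrite lee_fin.
  apply: le_trans (pint_boxes x0); rewrite le_eqVlt; apply/orP; left; apply/eqP.
  by congr pint; apply/funext => s; rewrite /q -sumEFin.
have mLq : mseq (fun b => (L * q b)%:E).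
  by move=> m; under eq_fun do rewrite EFinM; apply: emeasurable_funM => //; exact: mq.
have mg : mseq (fun b => (g (W k b))%:E) by exact: mseq_W.
have mgf : mseq (fun b => (g (W k (seq.filter (far a) b)))%:E).
  apply: (@mseq_filter _ T R _ (fun b => (g (W k b))%:E)) => //.
  exact: measurable_far.
have Lq0 b : 0 <= (L * q b)%:E by rewrite lee_fin mulr_ge0.
have eg0 j : 0 <= (g j)%:E by rewrite lee_fin.
have comp (F G : seq T -> \bar R) : (forall s, 0 <= F s) -> (forall s, 0 <= G s) ->
    mseq F -> mseq G -> (forall b, uniq b -> F b <= G b + (L * q b)%:E) ->
    pint F <= pint G + (L * Q)%:E.
  move=> F0 G0 mF mG FG.
  apply: (@le_trans _ _ (pint G + pint (fun b => (L * q b)%:E))); last by rewrite leeD2l.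
  rewrite -pintD//.
  have mGq := mseqD mG mLq.
  have Gq0 s : 0 <= G s + (L * q s)%:E by rewrite adde_ge0.
  exact: (@le_pint_uniq _ _ mu mu_atomless t [::] F _ isT mF mGq F0 Gq0 FG).
have H1 : H <= EW g + (L * Q)%:E.
  apply: comp => // b ub; rewrite -EFinD lee_fin -lerBlDl (le_trans (ler_norm _))//.
  by rewrite (le_trans (Lip _ _))// ler_wpM2l// dist_W_far.
have H2 : EW g <= H + (L * Q)%:E.
  apply: comp => // b ub; rewrite -EFinD lee_fin -lerBlDl (le_trans (ler_norm _))//.
  by rewrite (le_trans (Lip _ _))// ler_wpM2l// distrC dist_W_far.
have LQ0 : 0 <= (L * Q)%:E.
  by rewrite lee_fin mulr_ge0// mulr_ge0 ?exprn_ge0// divr_ge0// exprn_ge0// ltW.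
have cE0 : 0 <= c%:E by rewrite lee_fin.
split; first exact: (lee_wpmul2l cE0 H1).
have HH0 : 0 <= H by exact: pint_ge0.
rewrite -/H -ge0_muleDr//.
exact: (lee_wpmul2l cE0 H2).
Qed.

(** The bounds of [V_bounds] integrated over [a]. Two inequalities replace an absolute difference
    because [lam] and the expectations may a priori be infinite. *)
Theorem stein_bounds g (L : R) : (forall j, 0 <= g j)%R -> (0 <= L)%R ->
  (forall i j, `|g i - g j| <= L * `|i%:R - j%:R|)%R ->
  let lam := EW (fun j => j%:R) in
  EW (fun j => j%:R * g j)%R <= lam * (EW (fun j => g j.+1) + (L * Q)%:E) /\
  lam * EW (fun j => g j.+1) <= EW (fun j => j%:R * g j)%R + lam * (L * Q)%:E.
Proof.
move=> g0 L0 Lip lam.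
pose g' j := g j.+1.
have g'0 j : (0 <= g' j)%R by exact: g0.
have Lip' i j : (`|g' i - g' j| <= L * `|i%:R - j%:R|)%R.
  have -> : (i%:R - j%:R = i.+1%:R - j.+1%:R :> R)%R by rewrite -!natr1; ring.
  exact: Lip.
have c0 : 0 <= (t ^+ k / k`!%:R)%:E by rewrite lee_fin divr_ge0// exprn_ge0// ltW.
have EW0 : 0 <= EW g' by apply: pint_ge0 => s; rewrite lee_fin.
have LQ0 : 0 <= (L * Q)%:E.
  by rewrite lee_fin mulr_ge0// mulr_ge0 ?exprn_ge0// divr_ge0// exprn_ge0// ltW.
have mV1 := measurable_V (g := fun=> 1%R) (fun=> ler01).
have V10 a := V_ge0 (g := fun=> 1%R) a (fun=> ler01).
have mVg := measurable_V g'0.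
have Vg0 a := V_ge0 a g'0.
have IV (c : \bar R) : 0 <= c -> iint k (fun a => V (fun=> 1%R) a * c) = iint k (V (fun=> 1%R)) * c.
  move=> cc; rewrite muleC -iintZl//.
  by apply: eq_iint => a _; rewrite muleC.
rewrite /lam EW_mean (EW_palm g0) -/g'; split.
  rewrite -muleA; apply: lee_wpmul2l => //.
  rewrite -IV; last by apply: adde_ge0.
  apply: le_iint => //.
    by apply: mseqM => //; exact: (@mseq_cst _ T R).
  by move=> a ak; have [] := V_bounds g'0 L0 Lip' ak.
rewrite -!muleA -ge0_muleDr; last 2 first.
- exact: iint_ge0.
- by apply: mule_ge0 => //; exact: iint_ge0.
apply: lee_wpmul2l => //; rewrite -!IV//.
have mVc c : mseq (fun a => V (fun=> 1%R) a * c).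
  by apply: mseqM => //; exact: (@mseq_cst _ T R).
rewrite -iintD//; last by move=> a; apply: mule_ge0.
apply: le_iint => //.
- by move=> a; apply: mule_ge0.
- exact: mseqD.
by move=> a ak; have [] := V_bounds g'0 L0 Lip' ak.
Qed.

End stein_identity.

(** * The Stein equation of the Poisson law and the increments of its solution *)

Section poisson_stein.
Variables (R : realType) (lam : R).
Hypothesis lam_gt0 : 0 < lam.
Notation pm := (poisson_pmf lam).

Lemma poisson_pmf_gt0 j : 0 < pm j.
Proof.
rewrite /poisson_pmf lam_gt0 mulr_gt0 ?expR_gt0// divr_gt0 ?exprn_gt0//.
Qed.

Lemma poisson_pmfS j : j.+1%:R * pm j.+1 = lam * pm j.
Proof.
rewrite /poisson_pmf lam_gt0 factS natrM exprS.
have j0 : j`!%:R != 0 :> R by rewrite pnatr_eq0 -lt0n fact_gt0.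
have j1 : j.+1%:R != 0 :> R by rewrite pnatr_eq0.
by move: (j`!%:R) (j.+1%:R) j0 j1 => y x j0 j1; field; rewrite j0 j1.
Qed.

(** Log-concavity: the ratio of the weights at j + 1 and j is lam / (j + 1), which decreases in [j].
    The bounds on the Stein solution rest on this. *)
Lemma poisson_pmf_ratio i j : (i <= j)%N -> pm i * pm j.+1 <= pm i.+1 * pm j.
Proof.
move=> ij.
have i1 : 0 < i.+1%:R :> R by rewrite ltr0n.
have j1 : 0 < j.+1%:R :> R by rewrite ltr0n.
rewrite -(ler_pM2l (mulr_gt0 i1 j1)).
have -> : i.+1%:R * j.+1%:R * (pm i * pm j.+1) = i.+1%:R * (lam * pm j * pm i).
  by rewrite -poisson_pmfS; ring.
have -> : i.+1%:R * j.+1%:R * (pm i.+1 * pm j) = j.+1%:R * (lam * pm i * pm j).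
  by rewrite -poisson_pmfS; ring.
rewrite [lam * pm i * pm j]mulrAC ler_wpM2r ?ler_nat//.
by rewrite !mulr_ge0 ?poisson_pmf_ge0// ltW.
Qed.

Lemma series_poisson : series pm n @[n --> \oo] --> (1 : R).
Proof.
have -> : (1 : R) = expR (- lam) * expR lam by rewrite -expRD addrC subrr expR0.
rewrite (_ : series pm = fun n => expR (- lam) * series (exp_coeff lam) n).
  by apply: cvgMr; exact: is_cvg_series_exp_coeff.
apply/funext => n; rewrite /series /= mulr_sumr; apply: eq_bigr => i _.
by rewrite /poisson_pmf lam_gt0 /exp_coeff /= mulrC.
Qed.

Notation F := (series pm).

Lemma series_poisson_le1 n : F n <= 1.
Proof.
rewrite -(cvg_lim _ series_poisson)//.
apply: nondecreasing_cvgn_le; last by apply/cvg_ex; exists 1; exact: series_poisson.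
by apply: nondecreasing_series => i _ _; exact: poisson_pmf_ge0.
Qed.

Lemma series_poisson_ge0 n : 0 <= F n.
Proof. by apply: sumr_ge0 => i _; exact: poisson_pmf_ge0. Qed.

(** For a Poisson variable Y, [alpha j] is P(Y > j) / P(Y = j) and [beta j] is P(Y <= j) / P(Y = j),
    since [F n] sums the weights strictly below [n]. *)
Let alpha j := (1 - F j.+1) / pm j.
Let beta j := F j.+1 / pm j.

(** After a shift of the index the two tails are compared term by term with [poisson_pmf_ratio]; the
    infinite tails are limits of finite sums. *)
Lemma alpha_noninc j : alpha j.+1 <= alpha j.
Proof.
have pj := poisson_pmf_gt0.
rewrite /alpha ler_pdivrMr// mulrAC ler_pdivlMr//.
have cv m (c : R) : (F n.+1 - F m) * c @[n --> \oo] --> (1 - F m) * c.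
  apply: cvgMl; apply: cvgB; last exact: cvg_cst.
  by rewrite cvg_shiftS; exact: series_poisson.
have cv' m (c : R) : (F n - F m) * c @[n --> \oo] --> (1 - F m) * c.
  apply: cvgMl; apply: cvgB; last exact: cvg_cst.
  exact: series_poisson.
apply: (@ler_cvg_to _ _ _ _ _ _ _ _ (cv j.+2 (pm j)) (cv' j.+1 (pm j.+1))).
exists j.+1 => // n /= jn.
rewrite !sub_series_geq//.
rewrite -[X in \sum_(X <= k < _) _]addn1 -[X in \sum_(_ <= k < X) _]addn1.
rewrite big_addn addnK !mulr_suml; apply: ler_sum_nat => i /andP[ij _].
by rewrite addn1 [leRHS]mulrC [leLHS]mulrC poisson_pmf_ratio// ltnW.
Qed.

Lemma beta_nondec j : beta j <= beta j.+1.
Proof.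
have pj := poisson_pmf_gt0.
rewrite /beta ler_pdivrMr// mulrAC ler_pdivlMr//.
rewrite /series /= [X in _ <= X * _]big_nat_recl// [leRHS]mulrDl.
rewrite -[leLHS]add0r lerD//; first by rewrite mulr_ge0// poisson_pmf_ge0.
rewrite !mulr_suml; apply: ler_sum_nat => i /andP[_ ij].
by rewrite poisson_pmf_ratio.
Qed.

(** The left side is lam times an increment of the Stein solution for the indicator of [j.+1], the
    extremal case in [stein_sol_inc]. Since [pm j.+1 * alpha j.+1] is 1 - [F j.+2], the claim is
    again a termwise comparison of shifted sums. *)
Lemma alpha_beta j : pm j.+1 * (alpha j.+1 + beta j) <= 1.
Proof.
have pj := poisson_pmf_gt0.
have pn0 i : pm i != 0 by rewrite gt_eqF.
rewrite /alpha /beta mulrDr mulrCA divff// mulr1.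
suff : pm j.+1 * (F j.+1 / pm j) <= F j.+2 by lra.
rewrite mulrCA mulrA ler_pdivrMr// /series /= [X in _ <= X * _]big_nat_recl//.
rewrite [leRHS]mulrDl -[leLHS]add0r lerD//; first by rewrite mulr_ge0// poisson_pmf_ge0.
rewrite !mulr_suml; apply: ler_sum_nat => i /andP[_ ij].
by rewrite poisson_pmf_ratio.
Qed.

Section solution.
Variables (a : nat -> R) (p : R).
Hypothesis a01 : forall i, 0 <= a i <= 1.
Hypothesis ap : series (fun i => a i * pm i) n @[n --> \oo] --> p.

Notation FA := (series (fun i => a i * pm i)).

Let a0 i : 0 <= a i * pm i.
Proof. by rewrite mulr_ge0 ?poisson_pmf_ge0//; have /andP[] := a01 i. Qed.

Let FAp n : FA n <= p.
Proof.
rewrite -(cvg_lim _ ap)//.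
apply: nondecreasing_cvgn_le; last by apply/cvg_ex; exists p; exact: ap.
by apply: nondecreasing_series => i _ _.
Qed.

Let FAF n : FA n <= F n.
Proof.
apply: ler_sum_nat => i _; rewrite ler_piMl ?poisson_pmf_ge0//.
by have /andP[] := a01 i.
Qed.

Let FA_ge0 n : 0 <= FA n.
Proof. by apply: sumr_ge0. Qed.

Let TAT n : p - FA n <= 1 - F n.
Proof.
have c1 : (FA m - FA n) @[m --> \oo] --> p - FA n by apply: cvgB => //; exact: cvg_cst.
have c2 : (F m - F n) @[m --> \oo] --> 1 - F n.
  by apply: cvgB; [exact: series_poisson|exact: cvg_cst].
apply: (ler_cvg_to c1 c2); exists n => // m /= nm.
rewrite !sub_series_geq//; apply: ler_sum_nat => i _.
by rewrite ler_piMl ?poisson_pmf_ge0//; have /andP[] := a01 i.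
Qed.

(* The solution of lam g(j+1) - j g(j) = a j - p with p the Poisson mean of a;
   the junk value at j = 0 is chosen equal to the one at j = 1. *)
Definition stein_sol (j : nat) : R :=
  (FA j.-1.+1 - p * F j.-1.+1) / (lam * pm j.-1).

(** FA - p F = FA (1 - F) - (p - FA) F: the mass of [a] up to [j] is weighed against the upper tail,
    its mass beyond [j] against the lower one. *)
Lemma stein_solE j : lam * stein_sol j.+1 = alpha j * FA j.+1 - beta j * (p - FA j.+1).
Proof.
have pn0 : pm j != 0 by rewrite gt_eqF// poisson_pmf_gt0.
have l0 : lam != 0 by rewrite gt_eqF.
by rewrite /stein_sol /alpha /beta /=; field; rewrite pn0 l0.
Qed.

Lemma stein_sol_eq j : lam * stein_sol j.+1 - j%:R * stein_sol j = a j - p.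
Proof.
have pn0 i : pm i != 0 by rewrite gt_eqF// poisson_pmf_gt0.
have l0 : lam != 0 by rewrite gt_eqF.
case: j => [|j]; rewrite /stein_sol /=.
  by rewrite mul0r subr0 /series /= !big_nat1; field; rewrite pn0 l0.
have -> : FA j.+2 = FA j.+1 + a j.+1 * pm j.+1 by rewrite seriesSr.
have -> : F j.+2 = F j.+1 + pm j.+1 by rewrite seriesSr.
rewrite -(poisson_pmfS j).
have j1 : j.+1%:R != 0 :> R by rewrite pnatr_eq0.
have p1 := pn0 j.+1.
move: (FA j.+1) (F j.+1) (pm j.+1) (j.+1%:R) j1 p1 => x y z u u0 z0.
by field; rewrite u0 z0 l0.
Qed.

(** By monotonicity of [alpha] and [beta], the values of [a] on either side of the new index
    contribute nonpositively. Only the value at that index can raise the solution, and [alpha_beta]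
    bounds its contribution by 1 / lam. *)
Lemma stein_sol_inc j : stein_sol j.+1 - stein_sol j <= lam^-1.
Proof.
case: j => [|j]; first by rewrite /stein_sol subrr invr_ge0 ltW.
rewrite -(ler_pM2l lam_gt0) mulrBr !stein_solE divff ?gt_eqF//.
apply: le_trans (alpha_beta j).
have -> : FA j.+2 = FA j.+1 + a j.+1 * pm j.+1 by rewrite seriesSr.
have h1 : (alpha j.+1 - alpha j) * FA j.+1 <= 0.
  by rewrite mulr_le0_ge0// subr_le0 alpha_noninc.
have h2 : 0 <= (beta j.+1 - beta j) * (p - FA j.+2).
  by rewrite mulr_ge0// subr_ge0// beta_nondec.
have h3 : a j.+1 * (pm j.+1 * (alpha j.+1 + beta j)) <= pm j.+1 * (alpha j.+1 + beta j).
  rewrite ler_piMl//; last by have /andP[] := a01 j.+1.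
  rewrite mulr_ge0 ?poisson_pmf_ge0// addr_ge0// divr_ge0 ?poisson_pmf_ge0//.
    by rewrite subr_ge0 series_poisson_le1.
  exact: series_poisson_ge0.
have E : FA j.+2 = FA j.+1 + a j.+1 * pm j.+1 by rewrite seriesSr.
rewrite E in h2; nra.
Qed.

(** Serves, through the finiteness of the bound, to shift the solution to a nonnegative one with
    finite expectation. *)
Lemma stein_sol_bounded j : `|stein_sol j| <= 2 * alpha 0 / lam.
Proof.
suff H i : `|lam * stein_sol i.+1| <= 2 * alpha 0.
  rewrite ler_pdivlMr// mulrC -[X in X * _](gtr0_norm lam_gt0) -normrM.
  by case: j => [|j]; [exact: (H 0%N)|exact: H].
have aa : alpha i <= alpha 0.
  by elim: i => // i IH; exact: le_trans (alpha_noninc i) IH.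
have F0 := series_poisson_ge0 i.+1.
have F1 := series_poisson_le1 i.+1.
have pi := poisson_pmf_gt0 i.
have al0 : 0 <= alpha i by rewrite divr_ge0 ?subr_ge0// ltW.
rewrite stein_solE (le_trans (ler_normB _ _))//.
rewrite !ger0_norm; last 2 first.
- by rewrite mulr_ge0 ?subr_ge0// /beta divr_ge0// ltW.
- exact: mulr_ge0.
have e1 : alpha i * FA i.+1 <= alpha i.
  by rewrite ler_piMr// (le_trans (FAF _)).
have e2 : beta i * (p - FA i.+1) <= alpha i.
  apply: (@le_trans _ _ (beta i * (1 - F i.+1))).
    by rewrite ler_wpM2l// /beta divr_ge0// ltW.
  by rewrite /beta /alpha mulrAC ler_pM2r ?invr_gt0// ler_piMl// subr_ge0.
lra.
Qed.

End solution.

(** Complementing [a] reverses the sign, so [stein_sol_inc] also bounds the increments from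
    below. *)
Lemma stein_solC a p : stein_sol (fun i => 1 - a i) (1 - p) =1 fun j => - stein_sol a p j.
Proof.
move=> j; rewrite /stein_sol -[RHS]mulNr; congr (_ * _).
have -> : series (fun i => (1 - a i) * pm i) j.-1.+1 = F j.-1.+1 - series (fun i => a i * pm i) j.-1.+1.
  by rewrite /series /= -sumrB; apply: eq_bigr => i _; rewrite mulrBl mul1r.
by ring.
Qed.

Lemma stein_sol_lip a p : (forall i, 0 <= a i <= 1) ->
  series (fun i => a i * pm i) n @[n --> \oo] --> p ->
  forall i j, `|stein_sol a p i - stein_sol a p j| <= lam^-1 * `|i%:R - j%:R|.
Proof.
move=> a01 ap; set g := stein_sol a p.
have step j : `|g j.+1 - g j| <= lam^-1.
  rewrite ler_norml (stein_sol_inc a01 ap) andbT.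
  have a01' i : 0 <= 1 - a i <= 1 by have := a01 i; lra.
  have ap' : series (fun i => (1 - a i) * pm i) n @[n --> \oo] --> 1 - p.
    rewrite (_ : series _ = fun n => F n - series (fun i => a i * pm i) n).
      by apply: cvgB => //; exact: series_poisson.
    apply/funext => n.
    by rewrite /series /= -sumrB; apply: eq_bigr => i _; rewrite mulrBl mul1r.
  have := stein_sol_inc a01' ap' j; rewrite !stein_solC -/g; lra.
have up i n : `|g (i + n)%N - g i| <= lam^-1 * n%:R.
  elim: n => [|n IH]; first by rewrite addn0 subrr normr0 mulr0.
  rewrite addnS -natr1 mulrDr mulr1 (le_trans (ler_distD (g (i + n)%N) _ _))//.
  by rewrite [leLHS]addrC; apply: lerD.
move=> i j; wlog ij : i j / (i <= j)%N => [H|].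
  have [/H//|/ltnW/H] := leqP i j.
  by rewrite distrC [X in _ * X]distrC.
rewrite -(subnKC ij) distrC (le_trans (up _ _))// ler_wpM2l ?invr_ge0 ?(ltW lam_gt0)//.
by rewrite distrC natrD addrC addKr ger0_norm.
Qed.

End poisson_stein.

(** In [EW_set], [x] is lam E[g(W + 1)], [v] is E[W g(W)], [p] and [q] are the probabilities to be
    compared, [c] is the contribution of the shift and [e] the Stein error. *)
Lemma dist_le_of_balance (R : realType) (x v p q c e : R) :
  v <= x + e -> x <= v + e -> x + p + c = v + q + c -> `|q - p| <= e.
Proof. by move=> h1 h2 h; rewrite ler_norml; lra. Qed.

Section poisson_approximation.
Variables (R : realType) (d : nat) (r : R).
Notation T := (d.-tuple R).
Implicit Types (s a b : seq T).
Variable mu : probability T R.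
Hypothesis mu_atomless : forall x, mu [set x] = 0%E.
Variables (t : R) (k : nat) (beta : R).
Hypotheses (t_gt0 : 0 < t) (r_ge0 : 0 <= r) (beta_ge0 : 0 <= beta).
Hypothesis mu_box : forall x, (mu [set y | box r (2 * k.+1)%:R x y] <= beta%:E)%E.
Local Open Scope ereal_scope.
Notation EW := (EW r mu t k).
Let Q : R := (t ^+ k / k`!%:R * beta ^+ k)%R.
Variable lam : R.
Hypothesis lam_gt0 : (0 < lam)%R.
Hypothesis EW_lam : EW (fun j => j%:R) = lam%:E.

Lemma EW_ge0 g : (forall j, 0 <= g j)%R -> 0 <= EW g.
Proof. by move=> g0; apply: pint_ge0 => s; rewrite lee_fin. Qed.

Lemma EWD g h : (forall j, 0 <= g j)%R -> (forall j, 0 <= h j)%R ->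
  EW (fun j => g j + h j)%R = EW g + EW h.
Proof.
move=> g0 h0; rewrite /(EW _).
under [in LHS]eq_fun do rewrite EFinD.
rewrite pintD//.
- by move=> s; rewrite lee_fin.
- by move=> s; rewrite lee_fin.
- exact: mseq_W.
- exact: mseq_W.
Qed.

Lemma EWZ c g : (0 <= c)%R -> (forall j, 0 <= g j)%R ->
  EW (fun j => c * g j)%R = c%:E * EW g.
Proof.
move=> c0 g0; rewrite /(EW _).
under [in LHS]eq_fun do rewrite EFinM.
rewrite pintZl//; first by move=> s; rewrite lee_fin.
exact: mseq_W.
Qed.

Lemma EW_cst c : (0 <= c)%R -> EW (fun=> c) = c%:E.
Proof.
move=> c0; rewrite (_ : (fun=> c) = fun j : nat => (c * 1)%R); last by apply/funext => j; rewrite mulr1.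
by rewrite EWZ// /(EW _) (pint1 mu t_gt0) mule1.
Qed.

Lemma le_EW g h : (forall j, 0 <= g j)%R -> (forall j, g j <= h j)%R -> EW g <= EW h.
Proof.
move=> g0 gh; apply: le_pint.
- by move=> s; rewrite lee_fin.
- exact: mseq_W.
- exact: mseq_W.
- by move=> s; rewrite lee_fin.
Qed.

Lemma EW_square : exists2 v : R, EW (fun j => j%:R * j%:R)%R = v%:E &
  (`|v - lam * (lam + 1)| <= lam * Q)%R.
Proof.
have [] := @stein_bounds R d r mu mu_atomless t k beta t_gt0 r_ge0 beta_ge0 mu_box
  (fun j => j%:R) 1 (fun j => ler0n _ j) ler01.
  by move=> i j; rewrite mul1r.
rewrite -/Q mul1r EW_lam.
have -> : EW (fun j => j.+1%:R) = (lam + 1)%:E.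
  rewrite (_ : (fun j => j.+1%:R) = (fun j => j%:R + 1)%R).
    by rewrite EWD// EW_lam EW_cst.
  by apply/funext => j; rewrite natr1.
rewrite -EFinD -!EFinM => h1 h2.
have [v vE] : exists v, EW (fun j => j%:R * j%:R)%R = v%:E.
  exists (fine (EW (fun j => j%:R * j%:R)%R)); rewrite fineK//.
  rewrite ge0_fin_numE; first exact: (le_lt_trans h1 (ltry _)).
  by apply: EW_ge0 => j; rewrite mulr_ge0.
exists v => //; move: h1 h2; rewrite vE -EFinD !lee_fin ler_norml; lra.
Qed.

Lemma EW_set (A : pred nat) p :
  series (fun i => (A i)%:R * poisson_pmf lam i)%R n @[n --> \oo] --> p ->
  exists2 q : R, EW (fun j => (A j)%:R) = q%:E & (`|q - p| <= Q)%R.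
Proof.
move=> Ap.
have A01 i : (0 <= ((A i)%:R : R) <= 1)%R by rewrite ler0n lern1 leq_b1.
pose g := @stein_sol R lam (fun i => (A i)%:R%R) p.
have gL := @stein_sol_lip _ _ lam_gt0 _ _ A01 Ap.
have gE := @stein_sol_eq _ _ lam_gt0 (fun i => (A i)%:R%R) p.
have [C C0 gC] : exists2 C : R, (0 <= C)%R & forall j, (`|g j| <= C)%R.
  eexists; last exact: (@stein_sol_bounded _ _ lam_gt0 _ _ A01 Ap).
  exact: le_trans (normr_ge0 _) (@stein_sol_bounded _ _ lam_gt0 _ _ A01 Ap 0%N).
(* The Stein bounds require a nonnegative function. The shift adds C (lam - j) to the Stein
   equation, and this has mean 0 because E[W] = lam. *)
pose g' j := (g j + C)%R.
have g'0 j : (0 <= g' j)%R by have := gC j; rewrite /g' ler_norml; lra.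
have g'C j : (g' j <= 2 * C)%R by have := gC j; rewrite /g' ler_norml; lra.
have Ap0 : (0 <= p)%R.
  apply: (ler_cvg_to (cvg_cst 0%R) Ap).
  apply: nearW => n; apply: sumr_ge0 => i _; rewrite mulr_ge0 ?poisson_pmf_ge0//.
have li0 : (0 <= lam^-1)%R by rewrite invr_ge0 ltW.
have [] := @stein_bounds R d r mu mu_atomless t k beta t_gt0 r_ge0 beta_ge0 mu_box
  g' lam^-1 g'0 li0.
  by move=> i j; rewrite /g' opprD addrACA subrr addr0; exact: gL.
rewrite -/Q EW_lam.
have [u uE] : exists u, EW (fun j => g' j.+1) = u%:E.
  exists (fine (EW (fun j => g' j.+1))); rewrite fineK// ge0_fin_numE ?EW_ge0//.
  apply: (@le_lt_trans _ _ (2 * C)%:E); last exact: ltry.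
  rewrite -EW_cst; last by rewrite mulr_ge0.
  by apply: le_EW.
have [q qE] : exists q, EW (fun j => (A j)%:R) = q%:E.
  exists (fine (EW (fun j => (A j)%:R))); rewrite fineK// ge0_fin_numE ?EW_ge0//.
  apply: (@le_lt_trans _ _ 1%:E); last exact: ltry.
  rewrite -(EW_cst (c := 1%R))//.
  by apply: le_EW => // j; have /andP[] := A01 j.
rewrite uE => h1 h2.
have [v vE] : exists v, EW (fun j => j%:R * g' j)%R = v%:E.
  exists (fine (EW (fun j => j%:R * g' j)%R)); rewrite fineK// ge0_fin_numE; last first.
    by apply: EW_ge0 => j; rewrite mulr_ge0.
  by apply: (le_lt_trans h1); rewrite -EFinD -EFinM ltry.
exists q => //.
(* The Stein equation with every negative term moved across: both sides are sums of nonnegative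
   functions, on which the extended expectation is additive. *)
have key : EW (fun j => lam * g' j.+1 + p + C * j%:R)%R =
    EW (fun j => j%:R * g' j + (A j)%:R + C * lam)%R.
  congr EW; apply/funext => j; have := gE j; rewrite /g' -/g.
  by move=> /eqP; rewrite subr_eq => /eqP E; rewrite mulrDr E; ring.
have n1 j : (0 <= lam * g' j.+1)%R by rewrite mulr_ge0// ltW.
have n3 (j : nat) : (0 <= C * j%:R)%R by rewrite mulr_ge0.
have n4 j : (0 <= j%:R * g' j)%R by rewrite mulr_ge0.
have n6 (j : nat) : (0 <= C * lam)%R by rewrite mulr_ge0// ltW.
have n2 j : (0 <= lam * g' j.+1 + p)%R by rewrite addr_ge0.
have n5 j : (0 <= j%:R * g' j + (A j)%:R)%R by rewrite addr_ge0.
move: key; rewrite !EWD// !EWZ ?(ltW lam_gt0)// (EW_cst Ap0) (EW_cst (ltW lam_gt0)).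
rewrite uE vE EW_lam qE.
move: h1 h2; rewrite vE -EFinD -!EFinM -!EFinD !lee_fin.
rewrite mulrDr mulrA divff ?gt_eqF// mul1r => h1 h2 [key].
exact: dist_le_of_balance h1 h2 key.
Qed.

End poisson_approximation.

(** * Normal approximation of the Poisson law *)

Section gaussian.
Variable R : realType.

Lemma MVT_global (f df : R -> R) (a b : R) : a <= b ->
  (forall x : R, is_derive x 1 f (df x)) ->
  exists2 c, a <= c <= b & f b - f a = df c * (b - a).
Proof.
move=> ab fdf.
have cf : {within `[a, b], continuous f}.
  by apply: derivable_within_continuous => x _; have [] := fdf x.
have [c] := @MVT_segment R f df a b ab (fun x _ => fdf x) cf.
by rewrite in_itv/=; exists c.
Qed.

Definition gphi : R -> R := normal_pdf 0 1.
Definition gPhi (x : R) : R := fine (normal_prob 0 1 `]-oo, x]).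

Let gphiE x : gphi x = normal_peak 1 * expR (- x ^+ 2 / 2).
Proof.
rewrite /gphi normal_pdfE ?oner_neq0//; congr (_ * expR _).
by rewrite subr0 expr1n.
Qed.

Lemma gphi_gt0 x : 0 < gphi x.
Proof. by rewrite gphiE mulr_gt0 ?expR_gt0// normal_peak_gt0 ?oner_neq0. Qed.

Lemma gphi_le x : gphi x <= normal_peak 1.
Proof. by rewrite /gphi normal_pdf_ub// oner_neq0. Qed.

Lemma is_derive_gphi (x : R) : is_derive x 1 gphi (- x * gphi x).
Proof.
have -> : gphi = (fun y => normal_peak 1 * expR (- y ^+ 2 / 2)).
  by apply/funext => y; exact: gphiE.
apply: is_derive_eq.
by rewrite /GRing.scale /=; field.
Qed.

Lemma is_derive_gPhi (x : R) : is_derive x 1 gPhi (gphi x).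
Proof.
have ii y : (@lebesgue_measure R).-integrable `]-oo, y] (EFin \o gphi).
  by apply: (integrableS measurableT) => //; exact: integrable_normal_pdf.
have x1 : x < x + 1 by lra.
have cphi : {for x, continuous gphi} by apply: continuous_normal_pdf; exact: oner_neq0.
have [||dF eF] := continuous_FTC1 x1 (ii (x + 1)); [exact: ltNyr|exact: cphi|].
have -> : gPhi = fun y => \int[lebesgue_measure]_(t in `]-oo, y]) gphi t by [].
by apply: DeriveDef; [exact: dF|rewrite -derive1E; exact: eF].
Qed.

Lemma gPhi_ge0 x : 0 <= gPhi x.
Proof. by rewrite fine_ge0// measure_ge0. Qed.

Lemma gPhi_le1 x : gPhi x <= 1.
Proof. by rewrite -lee_fin fineK ?fin_num_measure// probability_le1. Qed.

Lemma gPhi_cvg0 : gPhi (- n%:R) @[n --> \oo] --> (0 : R).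
Proof.
pose N := normal_prob (0 : R) 1.
suff : N `]-oo, (- n%:R)]%classic @[n --> \oo] --> 0%:E by move/fine_cvg.
have <- : N set0 = 0%:E by exact: measure0.
have <- : \bigcap_n `]-oo, (- n%:R : R)]%classic = set0.
  rewrite -subset0 => t /(_ (Num.truncn (- t)).+1 I).
  by rewrite /= in_itv/= leNgt => /negP; apply; rewrite ltrNl truncnS_gt.
apply: nonincreasing_cvg_mu => //=.
- by rewrite (le_lt_trans (probability_le1 _ _)) ?ltry.
- exact: bigcap_measurable.
- move=> m n mn; apply/subsetPset => x/=; rewrite !in_itv => /le_trans; apply.
  by rewrite lerN2 ler_nat.
Qed.

Lemma gPhi_cvg1 : gPhi n%:R @[n --> \oo] --> (1 : R).
Proof.
pose N := normal_prob (0 : R) 1.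
suff : N `]-oo, n%:R]%classic @[n --> \oo] --> 1%:E by move/fine_cvg.
have <- : N setT = 1%:E by exact: probability_setT.
have <- : \bigcup_n `]-oo, (n%:R : R)]%classic = setT.
  rewrite -subTset => t _/=.
  by exists (Num.truncn t).+1; rewrite //= in_itv/= ltW// truncnS_gt.
apply: nondecreasing_cvg_mu => //; first exact: bigcup_measurable.
move=> n m nm; apply/subsetPset => x/=; rewrite !in_itv/= => /le_trans.
by apply; rewrite ler_nat.
Qed.

(** The constant 1 suffices in Mills' inequality for |x| >= 1, and the inverse of [gphi 1] for |x|
    <= 1, where the density is at least [gphi 1]. *)
Definition mills : R := Num.max 1 (gphi 1)^-1.

Lemma mills_ge1 : 1 <= mills.
Proof. by rewrite /mills le_max lexx. Qed.

Lemma gphi_ge1 x : `|x| <= 1 -> 1 <= mills * gphi x.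
Proof.
move=> x1; have g0 := gphi_gt0 1.
apply: (@le_trans _ _ ((gphi 1)^-1 * gphi x)).
  rewrite ler_pdivlMl// mulr1 !gphiE ler_pM2l ?normal_peak_gt0 ?oner_neq0//.
  have x2 : x ^+ 2 <= 1 by rewrite -real_normK ?num_real// exprn_ile1.
  by rewrite ler_expR expr1n; lra.
by rewrite ler_wpM2r ?(ltW (gphi_gt0 _))// /mills le_max lexx orbT.
Qed.

Lemma gPhi_mills (x : R) : x <= 0 -> gPhi x <= mills * gphi x.
Proof.
move=> x0; have m1 := mills_ge1.
have [x1|x1] := leP (- 1) x.
  apply: le_trans (gPhi_le1 x) (gphi_ge1 _).
  by rewrite ler_norml x1 (le_trans x0).
(* [D] is nondecreasing on y <= -1 because [mills] is at least 1. Bounding [D y] below by [- gPhi y]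
   leaves only the limit of [gPhi] at minus infinity to be known. *)
pose D (y : R) := mills * gphi y - gPhi y.
have dD (y : R) : is_derive y 1 D (gphi y * (- mills * y - 1)).
  have h1 := is_derive_gphi y; have h2 := is_derive_gPhi y.
  by apply: is_derive_eq; rewrite /GRing.scale /=; ring.
have Dy y : y <= x -> - gPhi y <= D x.
  move=> yx; apply: (@le_trans _ _ (D y)).
    by rewrite /D lerBrDr addrC subrr mulr_ge0 ?(ltW (gphi_gt0 _))// (le_trans ler01 m1).
  have [c /andP[_ cx] E] := MVT_global yx dD.
  rewrite -subr_ge0 E mulr_ge0 ?subr_ge0// mulr_ge0 ?(ltW (gphi_gt0 _))//.
  nra.
suff : 0 <= D x by rewrite /D; lra.
have c0 : - gPhi (- n%:R) @[n --> \oo] --> (0 : R).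
  by rewrite -[X in _ --> X]oppr0; apply: cvgN; exact: gPhi_cvg0.
apply: (ler_cvg_to c0 (cvg_cst (D x))).
exists (Num.truncn (- x)).+1 => // n /= xn; apply: Dy.
rewrite lerNl; apply: (le_trans (ltW (truncnS_gt _))).
by rewrite ler_nat.
Qed.

Lemma gPhi_mills_up (x : R) : 0 <= x -> 1 - gPhi x <= mills * gphi x.
Proof.
move=> x0; have m1 := mills_ge1.
have [x1|x1] := leP x 1.
  have := gPhi_ge0 x; have : 1 <= mills * gphi x.
    by apply: gphi_ge1; rewrite ler_norml x1 (le_trans _ x0)// lerN10.
  lra.
pose D (y : R) := mills * gphi y + gPhi y.
have dD (y : R) : is_derive y 1 D (gphi y * (- mills * y + 1)).
  have h1 := is_derive_gphi y; have h2 := is_derive_gPhi y.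
  by apply: is_derive_eq; rewrite /GRing.scale /=; ring.
have Dy y : x <= y -> gPhi y <= D x.
  move=> yx; apply: (@le_trans _ _ (D y)).
    by rewrite /D lerDr mulr_ge0 ?(ltW (gphi_gt0 _))// (le_trans ler01 m1).
  have [c /andP[cx _] E] := MVT_global yx dD.
  rewrite -subr_le0 E mulr_le0_ge0 ?subr_ge0// mulr_ge0_le0 ?(ltW (gphi_gt0 _))//.
  nra.
suff : 1 <= D x by rewrite /D; lra.
apply: (ler_cvg_to gPhi_cvg1 (cvg_cst (D x))).
exists (Num.truncn x).+1 => // n /= xn; apply: Dy.
apply: (le_trans (ltW (truncnS_gt _))).
by rewrite ler_nat.
Qed.

Lemma gPhi_nondecreasing (x y : R) : x <= y -> gPhi x <= gPhi y.
Proof.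
move=> xy; rewrite -subr_ge0.
have [c _ ->] := MVT_global xy is_derive_gPhi.
by rewrite mulr_ge0 ?subr_ge0// ltW// gphi_gt0.
Qed.

Lemma gPhi_lip (x y : R) : x <= y -> gPhi y - gPhi x <= normal_peak 1 * (y - x).
Proof.
move=> xy; have [c _ ->] := MVT_global xy is_derive_gPhi.
by rewrite ler_wpM2r ?subr_ge0// gphi_le.
Qed.

(** The inverse of the density, a solution of the homogeneous equation f'(y) = y f(y); written as an
    exponential so that its derivative is immediate. *)
Let G (y : R) := (normal_peak 1)^-1 * expR (y ^+ 2 / 2).

Let GE y : gphi y * G y = 1.
Proof.
rewrite gphiE /G mulrACA divff ?gt_eqF ?normal_peak_gt0 ?oner_neq0// mul1r.
by rewrite -expRD mulNr addNr expR0.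
Qed.

Let G_ge0 y : 0 <= G y.
Proof. by rewrite mulr_ge0 ?expR_ge0// invr_ge0 normal_peak_ge0. Qed.

Let dG (y : R) : is_derive y 1 G (y * G y).
Proof.
apply: is_derive_eq; rewrite /GRing.scale /= /G; field.
by rewrite gt_eqF// normal_peak_gt0 ?oner_neq0.
Qed.

(* The two branches, on y <= z and y >= z, of the bounded solution of the
   Gaussian Stein equation f'(y) - y f(y) = 1(y <= z) - Phi(z). *)
Definition sleft (z y : R) := (1 - gPhi z) * (gPhi y * G y).
Definition sright (z y : R) := gPhi z * ((1 - gPhi y) * G y).

Lemma is_derive_sleft (z y : R) : is_derive y 1 (sleft z) (y * sleft z y + (1 - gPhi z)).
Proof.
have h1 := is_derive_gPhi y; have h2 := dG y; apply: is_derive_eq.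
rewrite /GRing.scale /= /sleft.
rewrite -[RHS](_ : y * ((1 - gPhi z) * (gPhi y * G y)) + (1 - gPhi z) * (gphi y * G y) = _).
  by ring.
by rewrite GE mulr1.
Qed.

Lemma is_derive_sright (z y : R) : is_derive y 1 (sright z) (y * sright z y - gPhi z).
Proof.
have h1 := is_derive_gPhi y; have h2 := dG y; apply: is_derive_eq.
rewrite /GRing.scale /= /sright.
rewrite -[RHS](_ : y * (gPhi z * ((1 - gPhi y) * G y)) - gPhi z * (gphi y * G y) = _).
  by ring.
by rewrite GE mulr1.
Qed.

(** For y <= 0 Mills' inequality applies to [gPhi y]; for 0 < y <= z it applies to 1 - [gPhi y],
    which dominates 1 - [gPhi z]. The factor [G y] then cancels the density. *)
Lemma sleft_bound z y : y <= z -> 0 <= sleft z y <= mills.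
Proof.
move=> yz; have z1 := gPhi_le1 z; have z0 := gPhi_ge0 z.
have y1 := gPhi_le1 y; have y0 := gPhi_ge0 y.
have m1 := mills_ge1.
apply/andP; split; first by apply: mulr_ge0; [rewrite subr_ge0|apply: mulr_ge0].
have -> : mills = mills * gphi y * G y by rewrite -mulrA GE mulr1.
rewrite /sleft mulrA ler_wpM2r//.
have [yn|yp] := leP y 0.
  by apply: le_trans (gPhi_mills yn); rewrite ler_piMl//; lra.
apply: le_trans (gPhi_mills_up (ltW yp)).
apply: (@le_trans _ _ (1 - gPhi z)); first by rewrite ler_piMr// subr_ge0.
by have := gPhi_nondecreasing yz; lra.
Qed.

Lemma sright_bound z y : z <= y -> 0 <= sright z y <= mills.
Proof.
move=> yz; have z1 := gPhi_le1 z; have z0 := gPhi_ge0 z.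
have y1 := gPhi_le1 y; have y0 := gPhi_ge0 y.
have m1 := mills_ge1.
apply/andP; split; first by apply: mulr_ge0 => //; apply: mulr_ge0; rewrite ?subr_ge0.
have -> : mills = mills * gphi y * G y by rewrite -mulrA GE mulr1.
rewrite /sright mulrA ler_wpM2r//.
have [yn|yp] := leP y 0.
  apply: le_trans (gPhi_mills yn).
  apply: (@le_trans _ _ (gPhi z)); first by rewrite ler_piMr//; lra.
  exact: gPhi_nondecreasing.
by apply: le_trans (gPhi_mills_up (ltW yp)); rewrite ler_piMl// subr_ge0.
Qed.

Lemma sleft_right z : sleft z z = sright z z.
Proof. by rewrite /sleft /sright; ring. Qed.

(* Turns the Gaussian Stein equation into a difference equation on the lattice of
   standardized Poisson values. *)
Lemma euler_step (f : R -> R) (c K a h : R) :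
  (forall y : R, is_derive y 1 f (y * f y + c)) -> `|c| <= 1 -> 0 < h <= 1 ->
  (forall y, a <= y <= a + h -> `|f y| <= K) ->
  `|(f (a + h) - f a) / h - a * f a - c| <= h * ((3 * K + 2) * (1 + a ^+ 2)).
Proof.
move=> df c1 /andP[h0 h1] fK.
have ah : a <= a + h by rewrite lerDl ltW.
(* The quotient equals f'(u) = u f(u) + c, and a second mean value step, for y f(y), bounds its
   distance to a f(a) + c. As |v| <= |a| + 1, the derivative f(v) + v (v f(v) + c) is at most K + (2
   a^2 + 2) K + a^2 + 2. *)
have [u /andP[au uh] E] := MVT_global ah df.
have eh : a + h - a = h by ring.
rewrite {}E eh mulfK ?gt_eqF//.
pose yf (y : R) := y * f y.
have dyf (y : R) : is_derive y 1 yf (f y + y * (y * f y + c)).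
  have hy := df y; apply: is_derive_eq; rewrite /GRing.scale /=; ring.
have [v /andP[av vu] E] := MVT_global au dyf.
have -> : u * f u + c - a * f a - c = yf u - yf a by rewrite /yf; ring.
rewrite E normrM mulrC ler_pM//.
  by rewrite ger0_norm ?subr_ge0//; lra.
have fv : `|f v| <= K by apply: fK; rewrite av (le_trans vu).
have K0 : 0 <= K by apply: le_trans fv.
have va : `|v| <= `|a| + 1.
  have := ler_norm a; have := ler_norm (- a); rewrite normrN => ? ?.
  by rewrite ler_norml; lra.
have a2 : `|a| ^+ 2 = a ^+ 2 by rewrite real_normK ?num_real.
have v2 : `|v| ^+ 2 <= 2 * a ^+ 2 + 2.
  apply: (@le_trans _ _ ((`|a| + 1) ^+ 2)); first by rewrite lerXn2r ?nnegrE ?addr_ge0.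
  by rewrite -a2; have := sqr_ge0 (`|a| - 1); lra.
rewrite (le_trans (ler_normD _ _))// normrM.
have e1 : `|v * f v + c| <= `|v| * K + 1.
  rewrite (le_trans (ler_normD _ _))// lerD// normrM ler_wpM2l//.
have e2 : `|v| * `|v * f v + c| <= `|v| * (`|v| * K + 1) by rewrite ler_wpM2l.
have e3 : `|v| <= a ^+ 2 + 2.
  by rewrite -a2; have := sqr_ge0 (`|a| - 1); have := sqr_ge0 `|a|; lra.
have e4 : `|v| * (`|v| * K) <= (2 * a ^+ 2 + 2) * K.
  by rewrite mulrA -expr2 ler_wpM2r.
have a20 : 0 <= a ^+ 2 by exact: sqr_ge0.
nra.
Qed.

End gaussian.

Section poisson_berry_esseen.
Variables (R : realType) (lam h : R).
Hypotheses (lam_gt0 : 0 < lam) (h01 : 0 < h <= 1) (lamh : lam * h ^+ 2 = 1).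
Notation pm := (poisson_pmf lam).
Notation F := (series pm).

Let h_gt0 : 0 < h. Proof. by have /andP[] := h01. Qed.

(** Abel summation with [poisson_pmfS]: the identity E[(Y - lam) g(Y)] = lam E[g(Y + 1) - g(Y)] for
    a Poisson variable Y, cut off at [N]. Finite sums with a boundary term spare all integrability
    conditions. *)
Lemma poisson_summation (g : nat -> R) N :
  \sum_(0 <= j < N.+1) pm j * ((j%:R - lam) * g j) =
  lam * (\sum_(0 <= j < N.+1) pm j * (g j.+1 - g j)) - lam * pm N * g N.+1.
Proof.
elim: N => [|N IH]; first by rewrite !big_nat1; ring.
rewrite big_nat_recr// IH [in RHS]big_nat_recr//= mulrDr -poisson_pmfS//.
by ring.
Qed.

Lemma poisson_pmf_cvg0 : pm n @[n --> \oo] --> (0 : R).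
Proof.
by apply: cvg_series_cvg_0; apply/cvg_ex; exists 1; exact: series_poisson.
Qed.

(** With g(j) = j - lam in the summation formula, the boundary term has a favourable sign as soon as
    N + 1 >= lam. *)
Lemma poisson_second_moment N : lam <= N.+1%:R ->
  \sum_(0 <= j < N.+1) pm j * (j%:R - lam) ^+ 2 <= lam.
Proof.
move=> lN; have := poisson_summation (fun j => j%:R - lam) N.
under eq_bigr do rewrite -expr2.
move=> ->.
rewrite (_ : \sum_(0 <= j < N.+1) _ = F N.+1); last first.
  by apply: eq_bigr => j _; rewrite -natr1; ring.
have : lam * F N.+1 <= lam.
  by rewrite ler_piMr ?(ltW lam_gt0)// series_poisson_le1.
have : 0 <= lam * pm N * (N.+1%:R - lam).
  by rewrite mulr_ge0 ?subr_ge0// mulr_ge0 ?poisson_pmf_ge0// ltW.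
lra.
Qed.

Let lamh1 : lam * h = h^-1.
Proof. by apply: (mulIf (lt0r_neq0 h_gt0)); rewrite mulVf ?gt_eqF// -mulrA -expr2. Qed.

(** For g the indicator of j > m, the increment of g is concentrated at [m], so lam [pm m] is the
    mean of (Y - lam) 1(Y > m) up to a vanishing boundary term. The inequality 2 x <= h x^2 + 1 / h
    and the variance bound give at most 1 / h. *)
Lemma poisson_atom m : pm m <= h.
Proof.
suff : lam * pm m <= h^-1.
  by rewrite -lamh1 ler_pM2l.
have c0 : h^-1 + lam * pm n @[n --> \oo] --> h^-1 + lam * 0.
  by apply: cvgD; [exact: cvg_cst|apply: cvgMr; exact: poisson_pmf_cvg0].
rewrite mulr0 addr0 in c0.
apply: (ler_cvg_to (cvg_cst (lam * pm m)) c0).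
exists (maxn m.+1 (Num.truncn lam).+1) => // N /=; rewrite geq_max => /andP[mN lN].
have lN' : lam <= N.+1%:R.
  by apply: (le_trans (ltW (truncnS_gt _))); rewrite ler_nat leqW.
pose g (j : nat) : R := (m < j)%N%:R.
have := poisson_summation g N.
rewrite (_ : \sum_(0 <= j < N.+1) pm j * (g j.+1 - g j) = pm m); last first.
  rewrite (bigD1_seq m) ?iota_uniq ?mem_index_iota ?leq0n ?ltnS ?(ltnW mN)//=.
  rewrite /g ltnSn ltnn subr0 mulr1 big1_seq ?addr0// => j /andP[jm _].
  by rewrite ltnS [(m <= j)%N]leq_eqVlt eq_sym (negPf jm) /= subrr mulr0.
rewrite {2}/g ltnS (ltnW mN) mulr1 => E.
have -> : lam * pm m = \sum_(0 <= j < N.+1) pm j * ((j%:R - lam) * g j) + lam * pm N.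
  by rewrite E subrK.
rewrite lerD2r.
apply: (@le_trans _ _ (\sum_(0 <= j < N.+1) (2^-1 * h * (pm j * (j%:R - lam) ^+ 2) + 2^-1 * h^-1 * pm j))).
  apply: ler_sum => j _.
  have -> : 2^-1 * h * (pm j * (j%:R - lam) ^+ 2) + 2^-1 * h^-1 * pm j =
    pm j * (2^-1 * h * (j%:R - lam) ^+ 2 + 2^-1 * h^-1) by ring.
  apply: ler_wpM2l; first exact: poisson_pmf_ge0.
  have hi : h * h^-1 = 1 by rewrite divff ?gt_eqF.
  have hi0 : 0 < h^-1 by rewrite invr_gt0.
  have s0 : 0 <= 2^-1 * h * (j%:R - lam) ^+ 2 by rewrite mulr_ge0 ?sqr_ge0// mulr_ge0// ltW.
  rewrite /g; case: (m < j)%N; rewrite ?mulr1 ?mulr0.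
    have : 0 <= h^-1 * ((h * (j%:R - lam) - 1) ^+ 2) by rewrite mulr_ge0 ?sqr_ge0// ltW.
    have -> : h^-1 * (h * (j%:R - lam) - 1) ^+ 2 =
      h * (j%:R - lam) ^+ 2 * (h * h^-1) - 2 * (j%:R - lam) * (h * h^-1) + h^-1 by ring.
    rewrite hi; lra.
  by rewrite addr_ge0// mulr_ge0// ltW.
rewrite big_split /= -!mulr_sumr.
have m2 := poisson_second_moment lN'.
have f1 := series_poisson_le1 lam_gt0 N.+1.
apply: (@le_trans _ _ (2^-1 * h * lam + 2^-1 * h^-1 * 1)).
  by apply: lerD; rewrite ler_wpM2l// mulr_ge0// ?invr_ge0 ltW.
rewrite -mulrA (mulrC h) lamh1; lra.
Qed.

Let w (j : nat) := (j%:R - lam) * h.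

(** The error in [euler_step] carries the factor 3 K + 2 and is averaged against 1 + w^2, whose mean
    is at most 2; the final 1 is the atom at the jump of the indicator. *)
Definition be_cst : R := 2 * (3 * mills R + 2) + 1.

(** Since lam h = 1 / h, the summation formula makes the mean of (g(j + 1) - g(j)) / h - w(j) g(j)
    vanish up to the boundary. The difference to be bounded is therefore minus the mean of the
    defect [rho], in the limit of large [N]. *)
Lemma poisson_lattice m : `|F m.+1 - gPhi (w m)| <= be_cst * h.
Proof.
set z := w m; set K := mills R.
have K1 : 1 <= K := mills_ge1 R.
have z0 := gPhi_ge0 z; have z1 := gPhi_le1 z.
have wS j : w j.+1 = w j + h by rewrite /w -natr1; ring.
have wle i j : (i <= j)%N -> w i <= w j.
  by move=> ij; rewrite ler_wpM2r ?(ltW h_gt0)// lerD2r ler_nat.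
pose g j := if (j <= m)%N then sleft z (w j) else sright z (w j).
have gK j : `|g j| <= K.
  rewrite /g; case: leqP => jm.
    have /andP[] := sleft_bound (wle _ _ jm); rewrite -/z -/K => g0 gK.
    by rewrite ger0_norm.
  have /andP[] := sright_bound (wle _ _ (ltnW jm)); rewrite -/z -/K => g0 gK.
  by rewrite ger0_norm.
pose C1 := 3 * K + 2.
pose rho j := (g j.+1 - g j) / h - w j * g j - ((j <= m)%N%:R - gPhi z).
have rhoE j : `|rho j| <= h * (C1 * (1 + w j ^+ 2)) + (j == m)%:R.
  have cl : `|1 - gPhi z| <= 1 by rewrite ger0_norm; lra.
  have cr : `|- gPhi z| <= 1 by rewrite normrN ger0_norm; lra.
  rewrite /rho /g; have [jm|mj|->] := ltngtP j m.
  - have bl y : w j <= y <= w j + h -> `|sleft z y| <= K.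
      move=> /andP[_]; rewrite -wS => /le_trans/(_ (wle _ _ jm)) => yz.
      by have /andP[? ?] := sleft_bound yz; rewrite ger0_norm.
    rewrite addr0 wS.
    exact: (euler_step (is_derive_sleft z) cl h01 bl).
  - have br y : w j <= y <= w j + h -> `|sright z y| <= K.
      move=> /andP[yw _]; have yz := le_trans (wle _ _ (ltnW mj)) yw.
      by have /andP[? ?] := sright_bound yz; rewrite ger0_norm.
    rewrite addr0 sub0r wS.
    exact: (euler_step (is_derive_sright z) cr h01 br).
  (* At j = m the step starts at the kink. The branches agree at [z], but the step runs along the
     right one, whose equation lacks the indicator; this costs 1, with weight [pm m], at most h. *)
  - have br y : z <= y <= z + h -> `|sright z y| <= K.
      move=> /andP[yw _].
      by have /andP[? ?] := sright_bound yw; rewrite ger0_norm.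
    rewrite [sleft z (w m)]sleft_right wS -/z.
    have -> : (sright z (z + h) - sright z z) / h - z * sright z z - (true%:R - gPhi z) =
      (sright z (z + h) - sright z z) / h - z * sright z z - (- gPhi z) - 1.
      by rewrite /=; ring.
    rewrite (le_trans (ler_normB _ _))// normr1 lerD2r.
    exact: (euler_step (is_derive_sright z) cr h01 br).
have bound N : (m < N)%N -> lam <= N.+1%:R ->
    `|F m.+1 - F N.+1 * gPhi z| <= be_cst * h + h^-1 * K * pm N.
  move=> mN lN.
  have E : F m.+1 - F N.+1 * gPhi z =
      h^-1 * pm N * g N.+1 - \sum_(0 <= j < N.+1) pm j * rho j.
    have := poisson_summation g N.
    set B := \sum_(0 <= j < N.+1) pm j * ((j%:R - lam) * g j).
    set A := \sum_(0 <= j < N.+1) pm j * (g j.+1 - g j) => BA.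
    have Fm : F m.+1 = \sum_(0 <= j < N.+1) pm j * (j <= m)%N%:R.
      rewrite (@big_cat_nat_idem _ _ _ (addr0 0) m.+1) ?ltnS ?(ltnW mN)//=.
      rewrite [X in _ + X]big1_seq ?addr0.
        by apply: eq_big_nat => j /andP[_]; rewrite ltnS => ->; rewrite mulr1.
      by move=> j; rewrite mem_index_iota ltnNge => /andP[_ /andP[/negPf -> _]]; rewrite mulr0.
    have -> : \sum_(0 <= j < N.+1) pm j * rho j = h^-1 * A - h * B - F m.+1 + F N.+1 * gPhi z.
      rewrite Fm /A /B /series /= mulr_suml !mulr_sumr -!sumrB -big_split /=.
      by apply: eq_bigr => j _; rewrite /rho /w; ring.
    by rewrite BA mulrBr !mulrA (mulrC h) lamh1; ring.
  rewrite E (le_trans (ler_normB _ _))// addrC lerD//.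
    apply: (@le_trans _ _ (\sum_(0 <= j < N.+1) (h * C1 * pm j + h * C1 * h ^+ 2 * (pm j * (j%:R - lam) ^+ 2) + pm j * (j == m)%:R))).
      rewrite (le_trans (ler_norm_sum _ _ _))//; apply: ler_sum => j _.
      rewrite normrM (ger0_norm (poisson_pmf_ge0 _ _)).
      rewrite (le_trans (ler_wpM2l (poisson_pmf_ge0 _ _) (rhoE j)))//.
      by rewrite le_eqVlt; apply/orP; left; apply/eqP; rewrite /w; ring.
    rewrite !big_split /= -!mulr_sumr.
    have -> : \sum_(0 <= j < N.+1) pm j * (j == m)%:R = pm m.
      rewrite (bigD1_seq m) ?iota_uniq ?mem_index_iota ?leq0n ?ltnS ?(ltnW mN)//=.
      rewrite eqxx mulr1 big1_seq ?addr0// => j /andP[jm _].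
      by rewrite (negPf jm) mulr0.
    have m2 := poisson_second_moment lN.
    have f1 := series_poisson_le1 lam_gt0 N.+1.
    have at1 := poisson_atom m.
    have C10 : 0 <= h * C1 by rewrite mulr_ge0 ?(ltW h_gt0)// /C1; lra.
    apply: (@le_trans _ _ (h * C1 * 1 + h * C1 * h ^+ 2 * lam + h)).
      rewrite !lerD// ler_wpM2l// mulr_ge0// sqr_ge0//.
    by rewrite -(mulrA _ (h ^+ 2)) (mulrC _ lam) lamh /be_cst -/K /C1; lra.
  rewrite !normrM ger0_norm ?invr_ge0 ?(ltW h_gt0)// (ger0_norm (poisson_pmf_ge0 _ _)).
  rewrite [leRHS]mulrAC; apply: ler_wpM2l; last exact: gK.
  by rewrite mulr_ge0 ?poisson_pmf_ge0// invr_ge0 ltW.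
have c1 : `|F m.+1 - F N.+1 * gPhi z| @[N --> \oo] --> `|F m.+1 - 1 * gPhi z|.
  apply: cvg_norm; apply: cvgB; first exact: cvg_cst.
  apply: cvgMl; rewrite cvg_shiftS; exact: series_poisson.
have c2 : be_cst * h + h^-1 * K * pm N @[N --> \oo] --> be_cst * h + h^-1 * K * 0.
  by apply: cvgD; [exact: cvg_cst|apply: cvgMr; exact: poisson_pmf_cvg0].
rewrite mul1r in c1; rewrite mulr0 addr0 in c2.
apply: (ler_cvg_to c1 c2).
exists (maxn m.+1 (Num.truncn lam).+1) => // N /=; rewrite geq_max => /andP[mN lN].
apply: bound => //.
by apply: (le_trans (ltW (truncnS_gt _))); rewrite ler_nat leqW.
Qed.

End poisson_berry_esseen.

Section poisson_normal.
Variable R : realType.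

(** For x >= 0 the distribution function is constant since the lattice point below [x], and
    [normal_peak 1] pays for moving [gPhi] by at most one lattice step. For x < 0 the lattice bound
    at 0 is used, and the summand 1 pays for the atom there. *)
Lemma poisson_normal (lam x p : R) : 1 <= lam ->
  series (fun i => (i%:R <= x)%R%:R * poisson_pmf lam i) n @[n --> \oo] --> p ->
  `|p - gPhi ((x - lam) / Num.sqrt lam)| <= (be_cst R + 1 + normal_peak 1) / Num.sqrt lam.
Proof.
move=> lam1 xp.
have lam0 : 0 < lam by apply: lt_le_trans lam1.
have s0 : 0 < Num.sqrt lam by rewrite sqrtr_gt0.
set h := (Num.sqrt lam)^-1.
have h0 : 0 < h by rewrite invr_gt0.
have h1 : h <= 1.
  by rewrite /h invf_le1//; have := ler_wsqrtr lam1; rewrite sqrtr1.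
have h01 : 0 < h <= 1 by rewrite h0 h1.
have lamh : lam * h ^+ 2 = 1.
  by rewrite /h exprVn sqr_sqrtr ?ltW// divff// gt_eqF.
have np0 := normal_peak_ge0 (1 : R).
have L := poisson_lattice lam0 h01 lamh.
have [x0|x0] := ltP x 0.
  have -> : p = 0.
    apply/esym; apply: (cvg_unique _ _ xp) => //.
    rewrite (_ : series _ = fun=> 0); first exact: cvg_cst.
    apply/funext => n; rewrite /series /= big1// => i _.
    by rewrite leNgt (lt_le_trans x0)// mul0r.
  rewrite sub0r normrN ger0_norm ?gPhi_ge0//.
  apply: (@le_trans _ _ (gPhi ((0%:R - lam) * h))).
    by apply: gPhi_nondecreasing; rewrite ler_wpM2r ?(ltW h0)// lerD2r ltW.
  have := L 0%N; have := poisson_atom lam0 h01 lamh 0.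
  rewrite /series /= big_nat1 => a0; rewrite distrC => /ler_normlW l0.
  have : 0 <= normal_peak 1 * h by rewrite mulr_ge0// ltW.
  have -> : (be_cst R + 1 + normal_peak 1) * h = be_cst R * h + h + normal_peak 1 * h by ring.
  lra.
pose m := Num.truncn x.
have mx : m%:R <= x by have /andP[] := truncn_itv x0.
have xm : x < m%:R + 1 by rewrite natr1; have /andP[] := truncn_itv x0.
have -> : p = series (poisson_pmf lam) m.+1.
  apply/esym; apply: (cvg_unique _ _ xp) => //.
  apply: cvg_near_cst; exists m.+1 => // N /= mN.
  rewrite /series /= [LHS](big_cat_nat (n := m.+1))//=.
  rewrite [X in _ + X]big1_seq ?addr0; last first.
    move=> i; rewrite mem_index_iota => /andP[_ /andP[mi _]].
    rewrite leNgt (lt_le_trans xm) ?mul0r// natr1 ler_nat//.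
  apply: eq_big_nat => i /andP[_]; rewrite ltnS => im.
  by rewrite (le_trans _ mx) ?mul1r// ler_nat.
rewrite (le_trans (ler_distD (gPhi ((m%:R - lam) * h)) _ _))//.
have l1 := L m.
have mxh : (m%:R - lam) * h <= (x - lam) * h.
  by rewrite ler_wpM2r ?(ltW h0)// lerD2r.
have := gPhi_lip mxh; have := gPhi_nondecreasing mxh => g1 g2.
rewrite [X in _ + X]distrC (ger0_norm (x := gPhi _ - _)) ?subr_ge0//.
have : normal_peak 1 * ((x - lam) * h - (m%:R - lam) * h) <= normal_peak 1 * h.
  rewrite ler_wpM2l// -mulrBl ger_pMl//; lra.
have -> : (be_cst R + 1 + normal_peak 1) * h = be_cst R * h + h + normal_peak 1 * h by ring.
lra.
Qed.

(** By the mean value theorem the difference is |a - 1| |z| gphi(u) with u between z and a z. As a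
    >= 1/2, |u| >= |z| / 2, and |u| gphi(u) is at most [normal_peak 1] because |u| <= 1 + u^2 / 2 <=
    exp(u^2 / 2); hence uniformity in z. *)
Lemma gPhi_scale (a z : R) : 2^-1 <= a ->
  `|gPhi (a * z) - gPhi z| <= 2 * normal_peak 1 * `|a - 1|.
Proof.
move=> a2.
have np0 := normal_peak_ge0 (1 : R).
have gz u : 2^-1 * `|z| <= `|u| -> `|z| * gphi u <= 2 * normal_peak 1.
  move=> zu; apply: (@le_trans _ _ (2 * `|u| * gphi u)).
    by rewrite ler_wpM2r ?(ltW (gphi_gt0 _))//; lra.
  rewrite -mulrA ler_pM2l// /gphi normal_pdfE ?oner_neq0// mulrCA ler_piMr//.
  rewrite /normal_fun subr0 expr1n.
  have -> : - u ^+ 2 / 2 = - (u ^+ 2 / 2) by rewrite mulNr.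
  rewrite expRN -[leLHS]/(_ / _) ler_pdivrMr ?expR_gt0// mul1r.
  apply: le_trans (expR_ge1Dx _).
  rewrite -[u ^+ 2]real_normK ?num_real//.
  have := sqr_ge0 (`|u| - 1); lra.
have key x y : x <= y -> (forall u, x <= u <= y -> 2^-1 * `|z| <= `|u|) ->
    y - x = `|a - 1| * `|z| -> gPhi y - gPhi x <= 2 * normal_peak 1 * `|a - 1|.
  move=> xy xyu E; have [u xuy ->] := MVT_global xy (@is_derive_gPhi R).
  rewrite E mulrCA [gphi u * _]mulrC [leRHS]mulrC.
  by apply: ler_wpM2l => //; apply: gz; exact: xyu.
have a0 : 0 < a by lra.
have az u : (z <= u <= a * z) || (a * z <= u <= z) -> 2^-1 * `|z| <= `|u|.
  move=> zu; have [z0|z0] := leP 0 z.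
    rewrite (ger0_norm z0); apply: le_trans (ler_norm u).
    have zz : 2^-1 * z <= a * z by rewrite ler_wpM2r.
    by case/orP: zu => /andP[]; lra.
  rewrite (ltr0_norm z0) -normrN; apply: le_trans (ler_norm (- u)).
  have zz : a * z <= 2^-1 * z by rewrite ler_wnM2r// ltW.
  by case/orP: zu => /andP[]; lra.
have [zaz|azz] := leP z (a * z).
  rewrite ger0_norm ?subr_ge0 ?gPhi_nondecreasing//; apply: key => //.
    by move=> u zu; apply: az; rewrite zu.
  by rewrite -normrM mulrBl mul1r ger0_norm// subr_ge0.
rewrite distrC ger0_norm ?subr_ge0 ?gPhi_nondecreasing// ?(ltW azz)//.
apply: key; first exact: ltW.
  by move=> u zu; apply: az; rewrite zu orbT.
by rewrite -normrM mulrBl mul1r distrC ger0_norm// subr_ge0 ltW.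
Qed.

End poisson_normal.

(** * Changes of variables and translations for Lebesgue measure *)

Section affine.
Variable R : realType.
Notation leb := (@lebesgueR R).
Local Open Scope ereal_scope.

Let RD : measurableType default_measure_display := R.
Let RO : measurableType _ := measurableTypeR R.
Let toRD (x : RO) : RD := x.

Let measurable_toRD : measurable_fun setT toRD.
Proof. by move=> _ A mA; rewrite setTI. Qed.

Lemma ge0_integral_lebesgueR (D : set R) (f : R -> \bar R) : measurable D ->
  measurable_fun D f -> (forall x, 0 <= f x) ->
  \int[leb]_(x in D) f x = \int[@lebesgue_measure R]_(x in D) f x.
Proof.
move=> mD mf f0.
have /= := @ge0_integral_pushforward _ _ RO RD R toRD measurable_toRD (@lebesgue_measure R) D f mD mf (fun x _ => f0 x).
by move=> <-; apply: eq_measure_integral.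
Qed.

Let toRO (x : RD) : RO := x.

Let measurable_toRO : measurable_fun setT toRO.
Proof. by move=> _ A mA; rewrite setTI. Qed.

(* lebesgue_measure lives on measurableTypeR R, lebesgueR on R; the uniqueness
   theorem of the library is transported along the identity map. *)
Lemma lebesgueR_unique (m : {measure set R -> \bar R}) :
  (forall b c : R, m `]b, c]%classic = @lebesgue_measure R `]b, c]%classic) ->
  forall A : set R, measurable A -> m A = leb A.
Proof.
move=> mbc A mA.
pose m' := measure_function_pushforward__canonical__measure_function_Measure m measurable_toRO.
apply/esym; apply: (@lebesgue_measure_unique R m') => //.
by move=> X [[b c] /= _ <-]; exact/esym/mbc.
Qed.

Lemma integral_lebesgueR_affine (a r : R) (g : R -> \bar R) : (0 < r)%R ->
  measurable_fun setT g -> (forall x, 0 <= g x) ->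
  r%:E * \int[leb]_y g (a + r * y)%R = \int[leb]_x g x.
Proof.
move=> r0 mg g0.
pose phi (y : R) : R := (a + r * y)%R.
have mphi : measurable_fun setT phi.
  by apply: measurable_funD => //; apply: measurable_funM.
transitivity (r%:E * \int[pushforward leb phi]_x g x).
  by rewrite (ge0_integral_pushforward mphi)//.
pose nr := NngNum (ltW r0).
rewrite -[r%:E]/(nr%:num%:E) -ge0_integral_mscale//; last first.
apply: eq_measure_integral => A mA _.
apply: lebesgueR_unique => // b c.
transitivity (r%:E * leb (phi @^-1` `]b, c]%classic)) => //.
pose b' : R := ((b - a) / r)%R; pose c' : R := ((c - a) / r)%R.
have -> : phi @^-1` `]b, c] = `]b', c']%classic.
  apply/seteqP; split => y; rewrite /= !in_itv /= ltr_pdivrMr// ler_pdivlMr//;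
   by rewrite ltrBlDl lerBrDl /phi (mulrC r).
transitivity (r%:E * @lebesgue_measure R `]b', c']%classic) => //.
rewrite !lebesgue_measure_itv /= !lte_fin ltr_pM2r ?invr_gt0// ltrD2r.
case: ifP => bc; last by rewrite mule0.
rewrite -!EFinB -EFinM -mulrBl; congr (_%:E).
by field; rewrite gt_eqF.
Qed.

Fixpoint aff (r : R) (a y : seq R) : seq R :=
  match a, y with
  | u :: a', v :: y' => (u + r * v)%R :: aff r a' y'
  | _, _ => [::]
  end.

Lemma mlist_aff d' (O : measurableType d') r (g h : O -> seq R) :
  mlist g -> mlist h -> mlist (fun w => aff r (g w) (h w)).
Proof.
move=> mg; elim: mg h => [|x {}g mx mg IH] h mh /=; first exact: mlist_nil.
case: mh => [|y {}h my mh]; first exact: mlist_nil.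
apply: mlist_cons; last exact: IH.
by apply: measurable_funD => //; apply: measurable_funM.
Qed.

Lemma iint_aff r a (G : seq R -> \bar R) : (0 < r)%R -> (forall s, 0 <= G s) -> mseq G ->
  (r ^+ size a)%:E * iint leb (size a) (fun y => G (aff r a y)) = iint leb (size a) G.
Proof.
move=> r0; elim: a G => [|u a IH] G G0 mG.
  by rewrite expr0 mul1e; apply: eq_iint => s /size0nil ->.
have maff b (F : seq R -> \bar R) : mseq F -> mseq (fun s => F (aff r b s)).
  move=> mF n; apply: (mseq_mlist mF); apply: mlist_aff; first exact: mlist_cst.
  exact: mlist_tval.
rewrite /= iintS//; last exact: maff (u :: a) _ mG.
rewrite exprS EFinM -muleA.
have rn0 : 0 <= (r ^+ size a)%:E by rewrite lee_fin exprn_ge0// ltW.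
rewrite -ge0_integralZl//; last 2 first.
- exact: (@measurable_iint_cons _ _ _ leb (size a) (fun s => G (aff r (u :: a) s)) (fun s => G0 _) (maff (u :: a) _ mG)).
- by move=> x _; exact: iint_ge0.
transitivity (r%:E * \int[leb]_x (iint leb (size a) (fun s => G ((u + r * x)%R :: s)))).
  congr (_ * _); apply: eq_integral => x _.
  by rewrite -(IH (fun s => G ((u + r * x)%R :: s)))//; exact: mseq_cons.
rewrite (integral_lebesgueR_affine u (g := fun x => iint leb (size a) (fun s => G (x :: s))))//.
- by rewrite iintS.
- exact: (@measurable_iint_cons _ _ _ leb (size a) G G0 mG).
- by move=> x; exact: iint_ge0.
Qed.

End affine.

Section L1_continuity.
Variable R : realType.
Notation leb := (@lebesgueR R).
Local Open Scope ereal_scope.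

Lemma cvge0_le (u : nat -> \bar R) : (forall n, 0 <= u n) ->
  (forall e : R, (0 < e)%R -> \forall n \near \oo, u n <= e%:E) ->
  u n @[n --> \oo] --> 0.
Proof.
move=> u0 H; have fin : \forall n \near \oo, u n \is a fin_num.
  apply: filterS (H 1%R ltr01) => n un.
  by rewrite ge0_fin_numE//; apply: le_lt_trans un (ltry _).
apply/fine_cvgP; split => //.
apply/cvgr0Pnorm_le => e e0; near=> n.
rewrite /= ger0_norm ?fine_ge0// -lee_fin fineK; first by near: n; exact: H.
by near: n.
Unshelve. all: by end_near. Qed.

Lemma cvge0_near (u : nat -> \bar R) (e : R) : (0 < e)%R ->
  u n @[n --> \oo] --> 0 -> \forall n \near \oo, u n <= e%:E.
Proof.
move=> e0 /fine_cvgP[fin /cvgr0Pnorm_le/(_ _ e0) H]; near=> n.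
have un : u n \is a fin_num by near: n.
rewrite -(fineK un) lee_fin; apply: le_trans (ler_norm _) _.
by near: n.
Unshelve. all: by end_near. Qed.

Lemma leb_set1 (x : R) : leb [set x] = 0.
Proof. by rewrite /lebesgueR lebesgue_measure_set1. Qed.

Lemma leb_absle (B : R) : leb [set x | (`|x| <= B)%R] < +oo.
Proof.
rewrite /lebesgueR (_ : [set x | _] = `[- B, B]%classic)%R.
  by rewrite lebesgue_measure_itv; case: ifP => _; rewrite ?ltry// -EFinB ltry.
by apply/seteqP; split => x; rewrite /= in_itv /= ler_norml.
Qed.

Lemma dominated_cvg0 d (T : measurableType d) (mu : {measure set T -> \bar R})
  (f : nat -> T -> \bar R) (g : T -> \bar R) :
  (forall n, measurable_fun setT (f n)) -> (forall n x, 0 <= f n x) ->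
  {ae mu, forall x, f n x @[n --> \oo] --> 0} ->
  measurable_fun setT g -> \int[mu]_x g x < +oo ->
  {ae mu, forall x n, f n x <= g x} -> (forall x, 0 <= g x) ->
  \int[mu]_x f n x @[n --> \oo] --> 0.
Proof.
move=> mf f0 f_0 mg ig fg g0.
have ig' : mu.-integrable setT g.
  apply/integrableP; split => //.
  by under eq_integral => x _ do rewrite gee0_abs//.
have [|||_ _] := @dominated_convergence _ _ _ mu setT measurableT f (fun=> 0) g mf _ _ ig' _.
- exact: measurable_cst.
- by apply: filterS f_0 => x H _.
- by apply: filterS fg => x H n _; rewrite gee0_abs.
by rewrite integral0.
Qed.

Definition tail (g : R -> R) (N : nat) (x : R) : R :=
  if (`|x| <= N%:R)%R then 0%R else g x.

Lemma L1_tail (g : R -> R) : measurable_fun setT g -> \int[leb]_x `|g x|%:E < +oo ->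
  \int[leb]_x `|tail g n x|%:E @[n --> \oo] --> 0.
Proof.
move=> mg ig.
have mabs (n : nat) : measurable [set x : R | (`|x| <= n%:R)%R].
  rewrite (_ : [set x | _] = `[- n%:R, n%:R]%classic)%R; first exact: measurable_itv.
  by apply/seteqP; split => x; rewrite /= in_itv /= ler_norml.
apply: (@dominated_cvg0 _ _ leb _ (fun x => `|g x|%:E)) => //.
- move=> n; apply/measurable_EFinP; apply: measurableT_comp => //.
  apply: measurable_fun_ifT => //.
  by apply: (measurable_fun_bool true); rewrite setTI (_ : _ @^-1` _ = [set x : R | (`|x| <= n%:R)%R]).
- apply: aeW => x; apply: cvg_near_cst.
  exists (Num.truncn `|x|).+1 => // n /= xn.
  rewrite /tail (le_trans (ltW (truncnS_gt _))) ?normr0// ler_nat//.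
- by apply/measurable_EFinP; exact: measurableT_comp.
- by apply: aeW => x n; rewrite /tail lee_fin; case: ifP; rewrite ?normr0.
Qed.

(** Translates of [psi] converge pointwise except at the two possible jumps N and -N, which are
    null. The bound [B] on the translations confines everything to a bounded interval, where 2 K
    dominates. *)
Lemma L1_trans_cont_itv (c : R -> R) (N : R) (v : nat -> R) : (0 < N)%R ->
  continuous c -> v n @[n --> \oo] --> 0%R ->
  let psi x := if (`|x| <= N)%R then c x else 0%R in
  \int[leb]_x `|psi (x + v n) - psi x|%:E @[n --> \oo] --> 0.
Proof.
move=> N0 cc v0 psi.
have mabs (M : R) : measurable [set x : R | (`|x| <= M)%R].
  rewrite (_ : [set x | _] = `[- M, M]%classic)%R; first exact: measurable_itv.
  by apply/seteqP; split => x; rewrite /= in_itv /= ler_norml.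
have mpsi : measurable_fun setT psi.
  apply: measurable_fun_ifT => //; last exact: continuous_measurable_fun.
  by apply: (measurable_fun_bool true); rewrite setTI (_ : _ @^-1` _ = [set x : R | (`|x| <= N)%R]).
have [K K0 cK] : exists2 K : R, (0 <= K)%R & forall x, (`|psi x| <= K)%R.
  have ab : (- N <= N)%R by lra.
  have cf : {within `[(- N)%R, N], continuous (fun x => `|c x|)%R}.
    by apply: continuous_subspaceT => x; apply: cvg_norm; exact: cc.
  have [y _ ym] := @EVT_max R (fun x => `|c x|)%R _ _ ab cf.
  exists `|c y|%R => // x; rewrite /psi; case: ifP => xN; last by rewrite normr0.
  by apply: ym; rewrite in_itv /= -ler_norml.
have [B B0 vB] : exists2 B : R, (0 <= B)%R & forall n, (`|v n| <= B)%R.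
  have /cvg_seq_bounded/pinfty_ex_gt0[B B0 /= Bv] : cvgn v by apply/cvg_ex; exists 0%R.
  by exists B => [|n]; [exact: ltW|exact: Bv].
pose dom (x : R) := (if (`|x| <= N + B)%R then 2 * K else 0)%R.
apply: (@dominated_cvg0 _ _ leb _ (fun x => (dom x)%:E)).
- move=> n; apply/measurable_EFinP; apply: measurableT_comp => //.
  by apply: measurable_funB => //; apply: measurableT_comp => //; exact: measurable_funD.
- by move=> n x; rewrite lee_fin.
- exists ([set (- N)%R] `|` [set N]); split.
  + by apply: measurableU.
  + by rewrite measureU0//; exact: leb_set1.
  move=> x /= H; apply: contrapT => /not_orP[xN1 xN2]; apply: H.
  have xvn : (x + v n @[n --> \oo] --> x)%R.
    by rewrite -[X in _ --> X]addr0; apply: cvgD => //; exact: cvg_cst.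
  have xv : `|x + v n|%R @[n --> \oo] --> `|x|%R.
    exact: cvg_norm.
  suff pp : (psi (x + v n) @[n --> \oo] --> psi x)%R.
    rewrite -[X in _ --> X]/(0%:E); apply: cvg_EFin; first by exact: nearW.
    have : (`|psi (x + v n) - psi x| @[n --> \oo] --> `|psi x - psi x|)%R.
      by apply: cvg_norm; apply: cvgB => //; exact: cvg_cst.
    by rewrite subrr normr0.
  have [xN|Nx|xN] := ltgtP `|x|%R N.
  - rewrite {2}/psi ltW//.
    have cx : (c (x + v n) @[n --> \oo] --> c x)%R.
      by apply: (cvg_comp _ _ xvn (cc x)).
    apply: cvg_trans cx; apply: near_eq_cvg.
    near=> n; rewrite /psi ifT// ltW//; near: n.
    exact: (cvgr_lt _ xv).
  - rewrite {2}/psi leNgt Nx /=; apply: cvg_near_cst.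
    near=> n; rewrite /psi leNgt ifF//; apply/negbF; near: n.
    exact: (cvgr_gt _ xv).
  - exfalso; case: (leP 0%R x) => x0; [apply: xN2|apply: xN1].
      by rewrite -xN ger0_norm.
    by rewrite -xN ltr0_norm ?opprK.
- apply/measurable_EFinP; apply: measurable_fun_ifT => //.
  by apply: (measurable_fun_bool true); rewrite setTI (_ : _ @^-1` _ = [set x : R | (`|x| <= N + B)%R]).
- rewrite (_ : \int[leb]_x _ = \int[leb]_(x in [set x : R | (`|x| <= N + B)%R]) (2 * K)%:E).
    rewrite integral_cst//; apply: lte_mul_pinfty => //; first by rewrite lee_fin mulr_ge0.
    exact: leb_absle.
  rewrite [RHS]integral_mkcond; apply: eq_integral => x _; rewrite patchE /dom.
  by case: ifPn => xN; [rewrite ifT// inE|rewrite ifF//; apply/negbTE; rewrite notin_setE; exact/negP].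
- apply: aeW => x n; rewrite lee_fin /dom; case: ifPn => xNB.
    by rewrite (le_trans (ler_normB _ _))// mulr2n mulrDl mul1r lerD.
  rewrite -ltNge in xNB; have vBn := vB n.
  have : (`|x| <= `|x + v n| + `|v n|)%R.
    by rewrite -{1}[x](addrK (v n)) ler_normB.
  rewrite /psi => xx; rewrite !ifF ?subr0 ?normr0//; apply/negbTE; rewrite -ltNge; lra.
- by move=> x; rewrite lee_fin /dom; case: ifP => // _; lra.
Unshelve. all: by end_near. Qed.

(** [g] is approximated in L1 by a continuous function cut off to [-N, N]; translation invariance
    carries the approximation over to the translates. *)
Lemma L1_trans1 (g : R -> R) (v : nat -> R) : measurable_fun setT g ->
  \int[leb]_x `|g x|%:E < +oo -> v n @[n --> \oo] --> 0%R ->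
  \int[leb]_x `|g (x + v n) - g x|%:E @[n --> \oo] --> 0.
Proof.
move=> mg ig v0; apply: cvge0_le => [n|e e0]; first by apply: integral_ge0 => x _; rewrite lee_fin.
(* [psi] is off by two parts, one inside the interval and one in the tail; these are paid both for
   [g] and for its translate, and the translation of [psi] takes the fifth. *)
have e5 : (0 < e / 5)%R by rewrite divr_gt0.
have [N [N0 tN]] : exists N : nat, (0 < N%:R :> R)%R /\ \int[leb]_x `|tail g N x|%:E <= (e / 5)%:E.
  have := cvge0_near e5 (L1_tail mg ig) => -[m _ H].
  by exists m.+1; split => //; apply: H => /=.
pose E : set R := `[(- N%:R)%R, N%:R]%classic.
have EE x : E x <-> (`|x| <= N%:R)%R by rewrite /E /= in_itv /= ler_norml.
have mE : measurable E by exact: measurable_itv.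
have [c cc cE] : exists2 c : R -> R, continuous c &
    \int[leb]_(x in E) `|g x - c x|%:E <= (e / 5)%:E.
  have iE : (@lebesgue_measure R).-integrable E (EFin \o g).
    apply/integrableP; split; first by apply/measurable_EFinP; exact: measurable_funTS.
    rewrite -ge0_integral_lebesgueR//; last first.
      by apply/measurable_EFinP; apply: measurableT_comp => //; exact: measurable_funTS.
    apply: le_lt_trans ig; apply: ge0_subset_integral => //.
    by apply/measurable_EFinP; exact: measurableT_comp.
  have Ef : @lebesgue_measure R E < +oo.
    by rewrite lebesgue_measure_itv; case: ifP => _; rewrite ?ltry// -EFinB ltry.
  have [c_ [cc _ c0]] := @approximation_continuous_integrable R E g mE Ef iE.
  have [m _ H] := cvge0_near e5 c0.
  exists (c_ m); first exact: cc.
  rewrite ge0_integral_lebesgueR//; first exact: H m (leqnn m).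
  apply/measurable_EFinP; apply: measurableT_comp => //; apply: measurable_funB.
    exact: measurable_funTS.
  by apply: measurable_funTS; exact: continuous_measurable_fun.
pose psi x := if (`|x| <= N%:R)%R then c x else 0%R.
have mpsi : measurable_fun setT psi.
  apply: measurable_fun_ifT => //; last exact: continuous_measurable_fun.
  apply: (measurable_fun_bool true); rewrite setTI (_ : _ @^-1` _ = E)//.
  by apply/seteqP; split => x /EE.
have mD : measurable_fun setT (fun x => `|g x - psi x|%:E).
  by apply/measurable_EFinP; apply: measurableT_comp => //; exact: measurable_funB.
have gpsi : \int[leb]_x `|g x - psi x|%:E <= (e / 5 + e / 5)%:E.
  rewrite EFinD (le_trans _ (leeD cE tN))// [X in _ <= X + _]integral_mkcond -ge0_integralD//.
  - apply: ge0_le_integral => //.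
    + apply: emeasurable_funD.
        apply/(measurable_restrictT _ mE)/measurable_EFinP; apply: measurable_funTS.
        by apply: measurableT_comp => //; apply: measurable_funB => //; exact: continuous_measurable_fun.
      apply/measurable_EFinP; apply: measurableT_comp => //; apply: measurable_fun_ifT => //.
      by apply: (measurable_fun_bool true); rewrite setTI (_ : _ @^-1` _ = E)//; apply/seteqP; split => x /EE.
    + move=> x _; rewrite patchE /psi /tail; case: ifPn => xN.
        by rewrite ifT ?inE ?EE// normr0 adde0.
      by rewrite ifF ?subr0 ?add0e//; apply/negbTE; rewrite notin_setE EE; exact/negP.
  - by move=> x _; rewrite patchE; case: ifP.
  - apply/(measurable_restrictT _ mE)/measurable_EFinP; apply: measurable_funTS.
    by apply: measurableT_comp => //; apply: measurable_funB => //; exact: continuous_measurable_fun.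
  - apply/measurable_EFinP; apply: measurableT_comp => //; apply: measurable_fun_ifT => //.
    by apply: (measurable_fun_bool true); rewrite setTI (_ : _ @^-1` _ = E)//; apply/seteqP; split => x /EE.
have mtr (a : R) (h : R -> R) : measurable_fun setT h -> measurable_fun setT (fun x : R => h (x + a)%R).
  by move=> mh; apply: measurableT_comp => //; exact: measurable_funD.
have gpsiv a : \int[leb]_x `|g (x + a) - psi (x + a)|%:E <= (e / 5 + e / 5)%:E.
  rewrite (le_trans _ gpsi)// -(integral_lebesgueR_affine a ltr01 mD)// mul1e.
  by under [leRHS]eq_integral => x _ do rewrite mul1r (addrC a).
have := cvge0_near e5 (L1_trans_cont_itv N0 cc v0); apply: filterS => n psin.
have -> : (e = (e / 5 + e / 5) + (e / 5 + (e / 5 + e / 5)))%R by field.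
pose I1 := \int[leb]_x `|g (x + v n) - psi (x + v n)|%:E.
pose I2 := \int[leb]_x `|psi (x + v n) - psi x|%:E.
pose I3 := \int[leb]_x `|g x - psi x|%:E.
apply: (@le_trans _ _ (I1 + (I2 + I3))); last first.
  rewrite EFinD; apply: leeD; first exact: gpsiv.
  by rewrite EFinD; apply: leeD psin gpsi.
rewrite /I1 /I2 /I3.
have m1 : measurable_fun setT (fun x : R => `|psi (x + v n) - psi x|%:E).
  apply/measurable_EFinP; apply: measurableT_comp => //; apply: measurable_funB => //; exact: mtr.
have m2 : measurable_fun setT (fun x : R => `|g (x + v n) - psi (x + v n)|%:E).
  apply/measurable_EFinP; apply: measurableT_comp => //; apply: measurable_funB; exact: mtr.
rewrite -ge0_integralD// -ge0_integralD//; last 2 first.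
- by move=> x _; rewrite adde_ge0.
- exact: emeasurable_funD.
apply: ge0_le_integral => //.
- by apply/measurable_EFinP; apply: measurableT_comp => //; apply: measurable_funB => //; exact: mtr.
- by apply: emeasurable_funD => //; exact: emeasurable_funD.
- move=> x _; rewrite -!EFinD lee_fin.
  rewrite (_ : g (x + v n) - g x = (g (x + v n) - psi (x + v n)) + ((psi (x + v n) - psi x) - (g x - psi x)))%R; last by ring.
  by rewrite (le_trans (ler_normD _ _))// lerD2l (le_trans (ler_normB _ _)).
Qed.

End L1_continuity.

Section L1_translation.
Variable R : realType.
Notation leb := (@lebesgueR R).
Local Open Scope ereal_scope.

Lemma measurable_dist (phi : seq R -> R) d' (W : measurableType d') (g h : W -> seq R) :
  mseq (fun s => (phi s)%:E) -> mlist g -> mlist h ->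
  measurable_fun setT (fun w => `|phi (g w) - phi (h w)|%:E).
Proof.
move=> mphi mg mh; apply/measurable_EFinP; apply: measurableT_comp => //.
by apply: measurable_funB; apply/measurable_EFinP; exact: (mseq_mlist mphi).
Qed.

Lemma mseq_abs (phi : seq R -> R) : mseq (fun s => (phi s)%:E) -> mseq (fun s => `|phi s|%:E).
Proof.
by move=> mphi n; apply/measurable_EFinP; apply: measurableT_comp => //; apply/measurable_EFinP; exact: mphi.
Qed.

Lemma affC (v : R) s u : size s = size u -> aff v s u = aff 1 [seq (v * x)%R | x <- u] s.
Proof. by elim: s u => [|x s IH] [|y u] //= [/IH ->]; rewrite mul1r addrC. Qed.

Lemma iint_trans (v : R) u (G : seq R -> \bar R) : (forall s, 0 <= G s) -> mseq G ->
  iint leb (size u) (fun s => G (aff v s u)) = iint leb (size u) G.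
Proof.
move=> G0 mG; rewrite -(size_map ( *%R v)%R u) -(iint_aff _ ltr01 G0 mG) expr1n mul1e.
by apply: eq_iint => s; rewrite size_map => su; rewrite affC.
Qed.

Lemma iintS_swap d (T : measurableType d) (mu : {sigma_finite_measure set T -> \bar R}) m F :
  (forall s, 0 <= F s) -> mseq F ->
  iint mu m.+1 F = iint mu m (fun s => \int[mu]_x F (x :: s)).
Proof.
move=> F0 mF; rewrite iintS// /iint (fubini_tonelli (fun p : T * m.-tuple T => F (p.1 :: p.2)))//.
apply: (mseq_mlist mF (g := fun p : T * m.-tuple T => p.1 :: p.2)).
by apply: mlist_cons => //; exact: mlist_tval.
Qed.

Lemma ge0_integral_fin_ae d (T : measurableType d) (mu : {measure set T -> \bar R}) (g : T -> \bar R) :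
  measurable_fun setT g -> (forall x, 0 <= g x) -> \int[mu]_x g x < +oo ->
  {ae mu, forall x, g x < +oo}.
Proof.
move=> mg g0 ig.
have : mu.-integrable setT g.
  apply/integrableP; split => //.
  by under eq_integral => x _ do rewrite gee0_abs//.
move=> /(integrable_ae measurableT); apply: filterS => x /(_ I).
by rewrite ge0_fin_numE.
Qed.

(* Translates the first coordinate only; ahead translates all the others. *)
Definition shead (w : R) (s : seq R) : seq R := if s is x :: s' then (x + w)%R :: s' else [::].

Lemma mlist_shead d' (W : measurableType d') w (g : W -> seq R) : mlist g -> mlist (fun t => shead w (g t)).
Proof.
case=> [|x {}g mx mg] /=; first exact: mlist_nil.
by apply: mlist_cons => //; exact: measurable_funD.
Qed.

Lemma mlist_affl d' (W : measurableType d') (v : R) u (g : W -> seq R) : mlist g -> mlist (fun w => aff v (g w) u).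
Proof. by move=> mg; apply: mlist_aff => //; exact: mlist_cst. Qed.

Definition ahead (v : R) u (s : seq R) : seq R := if s is x :: s' then x :: aff v s' u else [::].

Lemma mlist_ahead d' (W : measurableType d') v u (g : W -> seq R) : mlist g -> mlist (fun t => ahead v u (g t)).
Proof.
case=> [|x {}g mx mg] /=; first exact: mlist_nil.
by apply: mlist_cons => //; exact: mlist_affl.
Qed.

(** Induction on the dimension through the function translated in its first coordinate only. In [F1]
    the common first translation is undone by invariance and the other coordinates move: the
    induction hypothesis on almost every slice. In [F2] only the first coordinate moves:
    [L1_trans1]. Twice the integral of |phi| over the slice dominates in both cases. *)
Lemma L1_trans (phi : seq R -> R) (u : seq R) (v : nat -> R) : mseq (fun s => (phi s)%:E) ->
  iint leb (size u) (fun s => `|phi s|%:E) < +oo -> v n @[n --> \oo] --> 0%R ->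
  iint leb (size u) (fun s => `|phi (aff (v n) s u) - phi s|%:E) @[n --> \oo] --> 0.
Proof.
elim: u phi => [|u0 u IH] phi mphi iphi v0 /=.
  rewrite (_ : (fun n => _) = cst 0); first exact: cvg_cst.
  apply/funext => n; rewrite iint0/= ?subrr ?normr0// => m.
  by apply: measurable_dist => //; [apply: mlist_affl|]; exact: mlist_tval.
set m := size u in IH iphi *.
have mabs := mseq_abs mphi.
have fin_inner : \int[leb]_x iint leb m (fun s => `|phi (x :: s)|%:E) < +oo by rewrite -(@iintS _ _ _ leb m (fun s => `|phi s|%:E)).
pose F1 n s := `|phi (aff (v n) s (u0 :: u)) - phi (shead (v n * u0) s)|%:E.
pose F2 n s := `|phi (shead (v n * u0) s) - phi s|%:E.
have mF1 n : mseq (F1 n).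
  by move=> i; apply: measurable_dist => //; [apply: mlist_affl|apply: mlist_shead]; exact: mlist_tval.
have mF2 n : mseq (F2 n).
  by move=> i; apply: measurable_dist => //; [apply: mlist_shead|]; exact: mlist_tval.
have F10 n s : 0 <= F1 n s by rewrite lee_fin.
have F20 n s : 0 <= F2 n s by rewrite lee_fin.
have mphix x : mseq (fun s => (phi (x :: s))%:E) by exact: (mseq_cons x mphi).
pose G n s := `|phi (ahead (v n) u s) - phi s|%:E.
have mG n : mseq (G n).
  by move=> i; apply: measurable_dist => //; [apply: mlist_ahead|]; exact: mlist_tval.
pose D1 n x := iint leb m (fun s => `|phi (x :: aff (v n) s u) - phi (x :: s)|%:E).
have E1 n : iint leb m.+1 (F1 n) = \int[leb]_x D1 n x.
  rewrite iintS// -(integral_lebesgueR_affine (v n * u0)%R ltr01 (g := D1 n)).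
  - rewrite mul1e; apply: eq_integral => x _; apply: eq_iint => s _.
    by rewrite /F1 /= mul1r (addrC x).
  - by apply: (@measurable_iint_cons _ _ _ leb m (G n) _ (mG n)) => t; rewrite lee_fin.
  - by move=> x; apply: iint_ge0 => s; rewrite lee_fin.
have cvg1 : iint leb m.+1 (F1 n) @[n --> \oo] --> 0.
  under eq_fun do rewrite E1.
  have mh : measurable_fun setT (fun x => iint leb m (fun s => `|phi (x :: s)|%:E)).
    by apply: (@measurable_iint_cons _ _ _ leb m (fun s => `|phi s|%:E)) => // s; rewrite lee_fin.
  have h0 x : 0 <= iint leb m (fun s => `|phi (x :: s)|%:E) by apply: iint_ge0 => s; rewrite lee_fin.
  apply: (@dominated_cvg0 _ _ _ leb _ (fun x => 2%:E * iint leb m (fun s => `|phi (x :: s)|%:E))) => //.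
  - by move=> n; apply: (@measurable_iint_cons _ _ _ leb m (G n) _ (mG n)) => t; rewrite lee_fin.
  - by move=> n x; apply: iint_ge0 => s; rewrite lee_fin.
  - have := ge0_integral_fin_ae mh h0 fin_inner; apply: filterS => x hx.
    exact: (IH (fun s => phi (x :: s)) (mphix x) hx v0).
  - by apply: measurable_funeM.
  - by rewrite ge0_integralZl// lte_mul_pinfty.
  - apply: aeW => x n; rewrite /D1.
    have mx : mseq (fun s => `|phi (x :: s)|%:E) by exact: mseq_abs.
    have mx' : mseq (fun s => `|phi (x :: aff (v n) s u)|%:E).
      by move=> i; apply: (mseq_mlist mx); apply: mlist_affl; exact: mlist_tval.
    rewrite (_ : 2%:E = 1 + 1)// ge0_muleDl// mul1e.
    rewrite -{1}(iint_trans (v n) u _ mx)//.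
    rewrite -iintD//; apply: le_iint => //.
    + by move=> i; apply: (measurable_dist (mphix x)) => //; [apply: mlist_affl|]; exact: mlist_tval.
    + exact: mseqD.
    + by move=> s _; rewrite -EFinD lee_fin ler_normB.
  - by move=> x; rewrite mule_ge0.
have cvg2 : iint leb m.+1 (F2 n) @[n --> \oo] --> 0.
  pose D2 n (t : m.-tuple R) := \int[leb]_x `|phi ((x + v n * u0)%R :: t) - phi (x :: t)|%:E.
  have E2 n : iint leb m.+1 (F2 n) = \int[power_measure leb m]_t D2 n t by rewrite iintS_swap.
  under eq_fun do rewrite E2.
  pose h (t : m.-tuple R) := \int[leb]_x `|phi (x :: t)|%:E.
  have h0 t : 0 <= h t by apply: integral_ge0 => x _; rewrite lee_fin.
  have mcons (t : seq R) : mlist (fun x : R => x :: t) by apply: mlist_cons => //; exact: mlist_cst.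
  have mpair : mlist (fun p : R * m.-tuple R => p.1 :: p.2).
    by apply: mlist_cons => //; exact: mlist_tval.
  have mh : measurable_fun setT h.
    apply: (measurable_fun_fubini_tonelli_G (fun p : R * m.-tuple R => `|phi (p.1 :: p.2)|%:E)) => //.
    exact: (mseq_mlist mabs mpair).
  have vu0 : (v n * u0)%R @[n --> \oo] --> 0%R.
    by rewrite -(mul0r u0); apply: cvgM => //; exact: cvg_cst.
  have ih : \int[power_measure leb m]_t h t < +oo.
    by rewrite (_ : \int[_]_t _ = iint leb m.+1 (fun s => `|phi s|%:E))// iintS_swap.
  apply: (@dominated_cvg0 _ _ _ (power_measure leb m) _ (fun t => 2%:E * h t)) => //.
  - move=> n; apply: (measurable_fun_fubini_tonelli_G (fun p : R * m.-tuple R => `|phi ((p.1 + v n * u0)%R :: p.2) - phi (p.1 :: p.2)|%:E)) => //.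
    by apply: measurable_dist => //; exact: mlist_shead mpair.
  - by move=> n t; apply: integral_ge0 => x _; rewrite lee_fin.
  - have := ge0_integral_fin_ae mh h0 ih; apply: filterS => t ht.
    apply: (L1_trans1 (g := fun x => phi (x :: t))) ht vu0.
    by apply/measurable_EFinP; exact: (mseq_mlist mphi).
  - by apply: measurable_funeM.
  - by rewrite ge0_integralZl// lte_mul_pinfty.
  - apply: aeW => t n; rewrite /D2.
    have mx : measurable_fun setT (fun x : R => `|phi (x :: t)|%:E) by exact: (mseq_mlist mabs).
    have mx' : measurable_fun setT (fun x : R => `|phi ((x + v n * u0)%R :: t)|%:E).
      by apply: (mseq_mlist mabs (g := fun x : R => (x + v n * u0)%R :: t)); exact: mlist_shead (mcons t).
    rewrite (_ : 2%:E = 1 + 1)// ge0_muleDl// mul1e.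
    rewrite {1}/h -(integral_lebesgueR_affine (v n * u0)%R ltr01 mx)// mul1e.
    under [X in _ <= X + _]eq_integral => x _ do rewrite mul1r addrC.
    rewrite -ge0_integralD//; apply: ge0_le_integral => //.
    + by apply: measurable_dist => //; exact: mlist_shead (mcons t).
    + exact: emeasurable_funD.
    + by move=> x _; rewrite -EFinD lee_fin ler_normB.
  - by move=> t; rewrite mule_ge0.
apply: cvge0_le => [n|e e0]; first by apply: iint_ge0 => s; rewrite lee_fin.
have e2 : (0 < e / 2)%R by rewrite divr_gt0.
have := cvge0_near e2 cvg1; have := cvge0_near e2 cvg2; apply: filterS2 => n H2 H1.
rewrite [e]splitr EFinD (le_trans _ (leeD H1 H2))// -iintD//; apply: le_iint.
- by move=> s; rewrite lee_fin.
- by move=> i; apply: measurable_dist => //; [apply: mlist_affl|]; exact: mlist_tval.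
- exact: mseqD.
- by move=> s _; rewrite -EFinD lee_fin ler_distD.
Qed.
End L1_translation.

(** * Asymptotics of the mean *)

Section density.
Context d (T : measurableType d) (R : realType).
Variables (L : {sigma_finite_measure set T -> \bar R}) (mu : {finite_measure set T -> \bar R}).
Variable f : T -> R.
Local Open Scope ereal_scope.
Hypothesis mf : measurable_fun setT f.
Hypothesis f0 : forall x, (0 <= f x)%R.
Hypothesis muf : forall A, measurable A -> mu A = \int[L]_(x in A) (f x)%:E.

Lemma density_dominates : mu `<< L.
Proof.
apply/null_content_dominatesP => A mA LA; rewrite muf//.
apply: null_set_integral => //; first by apply/measurable_EFinP; exact: measurable_funTS.
Qed.

(** [f] agrees almost everywhere with the Radon-Nikodym derivative of [mu], having the same integral
    over every measurable set; its change of variables formula then passes to [f]. *)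
Lemma ge0_integral_density (g : T -> \bar R) : measurable_fun setT g -> (forall x, 0 <= g x) ->
  \int[mu]_x g x = \int[L]_x ((f x)%:E * g x).
Proof.
move=> mg g0.
have := Radon_Nikodym_SigmaFinite.change_of_variables density_dominates g0 measurableT mg.
have fi := @Radon_Nikodym_SigmaFinite.f_integrable _ _ _ mu L density_dominates.
have mF := measurable_int _ fi.
have mfE : measurable_fun setT (EFin \o f) by exact/measurable_EFinP.
have ae := @integral_ae_eq _ _ _ L setT measurableT (EFin \o f) _ fi mfE.
move=> <-; apply: ge0_ae_eq_integral => //.
- exact: emeasurable_funM.
- exact: emeasurable_funM.
- by move=> x _; apply: mule_ge0 => //; apply: Radon_Nikodym_SigmaFinite.f_ge0; exact: density_dominates.
- by move=> x _; rewrite mule_ge0// lee_fin.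
- have : ae_eq L setT (Radon_Nikodym_SigmaFinite.f mu L) (EFin \o f).
    by apply: ae => E _ mE; rewrite -muf// -(Radon_Nikodym_SigmaFinite.f_integral density_dominates).
  by apply: filterS => x H _; rewrite H// muleC.
Qed.

Lemma mseq_prod : mseq (fun s => (\prod_(x <- s) f x)%:E).
Proof.
move=> n; apply/measurable_EFinP.
elim: n => [|n IH]; first by rewrite (_ : (fun _ => _) = cst 1%R)//; apply/funext => t; rewrite tuple0 big_nil.
rewrite (_ : (fun _ => _) = fun t : n.+1.-tuple T => (f (thead t) * \prod_(x <- [tuple of behead t]) f x)%R).
  apply: measurable_funM; first by apply: measurableT_comp => //; exact: measurable_tnth.
  by apply: (measurableT_comp IH); exact: measurable_behead.
by apply/funext => t; rewrite {1}(tuple_eta t) big_cons.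
Qed.

Lemma prod_ge0 s : (0 <= \prod_(x <- s) f x)%R.
Proof. by apply: prodr_ge0. Qed.
End density.

Section iint_density.
Context d (T : measurableType d) (R : realType).
Variables (L : {sigma_finite_measure set T -> \bar R}) (mu : probability T R).
Variable f : T -> R.
Local Open Scope ereal_scope.
Hypothesis mf : measurable_fun setT f.
Hypothesis f0 : forall x, (0 <= f x)%R.
Hypothesis muf : forall A, measurable A -> mu A = \int[L]_(x in A) (f x)%:E.

Lemma iint_density m (F : seq T -> \bar R) : (forall s, 0 <= F s) -> mseq F ->
  iint mu m F = iint L m (fun s => (\prod_(x <- s) f x)%:E * F s).
Proof.
have mprod := mseq_prod mf.
elim: m F => [|m IH] F F0 mF.
  by rewrite !iint0// ?big_nil ?mul1e//; exact: mseqM.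
rewrite !iintS//; [|by move=> s; rewrite mule_ge0// lee_fin prod_ge0|exact: mseqM].
rewrite (ge0_integral_density mf f0 muf); [|exact: (measurable_iint_cons mu)|by move=> x; exact: iint_ge0].
apply: eq_integral => x _; rewrite IH//; last exact: mseq_cons.
rewrite -iintZl ?lee_fin//; last 2 first.
- by move=> s; rewrite mule_ge0// lee_fin prod_ge0.
- by apply: mseqM => //; exact: mseq_cons.
by apply: eq_iint => s _; rewrite big_cons EFinM muleA.
Qed.
End iint_density.

Section lebesgue_tuple.
Variables (R : realType) (d : nat).
Notation T := (d.-tuple R).
Notation L := (@lebesgue R d).
Local Open Scope ereal_scope.

(** A point of R^d is a list of coordinates and [lebesgue d] an iterated integral over them;
    extending a function to lists of every length makes the results on [iint] over the reals apply
    to it. *)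
Definition lift_tuple (V : Type) (v0 : V) (g : T -> V) (s : seq R) : V :=
  if insub s is Some t then g t else v0.

Lemma lift_tupleE (V : Type) (v0 : V) (g : T -> V) (t : T) : lift_tuple v0 g t = g t.
Proof. by rewrite /lift_tuple valK. Qed.

Lemma mseq_lift_tuple (g : T -> \bar R) : measurable_fun setT g -> mseq (lift_tuple 0 g).
Proof.
move=> mg n; have [nd|nd] := eqVneq n d.
  by subst n; rewrite (_ : (fun _ => _) = g)//; apply/funext => t; rewrite lift_tupleE.
rewrite (_ : (fun _ => _) = cst 0)//; apply/funext => t.
by rewrite /lift_tuple insubF// size_tuple; exact/negbTE.
Qed.

Definition affT (r : R) (x y : T) : T := [tuple (tnth x i + r * tnth y i)%R | i < d].

Lemma val_affT r x y : tval (affT r x y) = aff r x y.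
Proof.
rewrite /affT /=; apply: (@eq_from_nth _ 0%R).
  rewrite size_map size_enum_ord; case: x y => [x /= /eqP <-] [y /= /eqP].
  by elim: x y => [|a x IH] [|b y]//= [/IH <-].
rewrite size_map size_enum_ord => i id; rewrite (nth_map (Ordinal id)) ?size_enum_ord//.
rewrite !(tnth_nth 0%R) nth_enum_ord//.
case: x y => [x /= /eqP xd] [y /= /eqP yd]; have : (i < size x)%N by rewrite xd.
have : size x = size y by rewrite xd yd.
by elim: x y i {id xd yd} => [|a x IH] [|b y] [|i] //= [xy] ix; apply: IH.
Qed.

Lemma lebesgue_affine (r : R) (a : T) (g : T -> \bar R) : (0 < r)%R -> measurable_fun setT g ->
  (forall x, 0 <= g x) -> (r ^+ d)%:E * \int[L]_y g (affT r a y) = \int[L]_x g x.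
Proof.
move=> r0 mg g0.
have G0 s : 0 <= lift_tuple 0 g s by rewrite /lift_tuple; case: insub.
have := iint_aff a r0 G0 (mseq_lift_tuple mg).
rewrite size_tuple /iint.
under eq_integral => y _ do rewrite -val_affT lift_tupleE.
by under [X in _ = X]eq_integral => y _ do rewrite lift_tupleE.
Qed.

Lemma lebesgue_trans_cvg (g : T -> R) (u : T) (v : nat -> R) : measurable_fun setT g ->
  \int[L]_x `|g x|%:E < +oo -> v n @[n --> \oo] --> 0%R ->
  \int[L]_x `|g (affT (v n) x u) - g x|%:E @[n --> \oo] --> 0.
Proof.
move=> mg ig v0.
have mphi : mseq (fun s => (lift_tuple 0%R g s)%:E).
  rewrite (_ : (fun s => _) = lift_tuple 0 (EFin \o g)).
    by apply: mseq_lift_tuple; exact/measurable_EFinP.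
  by apply/funext => s; rewrite /lift_tuple; case: insub.
have := @L1_trans R (lift_tuple 0%R g) u v mphi.
rewrite size_tuple /iint; under eq_integral => x _ do rewrite lift_tupleE.
move=> /(_ ig v0); apply: cvg_trans; apply: near_eq_cvg; apply: nearW => n.
by apply: eq_integral => x _; rewrite -val_affT !lift_tupleE.
Qed.

Lemma lebesgue_box (r c : R) x : (0 <= c * r)%R ->
  L [set y | box r c x y] = ((2 * (c * r)) ^+ d)%:E.
Proof.
move=> cr0.
pose A (i : 'I_d) : set R := `[(tnth x i - c * r)%R, (tnth x i + c * r)%R]%classic.
rewrite (_ : [set y | box r c x y] = [set t : T | forall i, A i (tnth t i)]); last first.
  apply/seteqP; split => y /=.
    move=> /forallP H i; have := H i; rewrite /A /= in_itv /= distrC ler_distl.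
    by [].
  by move=> H; apply/forallP => i; have := H i; rewrite /A /= in_itv /= distrC ler_distl.
rewrite power_measureX; last by move=> i; exact: measurable_itv.
transitivity (\prod_(i < d) (2 * (c * r))%:E).
  apply: eq_bigr => i _.
  transitivity (@lebesgue_measure R (A i)) => //.
  rewrite /A lebesgue_measure_itv /= lte_fin; case: ltP => h; last first.
    by have -> : (2 * (c * r) = 0)%R by lra.
  by rewrite -EFinB; congr _%:E; ring.
by rewrite prodEFin; congr _%:E; rewrite prodr_const card_ord.
Qed.

Lemma lebesgue_set1 (x : T) : (0 < d)%N -> L [set x] = 0.
Proof.
move=> d0; rewrite (_ : [set x] = [set y | box 0 0 x y]).
  by rewrite lebesgue_box ?mul0r// mulr0 expr0n eqn0Ngt d0.
apply/seteqP; split => y /=; first by move=> ->; apply/forallP => i; rewrite subrr normr0 mul0r.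
move=> /forallP H; apply: eq_from_tnth => i; have := H i.
by rewrite mul0r normr_le0 subr_eq0 => /eqP.
Qed.

Section bounded_density.
Variables (mu : probability T R) (f : T -> R) (M : R).
Hypothesis mf : measurable_fun setT f.
Hypothesis f0 : forall x, (0 <= f x)%R.
Hypothesis fM : forall x, (f x <= M)%R.
Hypothesis muf : forall A, measurable A -> mu A = \int[L]_(x in A) (f x)%:E.

Lemma density_box (r c : R) x : (0 <= c * r)%R ->
  mu [set y | box r c x y] <= (M * (2 * (c * r)) ^+ d)%:E.
Proof.
move=> cr0; have mB : measurable [set y | box r c x y] by exact: measurable_box.
have M0 : (0 <= M)%R by apply: le_trans (f0 x) (fM x).
rewrite muf// EFinM -(lebesgue_box x cr0) -integral_cst//.
apply: ge0_le_integral => //.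
- by move=> y _; rewrite lee_fin.
- by apply/measurable_EFinP; exact: measurable_funTS.
- by move=> y _; rewrite lee_fin.
Qed.

Lemma density_atomless x : (0 < d)%N -> mu [set x] = 0.
Proof.
move=> d0; have mx : measurable [set x].
  rewrite (_ : [set x] = [set y | box 0 0 x y]); first exact: measurable_box.
  apply/seteqP; split => y /=; first by move=> ->; apply/forallP => i; rewrite subrr normr0 mul0r.
  move=> /forallP H; apply: eq_from_tnth => i; have := H i.
  by rewrite mul0r normr_le0 subr_eq0 => /eqP.
rewrite muf//; apply: null_set_integral => //; last exact: lebesgue_set1.
by apply/measurable_EFinP; exact: measurable_funTS.
Qed.

End bounded_density.
End lebesgue_tuple.

Section mean_bounds.
Variables (R : realType) (d : nat) (r : R).
Notation T := (d.-tuple R).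
Variable mu : probability T R.
Hypothesis mu_atomless : forall x, mu [set x] = 0%E.
Variables (t : R) (k : nat) (beta : R).
Hypotheses (t_gt0 : 0 < t) (r_ge0 : 0 <= r) (beta_ge0 : 0 <= beta).
Hypothesis mu_box : forall x, (mu [set y | box r (2 * k.+1)%:R x y] <= beta%:E)%E.
Local Open Scope ereal_scope.

Lemma pint_isolated a : pint mu t (fun b => ((isolated r (a, b))%:R * 1)%:E) =
  (conn r a)%:R%:E * pint mu t (fun b => (all (far r a) b)%:R%:E).
Proof.
rewrite -pintZl//; last exact: (mseq_all (measurable_far r a)).
congr pint; apply/funext => b.
by rewrite mulr1 -EFinM -natrM mulnb /isolated /= sep_far.
Qed.

Lemma far_box a (x y : T) : conn r a -> x \in a -> size a = k -> ~~ far r a y ->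
  box r (2 * k.+1)%:R x y.
Proof.
move=> ca xa ak /allPn[z za]; rewrite negbK => nzy.
apply: (box_widen r_ge0 (c := k.+1%:R)); first by rewrite ler_nat leq_pmull.
rewrite -addn1 natrD; apply: box_trans (nbr_box nzy).
by rewrite -ak; exact: conn_box.
Qed.

(** [J] is the mean number of connected k-subsets. One of them fails to be a component only if
    another point is near it, which has probability 1 - exp(-t m) <= t beta, where m is the mass of
    its neighbourhood. *)
Lemma mean_bounds : let J := (t ^+ k / k`!%:R)%:E * iint mu k (fun a => (conn r a)%:R%:E) in
  EW r mu t k (fun j => j%:R) <= J /\ J <= EW r mu t k (fun j => j%:R) + (t * beta)%:E * J.
Proof.
rewrite /= EW_mean//.
set c := (t ^+ k / k`!%:R)%R; set I := iint mu k _; set J := iint mu k _.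
have c0 : (0 <= c)%R by rewrite divr_ge0// exprn_ge0// ltW.
have b0 (s : seq T) : 0 <= (conn r s)%:R%:E :> \bar R by rewrite lee_fin.
have V0 s : 0 <= pint mu t (fun b => ((isolated r (s, b))%:R * 1)%:E).
  by apply: pint_ge0 => b; rewrite lee_fin mulr_ge0.
have mV : mseq (fun a => pint mu t (fun b => ((isolated r (a, b))%:R * 1)%:E)).
  exact: (@measurable_V R d r mu t k (fun=> 1%R)).
have mC := @mseq_conn R d r.
have tb0 : (0 <= t * beta)%R by rewrite mulr_ge0// ltW.
suff [H1 H2] : I <= J /\ J <= I + (t * beta)%:E * J.
  split; first by apply: lee_wpmul2l; rewrite ?lee_fin.
  have I0 : 0 <= I by exact: iint_ge0.
  have J0 : 0 <= J by exact: iint_ge0.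
  rewrite muleCA -ge0_muleDr//; last by rewrite mule_ge0// lee_fin.
  by apply: lee_wpmul2l; rewrite ?lee_fin.
split.
  apply: le_iint => // s _; rewrite pint_isolated.
  rewrite -[leRHS]mule1; apply: lee_wpmul2l => //.
  rewrite -(pint1 mu t_gt0); apply: le_pint => //.
  + exact: (mseq_all (measurable_far r s)).
  + by move=> b; rewrite lee_fin; case: (all _ _).
have mbC : mseq (fun a : seq T => (t * beta)%:E * (conn r a)%:R%:E).
  exact: (mseqM (@mseq_cst _ T R (t * beta)%:E) mC).
rewrite /J -[X in _ <= _ + X]iintZl// -iintD//.
- apply: le_iint => //; first exact: mseqD.
  move=> a ak; rewrite pint_isolated.
  case: (boolP (conn r a)) => ca; rewrite ?mul0e ?mule0 ?adde0// ?mul1e ?mule1.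
  rewrite (pint_all mu t_gt0 (measurable_far r a)) -EFinD lee_fin.
  have [[x xa] _] := (connP r a).1 ca.
  have : (1 - fine (mu [set y | far r a y]) <= beta)%R.
    rewrite -lee_fin EFinB fineK ?fin_num_measure//; last exact: measurable_far.
    rewrite -probability_setC; last exact: measurable_far.
    apply: le_trans (mu_box x); apply: le_measure; rewrite ?inE.
    + by apply: measurableC; exact: measurable_far.
    + exact: measurable_box.
    by move=> y /= /negP fy; apply: far_box ca xa ak fy.
  by move=> /(ler_wpM2l (ltW t_gt0)) tb; apply: le_trans (lerD (expR_ge1Dx _) tb); rewrite subrK.
- by move=> s; rewrite mule_ge0// lee_fin.
Qed.
End mean_bounds.

Section scaling.
Variables (R : realType) (d : nat) (r : R).
Notation T := (d.-tuple R).
Hypothesis r_gt0 : 0 < r.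

Lemma edist_affT (x u v : T) : Defs.edist (affT r x u) (affT r x v) = r * Defs.edist u v.
Proof.
rewrite /Defs.edist -[in RHS](ger0_norm (ltW r_gt0)) -sqrtr_sqr -sqrtrM ?sqr_ge0//.
congr Num.sqrt; rewrite mulr_sumr; apply: eq_bigr => i _.
rewrite !tnth_mktuple; ring.
Qed.

Lemma affT_origin (x : T) : affT r x (origin d) = x.
Proof. by apply: eq_from_tnth => i; rewrite !tnth_mktuple mulr0 addr0. Qed.

Lemma conn_affT (x : T) s : conn r [seq affT r x y | y <- s] = conn 1 s.
Proof.
pose psi (z : T) : T := [tuple (tnth z i - tnth x i) / r | i < d].
have K : cancel (affT r x) psi.
  move=> u; apply: eq_from_tnth => i; rewrite !tnth_mktuple addrC addKr mulrC mulKf//.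
  by rewrite gt_eqF.
have I := can_inj K.
have N u v : nbr r (affT r x u) (affT r x v) = nbr 1 u v.
  by rewrite /nbr edist_affT -[X in _ <= X](mulr1 r) ler_pM2l.
apply/idP/idP => /connP[[z zs] H]; apply/connP; split.
- by move/mapP: zs => [y ys _]; exists y.
- move=> q [u us qu] [v vs qv].
  have [||y [w [/mapP[y' ys ->] /mapP[w' ws ->]]]] := H (q \o psi).
  + by exists (affT r x u); rewrite /= ?K//; exact: map_f.
  + by exists (affT r x v); rewrite /= ?K//; exact: map_f.
  by rewrite /= !K N => ? ? ?; exists y', w'; split.
- by exists (affT r x z); exact: map_f.
- move=> q [_ /mapP[u us ->] qu] [_ /mapP[v vs ->] qv].
  have [||y [w [ys ws qy qw yw]]] := H (q \o affT r x).
  + by exists u.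
  + by exists v.
  exists (affT r x y), (affT r x w); split => //; rewrite ?N//; exact: map_f.
Qed.

Local Open Scope ereal_scope.
Notation L := (@lebesgue R d).

Lemma mlist_map_affT d' (W : measurableType d') (x : W -> T) (g : W -> seq T) :
  measurable_fun setT x -> mlist g -> mlist (fun w => [seq affT r (x w) y | y <- g w]).
Proof.
move=> mx; elim=> [|y {}g my mg IH] /=; first exact: mlist_nil.
apply: mlist_cons => //.
apply/measurable_fun_tnthP => i.
rewrite (_ : (tnth (T:=R))^~ i \o _ = fun w => (tnth (x w) i + r * tnth (y w) i)%R); last first.
  by apply/funext => w; rewrite /= tnth_mktuple.
apply: measurable_funD; last apply: measurable_funM => //.
  exact: (measurableT_comp (measurable_tnth i)).
exact: (measurableT_comp (measurable_tnth i)).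
Qed.

Lemma iint_map_affT m x (G : seq T -> \bar R) : (forall s, 0 <= G s) -> mseq G ->
  ((r ^+ d) ^+ m)%:E * iint L m (fun s => G [seq affT r x y | y <- s]) = iint L m G.
Proof.
elim: m G => [|m IH] G G0 mG.
  rewrite expr0 mul1e !iint0// => m; apply: (mseq_mlist mG); apply: mlist_map_affT => //; exact: mlist_tval.
have rd0 : (0 <= r ^+ d)%R by rewrite exprn_ge0// ltW.
have mm (F : seq T -> \bar R) : mseq F -> mseq (fun s => F [seq affT r x y | y <- s]).
  by move=> mF i; apply: (mseq_mlist mF); apply: mlist_map_affT => //; exact: mlist_tval.
rewrite iintS//; last exact: mm.
rewrite exprS EFinM -muleA -ge0_integralZl//; last 3 first.
- exact: (@measurable_iint_cons _ _ _ L m (fun s => G [seq affT r x y | y <- s]) (fun s => G0 _) (mm _ mG)).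
- by move=> y _; exact: iint_ge0.
- by rewrite lee_fin exprn_ge0.
transitivity ((r ^+ d)%:E * \int[L]_y (iint L m (fun s => G (affT r x y :: s)))).
  congr (_ * _); apply: eq_integral => y _.
  by rewrite -(IH (fun s => G (affT r x y :: s)))//; exact: mseq_cons.
rewrite (@lebesgue_affine _ _ r x (fun y => iint L m (fun s => G (y :: s))))//.
- by rewrite iintS.
- exact: measurable_iint_cons.
- by move=> y; exact: iint_ge0.
Qed.
End scaling.

Section integral_cvg.
Context d (T : measurableType d) (R : realType) (mu : {measure set T -> \bar R}).
Local Open Scope ereal_scope.

Lemma cvg_integral_L1 (g : nat -> T -> R) (h : T -> R) :
  (forall n, measurable_fun setT (g n)) -> measurable_fun setT h ->
  (forall n x, 0 <= g n x)%R -> (forall x, 0 <= h x)%R -> \int[mu]_x (h x)%:E < +oo ->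
  \int[mu]_x `|g n x - h x|%:E @[n --> \oo] --> 0 ->
  \int[mu]_x (g n x)%:E @[n --> \oo] --> \int[mu]_x (h x)%:E.
Proof.
move=> mg mh g0 h0 ih gh.
have mgE n : measurable_fun setT (fun x => (g n x)%:E) by exact/measurable_EFinP.
have mhE : measurable_fun setT (fun x => (h x)%:E) by exact/measurable_EFinP.
have mD n : measurable_fun setT (fun x => `|g n x - h x|%:E).
  by apply/measurable_EFinP; apply: measurableT_comp => //; exact: measurable_funB.
have H1 n : \int[mu]_x (g n x)%:E <= \int[mu]_x (h x)%:E + \int[mu]_x `|g n x - h x|%:E.
  rewrite -ge0_integralD//; try by move=> x _; rewrite lee_fin.
  apply: ge0_le_integral => //; first by move=> x _; rewrite lee_fin.
    exact: emeasurable_funD.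
  by move=> x _; rewrite -EFinD lee_fin -lerBlDl ler_norm.
have H2 n : \int[mu]_x (h x)%:E <= \int[mu]_x (g n x)%:E + \int[mu]_x `|g n x - h x|%:E.
  rewrite -ge0_integralD//; try by move=> x _; rewrite lee_fin.
  apply: ge0_le_integral => //; first by move=> x _; rewrite lee_fin.
    exact: emeasurable_funD.
  by move=> x _; rewrite -EFinD lee_fin -lerBlDl distrC ler_norm.
have g_ge0 n : 0 <= \int[mu]_x (g n x)%:E by apply: integral_ge0 => x _; rewrite lee_fin.
have h_ge0 : 0 <= \int[mu]_x (h x)%:E by apply: integral_ge0 => x _; rewrite lee_fin.
have hfin : \int[mu]_x (h x)%:E \is a fin_num by rewrite ge0_fin_numE.
rewrite -(fineK hfin) in H1 H2 *; move: (fine _) H1 H2 => a H1 H2.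
apply/fine_cvgP; split.
  have := cvge0_near ltr01 gh; apply: filterS => n gn.
  rewrite ge0_fin_numE//; apply: le_lt_trans (H1 n) _.
  by apply: (@le_lt_trans _ _ (a%:E + 1%:E)); [exact: leeD|rewrite -EFinD ltry].
apply/cvgrPdist_le => e e0.
have := cvge0_near e0 gh; apply: filterS => n gn /=.
have h1 := le_trans (H1 n) (leeD (lexx a%:E) gn).
have gfin : \int[mu]_x (g n x)%:E \is a fin_num.
  by rewrite ge0_fin_numE//; apply: le_lt_trans h1 _; rewrite -EFinD ltry.
have h2 := le_trans (H2 n) (leeD (lexx _) gn).
rewrite -(fineK gfin) -!EFinD !lee_fin in h1 h2.
by rewrite ler_norml; apply/andP; split; lra.
Qed.
End integral_cvg.

Section mean_limit.
Variables (R : realType) (d : nat).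
Notation T := (d.-tuple R).
Notation L := (@lebesgue R d).
Variables (mu : probability T R) (f : T -> R) (M : R).
Local Open Scope ereal_scope.
Hypothesis mf : measurable_fun setT f.
Hypothesis f0 : forall x, (0 <= f x)%R.
Hypothesis fM : forall x, (f x <= M)%R.
Hypothesis muf : forall A, measurable A -> mu A = \int[L]_(x in A) (f x)%:E.

(* h1 as a function on lists. *)
Definition starc (y : seq T) : \bar R := (conn 1 (origin d :: y))%:R%:E.

Definition fprod r (y : seq T) (x : T) : R := (f x * \prod_(z <- y) f (affT r x z))%R.

Lemma fprod_ge0 r y x : (0 <= fprod r y x)%R.
Proof. by rewrite mulr_ge0// prodr_ge0. Qed.

Lemma measurable_fprod r d' (W : measurableType d') (y : W -> seq T) (x : W -> T) :
  measurable_fun setT x -> mlist y -> measurable_fun setT (fun w => (fprod r (y w) (x w))%:E).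
Proof.
move=> mx my.
rewrite (_ : (fun w => _) = fun w => (\prod_(z <- x w :: [seq affT r (x w) z | z <- y w]) f z)%:E).
  by apply: (mseq_mlist (mseq_prod mf)); apply: mlist_cons => //; exact: mlist_map_affT.
by apply/funext => w; rewrite big_cons big_map.
Qed.

Lemma mseq_starc : mseq starc.
Proof. exact: mseq_cons (@mseq_conn R d 1). Qed.

Lemma conn_int_scale (r : R) j : (0 < r)%R ->
  iint mu j.+1 (fun s => (conn r s)%:R%:E) =
  ((r ^+ d) ^+ j)%:E * iint L j (fun y => starc y * \int[L]_x (fprod r y x)%:E).
Proof.
move=> r0; have mC := @mseq_conn R d r.
have C0 (s : seq T) : 0 <= (conn r s)%:R%:E :> \bar R by rewrite lee_fin.
have rd0 : 0 <= ((r ^+ d) ^+ j)%:E by rewrite lee_fin !exprn_ge0// ltW.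
rewrite (iint_density mf f0 muf _ C0 mC).
pose G (s : seq T) : \bar R := (\prod_(x <- s) f x)%:E * (conn r s)%:R%:E.
have G0 s : 0 <= G s by rewrite mule_ge0// lee_fin prod_ge0.
have mG : mseq G by apply: mseqM => //; exact: mseq_prod.
rewrite -[LHS]/(iint L j.+1 G) iintS//.
pose H (p : T * j.-tuple T) : \bar R := starc p.2 * (fprod r p.2 p.1)%:E.
have H0 p : 0 <= H p by rewrite mule_ge0// lee_fin// fprod_ge0.
have mH : measurable_fun setT H.
  apply: emeasurable_funM.
    apply: (mseq_mlist mseq_starc (g := fun p : T * j.-tuple T => p.2)); exact: mlist_tval.
  by apply: measurable_fprod => //; exact: mlist_tval.
transitivity (\int[L]_x (((r ^+ d) ^+ j)%:E * \int[power_measure L j]_y H (x, y))).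
  apply: eq_integral => x _.
  rewrite -(iint_map_affT r0 j x (fun s => G0 (x :: s)) (mseq_cons x mG)).
  congr (_ * _); apply: eq_integral => y _.
  rewrite /G /H muleC big_cons big_map /starc /= -(conn_affT r0 x) /= affT_origin.
  by [].
rewrite ge0_integralZl//; last 2 first.
- exact: measurable_fun_fubini_tonelli_F.
- by move=> x _; exact: integral_ge0.
congr (_ * _); rewrite (fubini_tonelli H)//.
apply: eq_integral => y _; rewrite /H /=.
rewrite ge0_integralZl//.
- by apply: measurable_fprod => //; exact: mlist_cst.
- by move=> x _; rewrite lee_fin fprod_ge0.
- by rewrite lee_fin.
Qed.

End mean_limit.

Section fprod_limit.
Variables (R : realType) (d : nat).
Notation T := (d.-tuple R).
Notation L := (@lebesgue R d).
Variables (mu : probability T R) (f : T -> R) (M : R).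
Local Open Scope ereal_scope.
Hypothesis mf : measurable_fun setT f.
Hypothesis f0 : forall x, (0 <= f x)%R.
Hypothesis fM : forall x, (f x <= M)%R.
Hypothesis muf : forall A, measurable A -> mu A = \int[L]_(x in A) (f x)%:E.

Lemma density_bound_ge0 : (0 <= M)%R.
Proof. by apply: le_trans (f0 (origin d)) (fM _). Qed.
Let M0 := density_bound_ge0.

Lemma integral_density1 : \int[L]_x (f x)%:E = 1.
Proof. by rewrite -muf// probability_setT. Qed.

Let mfE : measurable_fun setT (fun x => (f x)%:E).
Proof. exact/measurable_EFinP. Qed.

Let mX j : measurable_fun setT (fun x => (f x ^+ j)%:E).
Proof. by apply/measurable_EFinP; exact: measurable_funX. Qed.

Lemma le_fprod r y x : (fprod f r y x <= M ^+ size y * f x)%R.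
Proof.
rewrite mulrC /fprod; apply: ler_wpM2l => //.
elim: y => [|z y IH] /=; first by rewrite big_nil.
by rewrite big_cons exprS ler_pM// prodr_ge0.
Qed.

Lemma le_integral_fprod r y : \int[L]_x (fprod f r y x)%:E <= (M ^+ size y)%:E.
Proof.
rewrite -[leRHS]mule1 -integral_density1 -ge0_integralZl ?lee_fin ?exprn_ge0//; last first.
  by move=> x _; rewrite lee_fin.
apply: ge0_le_integral => //.
- by move=> x _; rewrite lee_fin fprod_ge0.
- by apply: measurable_fprod => //; exact: mlist_cst.
- by apply: measurable_funeM.
- by move=> x _; rewrite -EFinM lee_fin le_fprod.
Qed.

Lemma integral_densityX_fin j : \int[L]_x (f x ^+ j.+1)%:E < +oo.
Proof.
apply: (@le_lt_trans _ _ (M ^+ j)%:E); last exact: ltry.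
rewrite -[leRHS]mule1 -integral_density1 -ge0_integralZl ?lee_fin ?exprn_ge0//; last first.
  by move=> x _; rewrite lee_fin.
apply: ge0_le_integral => //.
- by move=> x _; rewrite lee_fin exprn_ge0.
- by apply: measurable_funeM.
- move=> x _; rewrite -EFinM lee_fin exprSr; apply: ler_wpM2r => //.
  by apply: lerXn2r; rewrite ?nnegrE.
Qed.

(** If the integral were 0, [f] would vanish almost everywhere, against its total mass 1. Positivity
    allows the division in the asymptotics of the mean. *)
Lemma integral_densityX_gt0 j : 0 < \int[L]_x (f x ^+ j.+1)%:E.
Proof.
rewrite lt0e integral_ge0 ?andbT; last by move=> x _; rewrite lee_fin exprn_ge0.
apply/eqP => I0.
have : ae_eq L setT (fun x => (f x ^+ j.+1)%:E) (cst 0).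
  apply/ae_eq_integral_abs => //.
  by under eq_integral => x _ do rewrite gee0_abs ?lee_fin ?exprn_ge0//.
move=> ae; have : \int[L]_x (f x)%:E = \int[L]_x (cst 0 x).
  apply: ge0_ae_eq_integral => //; first by move=> x _; rewrite lee_fin.
  apply: filterS ae => x H _; have [/eqP] := H I.
  by rewrite expf_eq0 /= => /eqP ->.
by rewrite integral0 integral_density1 => /eqP; rewrite onee_eq0.
Qed.

(** Induction on [y], one translated factor at a time: a P - b c = a (P - b) + b (a - c), where a
    and b are bounded through f <= M, the induction hypothesis handles P - b and
    [lebesgue_trans_cvg] handles a - c. *)
Lemma fprod_cvg (v : nat -> R) y : v n @[n --> \oo] --> 0%R ->
  \int[L]_x `|fprod f (v n) y x - f x ^+ (size y).+1|%:E @[n --> \oo] --> 0.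
Proof.
move=> v0; elim: y => [|z y IH].
  rewrite (_ : (fun n => _) = cst 0); first exact: cvg_cst.
  apply/funext => n; rewrite /= -[RHS](integral0 L setT); apply: eq_integral => x _.
  by rewrite /fprod big_nil mulr1 expr1 subrr normr0.
set m := size y in IH.
have ifa : \int[L]_x `|f x|%:E < +oo.
  under eq_integral => x _ do rewrite ger0_norm//.
  by rewrite integral_density1 ltry.
have tr := lebesgue_trans_cvg z mf ifa v0.
have M1 : 0 <= M%:E by rewrite lee_fin.
have M2 : 0 <= (M ^+ m.+1)%:E by rewrite lee_fin exprn_ge0.
have maff n : measurable_fun setT (fun x => f (affT (v n) x z)).
  apply: measurableT_comp => //; apply/measurable_fun_tnthP => i.
  rewrite (_ : _ \o _ = fun x => (tnth x i + v n * tnth z i)%R).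
    by apply: measurable_funD => //; exact: measurable_tnth.
  by apply/funext => x; rewrite /= tnth_mktuple.
have mP n y' : measurable_fun setT (fprod f (v n) y').
  by apply/measurable_EFinP; apply: (@measurable_fprod R d f mf (v n) _ _ (fun=> y') id) => //; exact: mlist_cst.
have mD1 n : measurable_fun setT (fun x => `|fprod f (v n) y x - f x ^+ m.+1|%:E).
  apply/measurable_EFinP; apply: measurableT_comp => //; apply: measurable_funB => //.
  exact: measurable_funX.
have mD2 n : measurable_fun setT (fun x => `|f (affT (v n) x z) - f x|%:E).
  by apply/measurable_EFinP; apply: measurableT_comp => //; exact: measurable_funB.
apply: (@squeeze_cvge _ _ _ _ (cst 0) _ (fun n => M%:E * \int[L]_x `|fprod f (v n) y x - f x ^+ m.+1|%:E
   + (M ^+ m.+1)%:E * \int[L]_x `|f (affT (v n) x z) - f x|%:E)).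
- apply: nearW => n; rewrite integral_ge0 /=; last by move=> x _; rewrite lee_fin.
  rewrite -!ge0_integralZl//; try by move=> x _; rewrite lee_fin.
  rewrite -ge0_integralD//; try by move=> x _; rewrite mule_ge0// lee_fin.
  + apply: ge0_le_integral => //.
    * by apply/measurable_EFinP; apply: measurableT_comp => //; apply: measurable_funB => //; exact: measurable_funX.
    * by apply: emeasurable_funD; apply: measurable_funeM.
    * move=> x _; rewrite -!EFinM -EFinD lee_fin.
      have -> : fprod f (v n) (z :: y) x = (f (affT (v n) x z) * fprod f (v n) y x)%R.
        by rewrite /fprod big_cons mulrCA.
      rewrite /= -/m [(f x ^+ m.+2)%R]exprSr.
      set a := f (affT _ _ _); set P := fprod _ _ _ _; set b := (f x ^+ m.+1)%R.
      have -> : (a * P - b * f x = a * (P - b) + b * (a - f x))%R by ring.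
      rewrite (le_trans (ler_normD _ _))// !normrM; apply: lerD; apply: ler_wpM2r => //.
        by rewrite /a ger0_norm.
      by rewrite /b ger0_norm ?exprn_ge0//; apply: lerXn2r; rewrite ?nnegrE.
  + by apply: measurable_funeM.
  + by apply: measurable_funeM.
- exact: cvg_cst.
- rewrite -[X in _ --> X](_ : M%:E * 0 + (M ^+ m.+1)%:E * 0 = 0); last by rewrite !mule0 adde0.
  apply: cvgeD; first by rewrite !mule0.
    exact: cvgeZl.
  exact: cvgeZl.
Qed.

Lemma integral_fprod_cvg (v : nat -> R) y : v n @[n --> \oo] --> 0%R ->
  \int[L]_x (fprod f (v n) y x)%:E @[n --> \oo] --> \int[L]_x (f x ^+ (size y).+1)%:E.
Proof.
move=> v0; apply: cvg_integral_L1.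
- move=> n; apply/measurable_EFinP; apply: (@measurable_fprod R d f mf (v n) _ _ (fun=> y) id) => //; exact: mlist_cst.
- exact: measurable_funX.
- by move=> n x; exact: fprod_ge0.
- by move=> x; rewrite exprn_ge0.
- exact: integral_densityX_fin.
- exact: fprod_cvg.
Qed.
End fprod_limit.

Section star_integral.
Variables (R : realType) (d j : nat).
Hypothesis d_gt0 : (0 < d)%N.
Notation T := (d.-tuple R).
Notation L := (@lebesgue R d).
Local Open Scope ereal_scope.

Lemma starc_ge0 (y : seq T) : 0 <= starc y.
Proof. by rewrite lee_fin. Qed.

(** A connected graph on the origin and j more points stays in a box around the origin by
    [conn_box]. *)
Lemma iint_starc_fin : iint L j (@starc R d) < +oo.
Proof.
have c0 : (0 <= j.+1%:R * 1 :> R)%R by rewrite mulr1.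
have mb := measurable_box (1 : R) j.+1%:R (origin d).
apply: (@le_lt_trans _ _ (iint L j (fun s => (all (box 1 j.+1%:R (origin d)) s)%:R%:E))).
  apply: le_iint.
  - exact: starc_ge0.
  - exact: mseq_starc.
  - exact: mseq_all.
  move=> s sj; rewrite /starc lee_fin ler_nat.
  case: (boolP (conn 1 (origin d :: s))) => //= cs.
  rewrite lt0b; apply/allP => y ys.
  rewrite -sj -[(size s).+1]/(size (origin d :: s)); apply: conn_box => //; rewrite inE ?eqxx ?ys ?orbT//.
by rewrite (iint_all_pow mb (lebesgue_box (origin d) c0)) ltry.
Qed.

(** With half-side 1 / d each squared coordinate is at most 1 / d, so the d of them sum to at most
    1. *)
Lemma box_nbr1 (y : T) : box 1 d%:R^-1 (origin d) y -> nbr 1 (origin d) y.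
Proof.
move=> /forallP by'; rewrite /nbr /Defs.edist -(sqrtr1 R) ler_wsqrtr//.
apply: (@le_trans _ _ (\sum_(i < d) (d%:R^-1))%R); last first.
  by rewrite sumr_const card_ord -[leLHS]mulr_natr mulVf// pnatr_eq0 -lt0n.
apply: ler_sum => i _; have := by' i; rewrite mulr1 => bi.
rewrite -real_normK ?num_real//.
apply: (@le_trans _ _ (d%:R^-1 ^+ 2)%R); first by apply: lerXn2r; rewrite ?nnegrE.
rewrite expr2 ler_piMl// invf_le1 ?ler1n// ltr0n//.
Qed.

Lemma conn_star (s : seq T) : all (nbr 1 (origin d)) s -> conn 1 (origin d :: s).
Proof.
move=> /allP H; apply/connP; split; first by exists (origin d); rewrite inE eqxx.
move=> q [u us qu] [v vs qv].
have N z : z \in origin d :: s -> nbr 1 (origin d) z.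
  rewrite inE => /predU1P[->|]; last exact: H.
  by apply: box_nbr1; apply/forallP => i; rewrite subrr normr0 mulr1 invr_ge0.
have o : origin d \in origin d :: s by rewrite inE eqxx.
have [qo|nqo] := boolP (q (origin d)).
  by exists (origin d), v; split => //; exact: N.
by exists u, (origin d); split => //; rewrite nbr_sym; exact: N.
Qed.

(** If all points lie in a small cube around the origin, each is within distance 1 of it and the
    graph contains a star; such configurations fill a set of positive volume. *)
Lemma iint_starc_gt0 : 0 < iint L j (@starc R d).
Proof.
have c0 : (0 <= d%:R^-1 * 1 :> R)%R by rewrite mulr1 invr_ge0.
have mb := measurable_box (1 : R) d%:R^-1 (origin d).
apply: (@lt_le_trans _ _ (iint L j (fun s => (all (box 1 d%:R^-1 (origin d)) s)%:R%:E))).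
  rewrite (iint_all_pow mb (lebesgue_box (origin d) c0)) lte_fin !exprn_gt0// !mulr_gt0//.
  by rewrite invr_gt0 ltr0n.
apply: le_iint.
- by move=> s; rewrite lee_fin.
- exact: mseq_all.
- exact: mseq_starc.
move=> s _; rewrite /starc lee_fin ler_nat.
case: (boolP (all _ s)) => //= /allP bs; rewrite lt0b.
by apply: conn_star; apply/allP => y ys; apply: box_nbr1; exact: bs.
Qed.
End star_integral.

(** For infinite [x] both sides are 0, as [fine] sends infinities to 0. *)
Lemma fine_scale (R : realType) (c : R) (x : \bar R) : 0 < c -> fine (c%:E * x)%E = c * fine x.
Proof. by case: x => [x||] c0 //=; rewrite ?gt0_muley ?gt0_muleNy ?lte_fin// mulr0. Qed.

Section limit.
Variables (R : realType) (d j : nat).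
Notation T := (d.-tuple R).
Notation L := (@lebesgue R d).
Variables (mu : probability T R) (f : T -> R) (M : R).
Local Open Scope ereal_scope.
Hypothesis mf : measurable_fun setT f.
Hypothesis f0 : forall x, (0 <= f x)%R.
Hypothesis fM : forall x, (f x <= M)%R.
Hypothesis muf : forall A, measurable A -> mu A = \int[L]_(x in A) (f x)%:E.

Lemma iint_starc_fprod_cvg (v : nat -> R) : v n @[n --> \oo] --> 0%R ->
  iint L j (fun y => starc y * \int[L]_x (fprod f (v n) y x)%:E) @[n --> \oo] -->
  iint L j (@starc R d) * \int[L]_x (f x ^+ j.+1)%:E.
Proof.
move=> v0.
have M0 := density_bound_ge0 f0 fM.
have mst : mseq (@starc R d) by exact: mseq_starc.
have fin := integral_densityX_fin mf f0 fM muf j.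
have ige0 n y : 0 <= \int[L]_x (fprod f (v n) y x)%:E.
  by apply: integral_ge0 => x _; rewrite lee_fin fprod_ge0.
have If0 : 0 <= \int[L]_x (f x ^+ j.+1)%:E by apply: integral_ge0 => x _; rewrite lee_fin exprn_ge0.
have mS : measurable_fun setT (fun t : j.-tuple T => starc t) by exact: mst.
have iM : (power_measure L j).-integrable setT (fun t : j.-tuple T => starc t * (M ^+ j)%:E).
  apply/integrableP; split; first exact: emeasurable_funM.
  under eq_integral => t _ do rewrite gee0_abs ?mule_ge0 ?starc_ge0 ?lee_fin ?exprn_ge0//.
  rewrite ge0_integralZr//; last 2 first.
  - by move=> t _; exact: starc_ge0.
  - by rewrite lee_fin exprn_ge0.
  by rewrite muleC lte_mul_pinfty ?lee_fin ?exprn_ge0//; exact: iint_starc_fin.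
have mI n : measurable_fun setT (fun t : j.-tuple T => starc t * \int[L]_x (fprod f (v n) t x)%:E).
  apply: emeasurable_funM => //.
  apply: (measurable_fun_fubini_tonelli_G (fun p : T * j.-tuple T => (fprod f (v n) p.2 p.1)%:E)) => /=.
    by apply: measurable_fprod => //; exact: mlist_tval.
  by move=> p; rewrite lee_fin fprod_ge0.
have [|||_ _ +] := @dominated_convergence _ _ _ (power_measure L j) setT measurableT
   (fun n (t : j.-tuple T) => starc t * \int[L]_x (fprod f (v n) t x)%:E)
   (fun t => starc t * \int[L]_x (f x ^+ j.+1)%:E) _ mI _ _ iM.
- by apply: emeasurable_funM.
- apply: aeW => t _; apply: cvgeZl; first by rewrite /starc.
  by have := @integral_fprod_cvg R d mu f M mf f0 fM muf v t v0; rewrite size_tuple.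
- apply: aeW => t n _; rewrite gee0_abs ?mule_ge0 ?starc_ge0//.
  apply: lee_wpmul2l; first exact: starc_ge0.
  by have := le_integral_fprod mf f0 fM muf (v n) t; rewrite size_tuple.
rewrite ge0_integralZr//.
by move=> t _; exact: starc_ge0.
Qed.

Lemma conn_int_cvg (r : nat -> R) : (\forall n \near \oo, (0 < r n)%R) ->
  r n @[n --> \oo] --> 0%R ->
  (fine (iint mu j.+1 (fun s => (conn (r n) s)%:R%:E)) / (r n ^+ d) ^+ j)%R @[n --> \oo] -->
  (fine (iint L j (@starc R d)) * fine (\int[L]_x (f x ^+ j.+1)%:E))%R.
Proof.
move=> r0 rc; have := iint_starc_fprod_cvg rc.
have fin1 : iint L j (@starc R d) \is a fin_num.
  by rewrite ge0_fin_numE ?iint_starc_fin//; apply: iint_ge0; exact: starc_ge0.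
have fin2 : \int[L]_x (f x ^+ j.+1)%:E \is a fin_num.
  rewrite ge0_fin_numE ?(integral_densityX_fin mf f0 fM muf)//.
  by apply: integral_ge0 => x _; rewrite lee_fin exprn_ge0.
rewrite -{1}(fineK fin1) -{1}(fineK fin2) -EFinM => /fine_cvgP[_].
apply: cvg_trans; apply: near_eq_cvg; apply: filterS r0 => n r0.
rewrite /= (conn_int_scale mf f0 muf)// fine_scale ?exprn_gt0//.
by rewrite mulrC mulKf// gt_eqF// !exprn_gt0.
Qed.
End limit.

(** * The law of the number of components *)

Section poisson_sets.
Variables (R : realType) (lam : R).
Hypothesis lam_gt0 : 0 < lam.

Lemma poisson_series_cvg (A : pred nat) :
  series (fun i => (A i)%:R * poisson_pmf lam i) n @[n --> \oo] -->
    fine (poisson_prob lam 0 [set i | A i]).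
Proof.
pose a i := (A i)%:R * poisson_pmf lam i.
have a0 i : 0 <= a i by rewrite mulr_ge0// poisson_pmf_ge0.
have nd : nondecreasing_seq (series a) by apply: nondecreasing_series => i _ _.
have cv : cvgn (series a).
  apply: nondecreasing_is_cvgn => //; exists 1 => _ [n _ <-].
  apply: (@le_trans _ _ (series (poisson_pmf lam) n)); last exact: series_poisson_le1.
  apply: ler_sum => i _; rewrite /a ler_piMl ?poisson_pmf_ge0//.
  by rewrite lern1 leq_b1.
rewrite (_ : fine _ = limn (series a))//.
rewrite /poisson_prob lam_gt0 esum_mkcond.
rewrite (_ : (fun i => _) = (fun i => (a i)%:E)); last first.
  apply/funext => i; rewrite /a; case: (boolP (A i)) => Ai.
    by rewrite ifT ?inE//= mul1r.
  by rewrite ifF ?mul0r//; apply/negbTE; rewrite notin_setE; exact/negP.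
have <- : (\sum_(i <oo) (a i)%:E = \esum_(i in setT) (a i)%:E)%E.
  rewrite nneseries_esum; last by move=> i _; rewrite lee_fin.
  by rewrite (_ : [set x : nat | xpredT x] = setT)//; apply/seteqP.
rewrite (_ : (fun n => _) = EFin \o series a).
  by rewrite EFin_lim.
by apply/funext => n; rewrite /= sumEFin.
Qed.

End poisson_sets.

(** With a the ratio of the square roots, |a^2 - 1| = |a - 1| (a + 1) is at least |a - 1|; the bound
    1/2 on [Q] keeps [V] away from 0. *)
Lemma sqrt_ratio_bounds (R : realType) (V lam Q : R) : 0 < lam -> Q <= 2^-1 -> `|V - lam| <= lam * Q ->
  [/\ 0 < V, 2^-1 <= Num.sqrt V / Num.sqrt lam & `|Num.sqrt V / Num.sqrt lam - 1| <= Q].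
Proof.
move=> l0 Q2 Vb; have : lam * Q <= lam * 2^-1 by rewrite ler_wpM2l// ltW.
move: (Vb); rewrite ler_norml => /andP[h1 h2] h3.
have V0 : 0 < V by lra.
set a := Num.sqrt V / Num.sqrt lam.
have a0 : 0 <= a by rewrite divr_ge0.
have aa : a * a = V / lam.
  by rewrite -expr2 /a exprMn exprVn !sqr_sqrtr ?ltW.
have Vl : `|V / lam - 1| <= Q.
  rewrite -[X in _ - X](divff (lt0r_neq0 l0)) -mulrBl normrM normfV (gtr0_norm l0).
  by rewrite ler_pdivrMr// mulrC.
have a2 : 2^-1 <= a.
  have : 2^-1 <= a * a by move: Vl; rewrite aa ler_norml; lra.
  move=> h; rewrite leNgt; apply/negP => ah; have : a * a <= 2^-1 * a by apply: ler_wpM2r => //; exact: ltW.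
  by move: (a * a) h ah a0 => y; lra.
split => //; apply: le_trans Vl; rewrite -aa.
rewrite (_ : a * a - 1 = (a - 1) * (a + 1)); last by ring.
by rewrite normrM ler_peMr// ger0_norm; lra.
Qed.

Section count.
Context dO (Omega : measurableType dO) (R : realType) (P : probability Omega R).
Variables (d k : nat) (X : nat -> {RV P >-> d.-tuple R}) (N : {RV P >-> nat}) (t r : R).
Hypothesis t_gt0 : 0 < t.
Hypothesis r_ge0 : 0 <= r.
Hypothesis X_indep : mutually_independent X.
Hypothesis X_ident : forall i A, measurable A ->
  distribution P (X i) A = distribution P (X 0%N) A.
Hypothesis N_poisson : forall B : set nat, distribution P N B = poisson_prob t 0 B.
Hypothesis N_indep : independent_of_sequence N X.
Let mu := distribution P (X 0%N).
Hypothesis mu_atomless : forall x, mu [set x] = 0%E.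
Variable beta : R.
Hypothesis beta_ge0 : 0 <= beta.
Hypothesis mu_box : forall x, (mu [set y | box r (2 * k.+1)%:R x y] <= beta%:E)%E.
Let Q : R := t ^+ k / k`!%:R * beta ^+ k.
Let S := nb_components X N r k : {RV P >-> R}.
Let cnt w := W r k (seqX X (N w) w).
Local Open Scope ereal_scope.

Lemma nb_componentsE w : nb_components X N r k w = (W r k (seqX X (N w) w))%:R.
Proof.
rewrite /nb_components /W; congr ((ncomponents _ _ _)%:R).
apply/fsetP => x; rewrite !inE; apply/imfsetP/mapP => [[i _ ->]|[i]].
  by exists (val i); rewrite ?mem_iota/=.
by rewrite mem_iota /= => iN ->; exists (Ordinal iN).
Qed.

Let SE w : S w = (cnt w)%:R.
Proof. exact: nb_componentsE. Qed.

Lemma integral_count (g : nat -> R) : (forall j, 0 <= g j)%R ->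
  \int[P]_w (g (cnt w))%:E = EW r mu t k g.
Proof.
move=> g0.
apply: (integral_sample t_gt0 X_indep X_ident N_poisson N_indep (F := fun s => (g (W r k s))%:E)).
- by move=> s; rewrite lee_fin.
- exact: mseq_W.
Qed.

Lemma prob_count (E : set R) : measurable E ->
  distribution P S E = EW r mu t k (fun j => (`[< E j%:R >])%:R).
Proof.
move=> mE; rewrite -integral_count//.
have mSE : measurable (S @^-1` E) by rewrite -[X in measurable X]setTI; exact: measurable_funP.
rewrite /distribution /pushforward -(setIT (S @^-1` E)) -integral_indic//.
apply: eq_integral => w _; rewrite indicE.
rewrite (_ : (w \in S @^-1` E) = `[< E (cnt w)%:R >])//.
by apply/idP/asboolP; rewrite inE /= SE.
Qed.

Variable lam : R.
Hypothesis lam_gt0 : (0 < lam)%R.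
Hypothesis EW_lam : EW r mu t k (fun j => j%:R) = lam%:E.

Lemma expectation_count : 'E_P[S] = lam%:E.
Proof.
rewrite unlock -EW_lam -integral_count//.
by apply: eq_integral => w _; rewrite SE.
Qed.

Lemma variance_count : exists2 V : R, 'V_P[S] = V%:E & (`|V - lam| <= lam * Q)%R.
Proof.
have [v vE vb] := EW_square mu_atomless t_gt0 r_ge0 beta_ge0 mu_box EW_lam.
exists (v - lam ^+ 2)%R; last by rewrite (_ : _ - _ = v - lam * (lam + 1))%R//; ring.
have VE : 'V_P[S] = EW r mu t k (fun j => (j%:R - lam) ^+ 2)%R.
  rewrite /variance covariance.unlock expectation_count unlock -integral_count; last first.
    by move=> j; exact: sqr_ge0.
  by apply: eq_integral => w _; rewrite /= /GRing.mul /= SE.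
have sq0 j : (0 <= (j%:R - lam) ^+ 2 :> R)%R by exact: sqr_ge0.
have lj0 (j : nat) : (0 <= 2 * lam * j%:R)%R by rewrite !mulr_ge0// ltW.
have jj0 j : (0 <= j%:R * j%:R :> R)%R by rewrite mulr_ge0.
have l0 : (0 <= lam ^+ 2)%R by exact: sqr_ge0.
(* The square is expanded with the cross term moved to the other side, so that only nonnegative
   functions are integrated. *)
have : EW r mu t k (fun j => (j%:R - lam) ^+ 2 + 2 * lam * j%:R)%R =
       EW r mu t k (fun j => j%:R * j%:R + lam ^+ 2)%R.
  by congr EW; apply/funext => j; ring.
rewrite EWD// EWD// EWZ ?mulr_ge0// ?ltW// EW_lam EW_cst// vE -VE.
case: ('V_P[S]) => //= w [] e; congr (_%:E).
by rewrite expr2; move: e; rewrite expr2; lra.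
Qed.

Let E_poisson (A : pred nat) : exists2 q : R, EW r mu t k (fun j => (A j)%:R) = q%:E &
  (`|q - fine (poisson_prob lam 0 [set i | A i])| <= Q)%R.
Proof. by apply: (EW_set mu_atomless t_gt0 r_ge0 beta_ge0 mu_box lam_gt0 EW_lam); exact: poisson_series_cvg. Qed.

Lemma dTV_count : (dTV (distribution P S) (poisson_law lam) <= Q)%R.
Proof.
apply: ge_sup.
  by exists `|fine (distribution P S setT) - fine (poisson_law lam setT)|%R; exists setT.
move=> _ [E mE <-]; have [q qE qb] := E_poisson (fun j => `[< E j%:R >]).
rewrite prob_count// qE /=; apply: le_trans qb.
rewrite le_eqVlt; apply/orP; left; apply/eqP; congr (`|_ - fine _|)%R.
rewrite /poisson_law /pushforward; congr poisson_prob.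
by apply/seteqP; split => j /= /asboolP.
Qed.

(** Three errors add up: [Q] from the Poisson approximation on a half-line, the Berry-Esseen term of
    the Poisson law standardized by its own variance lam, and the change of scale from lam to the
    true variance, where the ratio of standard deviations is within [Q] of 1. *)
Lemma dK_count : (1 <= lam)%R -> (Q <= 2^-1)%R ->
  (dK (distribution P (standardize S)) (normal_prob 0 1) <=
   Q + (be_cst R + 1 + normal_peak 1) / Num.sqrt lam + 2 * normal_peak 1 * Q)%R.
Proof.
move=> lam1 Q2; have [V VE Vb] := variance_count.
apply: ge_sup.
  by eexists; exists 0%R.
move=> _ [z _ <-].
have [V0 a2 a1] := sqrt_ratio_bounds lam_gt0 Q2 Vb.
set a := (Num.sqrt V / Num.sqrt lam)%R in a2 a1.
have sV : (0 < Num.sqrt V)%R by rewrite sqrtr_gt0.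
pose x := (lam + z * Num.sqrt V)%R.
have -> : distribution P (standardize S) `]-oo, z] = distribution P S `]-oo, x].
  rewrite /distribution /pushforward; congr (P _); apply/seteqP.
  have H w : (standardize S w <= z)%R = (S w <= x)%R.
    rewrite /standardize VE expectation_count /= mulrC ler_pdivrMr// lerBlDl//.
  by split => w; rewrite /= !in_itv /= H.
rewrite prob_count//.
rewrite (_ : (fun j => _) = fun j : nat => (j%:R <= x)%R%:R); last first.
  apply/funext => j; rewrite (_ : `[< _ >] = (j%:R <= x)%R)//.
  by apply/asboolP/idP; rewrite /= in_itv.
have [q -> qb] := E_poisson (fun j => j%:R <= x)%R.
have pb := poisson_normal lam1 (@poisson_series_cvg R lam lam_gt0 (fun j => j%:R <= x)%R).
have gb := gPhi_scale z a2.
have xa : ((x - lam) / Num.sqrt lam = a * z)%R.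
  by rewrite /x addrAC subrr add0r -mulrA mulrC.
rewrite xa in pb; rewrite /= -/(gPhi z).
set p := fine (poisson_prob _ _ _) in qb pb.
have np0 := normal_peak_ge0 (1 : R).
rewrite (_ : q - gPhi z = (q - p) + (p - gPhi (a * z)) + (gPhi (a * z) - gPhi z))%R; last by ring.
apply: (le_trans (ler_normD _ _)); apply: lerD.
  by apply: (le_trans (ler_normD _ _)); exact: lerD.
by apply: (le_trans gb); apply: ler_wpM2l => //; rewrite mulr_ge0.
Qed.
End count.

Section mean_real.
Variables (R : realType) (d : nat) (r : R).
Notation T := (d.-tuple R).
Variable mu : probability T R.
Hypothesis mu_atomless : forall x, mu [set x] = 0%E.
Variables (t : R) (k : nat) (beta : R).
Hypotheses (t_gt0 : 0 < t) (r_ge0 : 0 <= r) (beta_ge0 : 0 <= beta).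
Hypothesis mu_box : forall x, (mu [set y | box r (2 * k.+1)%:R x y] <= beta%:E)%E.

Lemma mean_real : let J := t ^+ k / k`!%:R * fine (iint mu k (fun a => (conn r a)%:R%:E)) in
  exists lam, [/\ EW r mu t k (fun j => j%:R) = lam%:E, lam <= J & J <= lam + t * beta * J].
Proof.
move=> J; have [] := mean_bounds mu_atomless t_gt0 r_ge0 beta_ge0 mu_box.
have b0 (s : seq T) : (0 <= (conn r s)%:R%:E :> \bar R)%E by rewrite lee_fin.
have I0 : (0 <= iint mu k (fun a => (conn r a)%:R%:E))%E by exact: iint_ge0.
have I1 : (iint mu k (fun a => (conn r a)%:R%:E) <= 1)%E.
  have mT : measurable [set x : T | xpredT x] by rewrite (_ : [set _ | _] = setT)//; apply/seteqP.
  have pT : (mu [set x : T | xpredT x] = 1%:E)%E.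
    by rewrite (_ : [set _ | _] = setT) ?probability_setT//; apply/seteqP.
  have := iint_all_pow mT pT k; rewrite expr1n => <-; apply: le_iint => //.
  - exact: mseq_conn.
  - exact: mseq_all.
  - by move=> s _; rewrite all_predT lee_fin lern1 leq_b1.
have Ifin : iint mu k (fun a => (conn r a)%:R%:E) \is a fin_num.
  by rewrite ge0_fin_numE//; apply: le_lt_trans I1 (ltry _).
rewrite -(fineK Ifin) -!EFinM -/J => h1 h2.
have Efin : EW r mu t k (fun j => j%:R) \is a fin_num.
  by rewrite ge0_fin_numE ?EW_ge0//; apply: le_lt_trans h1 (ltry _).
exists (fine (EW r mu t k (fun j => j%:R))); rewrite fineK//.
by move: h1 h2; rewrite -(fineK Efin) -EFinD !lee_fin; split.
Qed.
End mean_real.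

(** * Passage to the limit *)

Lemma sup_nneg (R : realType) (A : set R) : (forall a, A a -> 0 <= a) -> 0 <= sup A.
Proof.
(* A set without a supremum is given the value 0 by [sup]. *)
move=> A0; have [hs|ns] := pselect (has_sup A); last by rewrite sup_out.
have [[a Aa] ub] := hs; apply: (le_trans (A0 a Aa)).
exact: ub_le_sup.
Qed.

Lemma dTV_ge0 (R : realType) (mu nu : set R -> \bar R) : 0 <= dTV mu nu.
Proof. by apply: sup_nneg => _ [E _ <-]. Qed.

Lemma dK_ge0 (R : realType) (mu nu : set R -> \bar R) : 0 <= dK mu nu.
Proof. by apply: sup_nneg => _ [E _ <-]. Qed.

(** For n >= 1, r^d is at most n r^d, and d > 0 allows the root to be taken. *)
Lemma cvg0_root (R : realType) (d : nat) (r : nat -> R) : (0 < d)%N ->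
  (forall n, (0 < n)%N -> 0 < r n) -> n%:R * r n ^+ d @[n --> \oo] --> 0 ->
  r n @[n --> \oo] --> 0.
Proof.
move=> d0 r0 nr; apply/cvgr0Pnorm_lt => e e0.
have ed : 0 < e ^+ d by rewrite exprn_gt0.
move: nr => /cvgr0Pnorm_lt/(_ _ ed) H; near=> n.
have n0 : (0 < n)%N by near: n; exists 1%N.
have rn := r0 n n0; rewrite gtr0_norm//.
have Hn : `|n%:R * r n ^+ d| < e ^+ d by near: n.
rewrite -(ltr_pXn2r d0) ?nnegrE ?ltW//; apply: le_lt_trans Hn.
have p : 0 <= r n ^+ d by rewrite exprn_ge0// ltW.
by rewrite normrM (ger0_norm p) normr_nat ler_peMl// ler1n.
Unshelve. all: by end_near. Qed.

Lemma be_cst_ge0 (R : realType) : 0 <= be_cst R.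
Proof. by rewrite /be_cst; have := mills_ge1 R; lra. Qed.

Theorem mainTheorem10 (R : realType) (dO : measure_display)
    (Omega : measurableType dO) (P : probability Omega R)
    (d k : nat) (d_gt0 : (0 < d)%N) (k_gt0 : (0 < k)%N)
    (f : d.-tuple R -> R)
    (f_measurable : measurable_fun setT f)
    (f_ge0 : forall x, 0 <= f x)
    (f_bounded : exists M : R, forall x, f x <= M)
    (X : nat -> {RV P >-> d.-tuple R})
    (X_independent : mutually_independent X)
    (X_density : forall i, has_density (X i) f)
    (Z : nat -> {RV P >-> nat})
    (Z_poisson : forall n, (0 < n)%N ->
       forall B : set nat, distribution P (Z n) B = poisson_prob n%:R 0 B)
    (Z_independent : forall n, (0 < n)%N -> independent_of_sequence (Z n) X)
    (r : nat -> R) (r_gt0 : forall n, (0 < n)%N -> 0 < r n)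
    (nrd_to0 : (n%:R * r n ^+ d) @[n --> \oo] --> (0 : R))
    (mean_toy :
       (n%:R * (n%:R * r n ^+ d) ^+ k.-1) @[n --> \oo] --> +oo) :
  let S n : {RV P >-> R} := nb_components X (Z n) (r n) k in
  let ES n : R := fine 'E_P[S n] in
  let VS n : R := fine 'V_P[S n] in
  let rho n : R := n%:R * r n ^+ d in
  [/\ (ES n / (k`!%:R^-1 * (n%:R * rho n ^+ k.-1)
          * (\int[lebesgue d]_x (f x ^+ k))
          * (\int[power_measure (lebesgue d) k.-1]_x h1 x)))
        @[n --> \oo] --> (1 : R),
      exists2 e : nat -> R, e =O_\oo (fun n => rho n ^+ k) &
        \forall n \near \oo, VS n = ES n * (1 + e n),
      (fun n => dTV (distribution P (S n)) (poisson_law (ES n)))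
        =O_\oo (fun n => rho n ^+ k) &
      (fun n => dK (distribution P (standardize (S n)))
                   (normal_prob (0 : R) 1))
        =O_\oo (fun n => Num.max (rho n ^+ k)
                           (Num.sqrt (n%:R * rho n ^+ k.-1))^-1)].
Proof.
case: k k_gt0 mean_toy => [//|j] _ mean_toy S ES VS rho.
rewrite /= -/(rho _) in mean_toy.
have [M fM] := f_bounded.
pose mu : probability (d.-tuple R) R := distribution P (X 0%N).
have muf A : measurable A -> mu A = (\int[lebesgue d]_(x in A) (f x)%:E)%E.
  exact: X_density.
have X_ident i A : measurable A -> distribution P (X i) A = distribution P (X 0%N) A.
  by move=> mA; rewrite !X_density.
have M0 := density_bound_ge0 f_ge0 fM.
have atom x := density_atomless f_measurable muf x d_gt0.
(* For k = j + 1 the box in the Stein bounds has half-side 2 (k + 1) r, hence volume (4 (k + 1)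
   r)^d, and the density is at most [M]. *)
pose C1 : R := M * (2 * (2 * j.+2)%:R) ^+ d.
have C10 : 0 <= C1 by rewrite mulr_ge0// exprn_ge0// mulr_ge0.
pose beta n : R := C1 * r n ^+ d.
have beta0 n : (0 < n)%N -> 0 <= beta n.
  by move=> n0; rewrite mulr_ge0// exprn_ge0// ltW// r_gt0.
have mbox n : (0 < n)%N -> forall x, (mu [set y | box (r n) (2 * j.+2)%:R x y] <= (beta n)%:E)%E.
  move=> n0 x; rewrite (_ : beta n = M * (2 * ((2 * j.+2)%:R * r n)) ^+ d).
    by apply: (density_box f_measurable f_ge0 fM muf); rewrite mulr_ge0// ltW// r_gt0.
  by rewrite /beta /C1 mulrA (exprMn _ (2 * _)) mulrA.
(* Chosen so that the Stein error at stage n is [cQ] times rho^k. *)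
pose cQ : R := C1 ^+ j.+1 / (j.+1)`!%:R.
have cQ0 : 0 <= cQ by rewrite divr_ge0// exprn_ge0.
have rho_gt0 n : (0 < n)%N -> 0 < rho n.
  by move=> n0; rewrite mulr_gt0 ?ltr0n// exprn_gt0// r_gt0.
have QE n : n%:R ^+ j.+1 / (j.+1)`!%:R * beta n ^+ j.+1 = cQ * rho n ^+ j.+1.
  by rewrite /beta /cQ /rho !exprMn; ring.
have r0 : r n @[n --> \oo] --> 0 by exact: cvg0_root nrd_to0.
pose If : R := fine (\int[lebesgue d]_x (f x ^+ j.+1)%:E)%E.
pose Ih : R := fine (iint (lebesgue d) j (@starc R d)).
have If0 : 0 < If.
  rewrite fine_gt0// (integral_densityX_gt0 f_measurable f_ge0 muf)/=.
  exact: (integral_densityX_fin f_measurable f_ge0 fM muf).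
have Ih0 : 0 < Ih by rewrite fine_gt0// iint_starc_gt0//= iint_starc_fin.
(* The probability that k random points form a connected graph, divided by the power of r with which
   it scales. *)
pose q n : R := fine (iint mu j.+1 (fun s => (conn (r n) s)%:R%:E)) / (r n ^+ d) ^+ j.
have qc : q n @[n --> \oo] --> Ih * If.
  apply: (conn_int_cvg f_measurable f_ge0 fM muf) => //.
  by exists 1%N => // n /= n0; exact: r_gt0.
pose cD : R := (j.+1)`!%:R^-1 * If * Ih.
have cD0 : 0 < cD by rewrite !mulr_gt0// invr_gt0 ltr0n fact_gt0.
(* The denominator of the first claim, with [Ih] the integral of [h1] in its list form. *)
pose D n : R := (j.+1)`!%:R^-1 * (n%:R * rho n ^+ j) * If * Ih.
have DE n : D n = cD * (n%:R * rho n ^+ j) by rewrite /D /cD; ring.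
have D0 n : (0 < n)%N -> 0 < D n.
  by move=> n0; rewrite DE mulr_gt0// mulr_gt0 ?ltr0n// exprn_gt0// rho_gt0.
(* [D n * (q n / (Ih * If))] is the mean number of connected k-subsets; [C1 * rho n] is n beta, a
   bound for the mean number of points in the box. *)
have mean n : (0 < n)%N -> [/\ EW (r n) mu n%:R j.+1 (fun i => i%:R) = (ES n)%:E,
    ES n <= D n * (q n / (Ih * If)) &
    D n * (q n / (Ih * If)) * (1 - C1 * rho n) <= ES n].
  move=> n0; have n1 : 0 < n%:R :> R by rewrite ltr0n.
  have rn := r_gt0 n n0.
  have [lam [lamE]] := mean_real atom n1 (ltW rn) (beta0 n n0) (mbox n n0).
  have -> : n%:R ^+ j.+1 / (j.+1)`!%:R * fine (iint mu j.+1 (fun s => (conn (r n) s)%:R%:E)) =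
    D n * (q n / (Ih * If)).
    rewrite /D /q /rho exprMn exprS; field.
    by rewrite !gt_eqF ?exprn_gt0 ?ltr0n ?fact_gt0.
  have -> : n%:R * beta n = C1 * rho n by rewrite /beta /rho; ring.
  move=> h1 h2; have -> : ES n = lam.
    by rewrite /ES (expectation_count n1 X_independent X_ident (Z_poisson n n0) (Z_independent n n0) lamE).
  by split => //; lra.
have part1 : ES n / D n @[n --> \oo] --> (1 : R).
  pose u n := q n / (Ih * If).
  have uc : u n @[n --> \oo] --> (1 : R).
    rewrite -(divff (lt0r_neq0 (mulr_gt0 Ih0 If0))).
    by apply: cvgM => //; exact: cvg_cst.
  have lc : u n * (1 - C1 * rho n) @[n --> \oo] --> (1 : R).
    rewrite -[X in _ --> X](_ : 1 * (1 - C1 * 0) = 1 :> R); last by rewrite mulr0 subr0 mulr1.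
    apply: cvgM => //; apply: cvgB; first exact: cvg_cst.
    by apply: cvgM => //; exact: cvg_cst.
  apply: (squeeze_cvgr _ lc uc); exists 1%N => // n /= n0.
  have [_ h1 h2] := mean n n0; have Dn := D0 n n0.
  by rewrite ler_pdivlMr// ler_pdivrMr// mulrC mulrA -/(u n) h2 (mulrC (u n)) h1.
(* The bounds at fixed n ask for a mean of at least 1 and an error of at most 1/2; both hold
   eventually, as n rho^(k-1) tends to infinity and rho to 0. The factor 1/2 in the third clause
   comes from ES / D > 1/2. *)
have good : \forall n \near \oo, [/\ (0 < n)%N, 1 <= ES n,
    cD / 2 * (n%:R * rho n ^+ j) <= ES n & cQ * rho n ^+ j.+1 <= 2^-1].
  have Qc : cQ * rho n ^+ j.+1 @[n --> \oo] --> (0 : R).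
    rewrite -[X in _ --> X](_ : cQ * 0 ^+ j.+1 = 0 :> R); last by rewrite expr0n mulr0.
    apply: cvgM; first exact: cvg_cst.
    exact: (@continuous_cvg _ _ _ _ _ rho (fun x : R => x ^+ j.+1) 0 (@exprn_continuous R j.+1 0) nrd_to0).
  have h2 : (0 : R) < 2^-1 by rewrite invr_gt0.
  have h21 : 2^-1 < (1 : R) by rewrite invf_lt1// ltr1n.
  near=> n; have n0 : (0 < n)%N by near: n; exists 1%N.
  have Dn := D0 n n0.
  have H1 : 2^-1 < ES n / D n by near: n; exact: (cvgr_gt _ part1).
  have H2 : 2 / cD <= n%:R * rho n ^+ j by near: n; move/cvgryPge: mean_toy; exact.
  have H3 : cQ * rho n ^+ j.+1 < 2^-1 by near: n; exact: (cvgr_lt _ Qc).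
  rewrite ltr_pdivlMr// in H1.
  have H4 : cD / 2 * (n%:R * rho n ^+ j) <= ES n.
    by apply: le_trans (ltW H1); rewrite DE (_ : _ / 2 * _ = 2^-1 * (cD * (n%:R * rho n ^+ j)))//; ring.
  split => //; last exact: ltW.
  apply: le_trans H4; rewrite ler_pdivrMr// in H2.
  by rewrite mulrAC ler_pdivlMr// mul1r mulrC.
have one n : (0 < n)%N -> 1 <= ES n -> [/\ `|VS n - ES n| <= ES n * (cQ * rho n ^+ j.+1),
    dTV (distribution P (S n)) (poisson_law (ES n)) <= cQ * rho n ^+ j.+1 &
    (cQ * rho n ^+ j.+1 <= 2^-1 -> dK (distribution P (standardize (S n))) (normal_prob (0 : R) 1) <=
      cQ * rho n ^+ j.+1 + (be_cst R + 1 + normal_peak 1) / Num.sqrt (ES n)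
      + 2 * normal_peak 1 * (cQ * rho n ^+ j.+1))].
  move=> n0 ES1; have n1 : 0 < n%:R :> R by rewrite ltr0n.
  have rn := r_gt0 n n0; have [lamE _ _] := mean n n0.
  have ES0 : 0 < ES n by apply: lt_le_trans ES1.
  rewrite -QE; split.
  - have [V VE Vb] := variance_count n1 (ltW rn) X_independent X_ident (Z_poisson n n0) (Z_independent n n0)
      atom (beta0 n n0) (mbox n n0) ES0 lamE.
    by rewrite /VS VE.
  - exact: (dTV_count n1 (ltW rn) X_independent X_ident (Z_poisson n n0) (Z_independent n n0)
      atom (beta0 n n0) (mbox n n0) ES0 lamE).
  - exact: (dK_count n1 (ltW rn) X_independent X_ident (Z_poisson n n0) (Z_independent n n0)
      atom (beta0 n n0) (mbox n n0) ES0 lamE).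
split.
- exact: part1.
(* The claimed equation solved for the error; it is then an identity wherever the mean is
   nonzero. *)
- exists (fun n => VS n / ES n - 1).
    (* The added 1 makes the constant strictly positive, as the characterization of O requires. *)
    apply/eqO_exP; exists (cQ + 1); first by rewrite ltr_wpDl.
    apply: filterS good => n [n0 ES1 _ _].
    have [Vb _ _] := one n n0 ES1.
    have ES0 : 0 < ES n by apply: lt_le_trans ES1.
    have rk : 0 <= rho n ^+ j.+1 by rewrite exprn_ge0// ltW// rho_gt0.
    rewrite (ger0_norm rk) -{1}(divff (lt0r_neq0 ES0)) -mulrBl normrM normfV (gtr0_norm ES0).
    rewrite ler_pdivrMr// (le_trans Vb)// mulrC ler_wpM2r ?ler_wpM2r// ?lerDl// ltW//.
  apply: filterS good => n [n0 ES1 _ _].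
  have ES0 : 0 < ES n by apply: lt_le_trans ES1.
  by field; rewrite gt_eqF.
- apply/eqO_exP; exists (cQ + 1); first by rewrite ltr_wpDl.
  apply: filterS good => n [n0 ES1 _ _].
  have [_ Tb _] := one n n0 ES1.
  have rk : 0 <= rho n ^+ j.+1 by rewrite exprn_ge0// ltW// rho_gt0.
  rewrite (ger0_norm rk) ger0_norm ?dTV_ge0// (le_trans Tb)// ler_wpM2r// lerDl//.
(* One summand for each error in [dK_count]; [Num.sqrt (cD / 2)] converts the square root of the
   mean into that of n rho^(k-1), by the third clause of [good]. *)
- pose K := cQ + (be_cst R + 1 + normal_peak 1) / Num.sqrt (cD / 2) + 2 * normal_peak 1 * cQ.
  have np0 := normal_peak_ge0 (1 : R).
  have bc0 : 0 <= be_cst R + 1 + normal_peak 1.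
    by rewrite addr_ge0// addr_ge0// be_cst_ge0.
  have K0 : 0 <= K.
    by rewrite /K; apply: addr_ge0; [apply: addr_ge0 => //; exact: divr_ge0|apply: mulr_ge0 => //; exact: mulr_ge0].
  apply/eqO_exP; exists (K + 1); first by rewrite ltr_wpDl.
  apply: filterS good => n [n0 ES1 ESD Q2].
  have [_ _ /(_ Q2) Kb] := one n n0 ES1.
  have rk : 0 <= rho n ^+ j.+1 by rewrite exprn_ge0// ltW// rho_gt0.
  set mx := Num.max _ _.
  have m1 : rho n ^+ j.+1 <= mx by rewrite le_max lexx.
  have m2 : (Num.sqrt (n%:R * rho n ^+ j))^-1 <= mx by rewrite le_max lexx orbT.
  have mx0 : 0 <= mx by apply: le_trans m1.
  have nr0 : 0 < n%:R * rho n ^+ j by rewrite mulr_gt0 ?ltr0n// exprn_gt0// rho_gt0.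
  have c2 : 0 < cD / 2 by rewrite divr_gt0.
  rewrite (ger0_norm mx0) ger0_norm ?dK_ge0// (le_trans Kb)//.
  apply: (@le_trans _ _ (K * mx)); last by rewrite ler_wpM2r// lerDl.
  have -> : K * mx = cQ * mx + (be_cst R + 1 + normal_peak 1) / Num.sqrt (cD / 2) * mx +
    2 * normal_peak 1 * cQ * mx by rewrite /K; ring.
  apply: lerD; first apply: lerD.
  + exact: ler_wpM2l.
  + rewrite -mulrA; apply: ler_wpM2l => //.
    apply: (@le_trans _ _ ((Num.sqrt (cD / 2))^-1 * (Num.sqrt (n%:R * rho n ^+ j))^-1)); last first.
      by apply: ler_wpM2l => //; rewrite invr_ge0 sqrtr_ge0.
    have ES0 : 0 < ES n by exact: lt_le_trans ES1.
    rewrite -invfM -sqrtrM; last exact: ltW.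
    rewrite lef_pV2 ?posrE ?sqrtr_gt0 ?(mulr_gt0 c2)//.
    exact: ler_wsqrtr.
  + by rewrite -[leRHS]mulrA; apply: ler_wpM2l; [rewrite mulr_ge0|exact: ler_wpM2l].
Unshelve. all: by end_near. Qed.
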